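(* Let $(\Gamma,d_0)$ be a compact metric space with $d_0\le 1$ and let $\Xi_1,\dots,\Xi_n$ be independent and identically distributed point processes on $\Gamma$, with mean measure $\lambda(dx)=\mathbb{E}\,\Xi_1(dx)$ and factorial moments $\theta_r=\mathbb{E}[|\Xi_1|(|\Xi_1|-1)\cdots(|\Xi_1|-r+1)]$, $r\in\{1,2,3,\dots\}$. Assume one of the following two cases holds and define $b$ and $\beta$ accordingly. Case 1: $\mathrm{Var}(|\Xi_1|)\ge \mathbb{E}|\Xi_1|$. Put $b=\dfrac{\theta_2-\theta_1^2}{\theta_2-\theta_1^2+\theta_1}$ and $\beta=0$. Case 2: either $\frac12\mathbb{E}|\Xi_1|<\mathrm{Var}(|\Xi_1|)<\mathbb{E}|\Xi_1|$, or $\frac12\mathbb{E}|\Xi_1|=\mathrm{Var}(|\Xi_1|)$ and $\theta_3>\theta_2(\theta_1-1)$. Put $b=0$ and $$\beta=\frac{\theta_1^2-\theta_2}{(n-1)\theta_1[\theta_1-2(\theta_1^2-\theta_2)]+(\theta_3+\theta_2-\theta_1\theta_2)}.$$ In both cases put $$a=n\left[(1-b)\theta_1+\beta\theta_2+\beta(n-1)\theta_1^2\right],\qquad \mu(dx)=\frac{1+\beta\,\mathbb{E}|\Xi_{1,x}|+\beta(n-1)\theta_1}{\theta_1+\beta[\theta_2+(n-1)\theta_1^2]}\,\lambda(dx),$$ where $\Xi_{1,x}$ is the reduced Palm process of $\Xi_1$ at $x$. Then, in both cases, there exist a constant $C$, depending on the law of $\Xi_1$, and $0<\rho<1$ such that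 for any $\varepsilon>0$, $$d_2\Big(\mathscr{L}\Big(\sum_{k=1}^n\Xi_k\Big),\boldsymbol{\pi}_{a,b;\beta;\mu}\Big)\le 2\varepsilon+C\,\vartheta_\varepsilon\Big(\sum_{k=1}^{n-2}\Xi_k\Big)+Cn\,\mathbb{P}\Big(\sum_{k=1}^{n-2}|\Xi_k|\le\rho(n-2)\theta_1\Big)$$ $$\le 2\varepsilon+C\,\vartheta_\varepsilon\Big(\sum_{k=1}^{n-2}\Xi_k\Big)+O(n^{-1/2})$$ for $n>2$ in Case 1 and for $n>1+\max\left\{\dfrac{\theta_1\theta_2-\theta_2-\theta_3}{\theta_1(\theta_1-2(\theta_1^2-\theta_2))},0\right\}$ in Case 2. In particular, for the same range of $n$, $$d_2\Big(\mathscr{L}\Big(\sum_{k=1}^n\Xi_k\Big),\boldsymbol{\pi}_{a,b;\beta;\mu}\Big)\le (C+1)\,2\varepsilon_{n-2}+Cn\,\mathbb{P}\Big(\sum_{k=1}^{n-2}|\Xi_k|\le\rho(n-2)\theta_1\Big)\le (C+1)\,2\varepsilon_{n-2}+O(n^{-1/2}),$$ where $\varepsilon_n=\inf\{v:\ 2v\ge\vartheta_v(\sum_{k=1}^n\Xi_k)\}$.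
   Context: Configurations and point processes. A configuration on $\Gamma$ is a finite nonnegative-integer-valued measure $\xi=\sum_{i=1}^{|\xi|}\delta_{x_i}$ on the Borel sets of $\Gamma$, where $|\rho|$ denotes the total mass of a measure $\rho$ and $\delta_x$ the Dirac measure at $x$. $\mathscr{H}$ is the set of configurations, with the $\sigma$-algebra $\mathscr{B}(\mathscr{H})$ generated by the maps $\xi\mapsto\xi(B)$, $B$ Borel. A point process is a random element of $\mathscr{H}$; $\mathscr{L}(\cdot)$ denotes its law. An empty sum of point processes is the zero configuration. Reduced Palm processes. For a point process $\Xi$ with finite mean measure $\lambda(dx)=\mathbb{E}\,\Xi(dx)$, the reduced Palm processes $\{\Xi_x:x\in\Gamma\}$ are point processes such that for all measurable $f:\Gamma\times\mathscr{H}\to[0,\infty)$, $\mathbb{E}\int_\Gamma f(x,\Xi-\delta_x)\,\Xi(dx)=\int_\Gamma\mathbb{E}f(x,\Xi_x)\,\lambda(dx)$. $\Xi_{1,x}$ denotes the reduced Palm process of $\Xi_1$ at $x$. Metrics $d_1,d_2$. For configurations $\xi_1=\sum_{i=1}^{m}\delta_{x_{1i}}$, $\xi_2=\sum_{i=1}^{m}\delta_{x_{2i}}$ with the same mass $m\ge1$, $d_1(\xi_1,\xi_2)=\min_{\sigma}\frac1m\sum_{i=1}^m d_0(x_{1i},x_{2\sigma(i)})$ over permutations $\sigma$ of $\{1,\dots,m\}$; $d_1=1$ if the masses differ and $d_1=0$ if both masses are $0$. For probability measures $\mathbf{P},\mathbf{Q}$ on $\mathscr{H}$, $d_2(\mathbf{P},\mathbf{Q})=\sup_f|\int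 f\,d\mathbf{P}-\int f\,d\mathbf{Q}|$ over all $f:\mathscr{H}\to\mathbb{R}$ with $|f(\xi)-f(\eta)|\le d_1(\xi,\eta)$ for all $\xi,\eta\in\mathscr{H}$; equivalently $d_2(\mathbf{P},\mathbf{Q})=\inf\mathbb{E}\,d_1(\mathcal{W},\mathcal{Z})$ over couplings $\mathcal{W}\sim\mathbf{P}$, $\mathcal{Z}\sim\mathbf{Q}$. Partitional total variation. For a finite partition $\mathscr{G}=\{G_i:i\in I\}$ of $\Gamma$ into Borel sets, choose centers $t_i\in\arg\min_{x\in\Gamma}\sup_{s\in G_i}d_0(s,x)$ and put $d_0(G_i,t_i)=\sup_{s\in G_i}d_0(s,t_i)$, $d_0(\mathscr{G})=\max_{i\in I}d_0(G_i,t_i)$. $\mathscr{G}$ is an $\varepsilon$-partition if $d_0(\mathscr{G})\le\varepsilon$; $\mathscr{P}_\varepsilon$ is the set of all $\varepsilon$-partitions. The assembling mapping is $\mathscr{M}_{\mathscr{G}}\circ\eta=\sum_{i\in I}\eta(G_i)\delta_{t_i}$. For a point process $\mathcal{W}$, $\mathrm{TV}_{\mathscr{G}}(\mathcal{W})=\max_{i\in I}d_{tv}(\mathscr{L}(\mathscr{M}_{\mathscr{G}}\circ\mathcal{W}+\delta_{t_i}),\mathscr{L}(\mathscr{M}_{\mathscr{G}}\circ\mathcal{W}))$, where $d_{tv}(\mathbf{P},\mathbf{Q})=\sup_{A\in\mathscr{B}(\mathscr{H})}|\mathbf{P}(A)-\mathbf{Q}(A)|$, and $\vartheta_\varepsilon(\mathcal{W})=\inf_{\mathscr{G}\in\mathscr{P}_\varepsilon}\mathrm{TV}_{\mathscr{G}}(\mathcal{W})$.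 Polynomial birth-death point process. For $a>0$, $0\le b<1$, $\beta\ge0$, $\pi_{a,b;\beta}$ is the probability distribution on $\{0,1,2,\dots\}$ with $\pi_{a,b;\beta}(0)=c$ and $\pi_{a,b;\beta}(i+1)=c\prod_{j=0}^{i}\frac{a+bj}{(j+1)(1+\beta j)}$ for $i\ge0$, where $c$ is the normalizing constant. For a probability measure $\mu$ on $\Gamma$, $\boldsymbol{\pi}_{a,b;\beta;\mu}$ is the law of $\sum_{j=1}^{Z}\delta_{U_j}$, where $Z,U_1,U_2,\dots$ are independent, $Z\sim\pi_{a,b;\beta}$ and each $U_j\sim\mu$. The $O(n^{-1/2})$ terms are as $n\to\infty$. The parameters $\beta$, $a$ and $\mu$ may depend on $n$. In the second alternative of Case 2 the denominator of the fraction in the range of $n$ is zero and its numerator is negative; the fraction is then read as $-\infty$.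
   Formalization: The third factorial moment θ_3 of |Ξ_1| is assumed finite in both cases; the English leaves this implicit, and in Case 1 the bound fails for some laws with θ_3 infinite (e.g. Γ a single point and |Ξ_1| with tail index 5/2). *)

(* Defs.v *)
From HB Require Import structures.
From mathcomp Require Import all_boot all_order all_algebra all_fingroup.
From mathcomp Require Import finmap multiset.
From mathcomp Require Import all_classical all_reals all_analysis.
From mathcomp Require Import measurable_realfun.

Set Implicit Arguments.
Unset Strict Implicit.
Unset Printing Implicit Defensive.

Import Order.TTheory GRing.Theory Num.Theory.
Import numFieldNormedType.Exports.

Local Open Scope classical_set_scope.
Local Open Scope ring_scope.

(* The point plays no role in the mathematics: it only witnesses that the space
   is nonempty, as required by [measurableType]. *)
#[short(type="pointedMetricType")]
HB.structure Definition PointedMetric (K : numDomainType) :=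
  {M of Pointed M & Metric K M}.

Definition borel {R : realType} (T : pointedMetricType R) :=
  g_sigma_algebraType (@open T).

(* The configuration [\sum_i \d_(x_i)] is represented by the multiset of the
   points x_i ([cfg_measureE] recovers the measure): [mset0], [msetD] and
   [msetn k x] are the zero measure, the sum of measures and k times the Dirac
   measure at x, and [seq_mset [:: x_1; ...; x_m]] is [\sum_i \d_(x_i)]. *)
Section configurations.
Context {R : realType} (T : pointedMetricType R).

HB.instance Definition _ := Choice.on (multiset T).
HB.instance Definition _ := isPointed.Build (multiset T) (@mset0 T).

Definition cfg_count (B : set T) (xi : multiset T) : nat :=
  count (fun x => x \in B) xi.

Definition cfg_gen : set (set (multiset T)) :=
  [set S | exists B : set T, measurable (B : set (borel T)) /\
           exists A : set nat, S = cfg_count B @^-1` A].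

Definition config := g_sigma_algebraType cfg_gen.

Definition cfg_points (xi : config) : seq T := enum_mset (xi : multiset T).

Definition mass (xi : config) : nat := size (cfg_points xi).

Definition cfg_add (xi eta : config) : config :=
  msetD (xi : multiset T) (eta : multiset T).

Definition cfg_remove (xi : config) (x : T) : config :=
  msetB (xi : multiset T) (msetn 1%N x).

Definition cfg_measure (xi : config) : {measure set (borel T) -> \bar R} :=
  msum (fun i => dirac (nth point (cfg_points xi) i : borel T)) (mass xi).

Lemma cfg_measureE (B : set T) (xi : config) :
  cfg_measure xi B = (cfg_count B xi)%:R%:E.
Proof.
rewrite /cfg_measure /mass /cfg_count /= /msum.
have -> : enum_mset (xi : multiset T) = cfg_points xi by [].
rewrite -(big_mkord xpredT
  (fun i => dirac (nth point (cfg_points xi) i : borel T) B)).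
rewrite -(big_nth point xpredT (fun x => dirac (x : borel T) B)).
elim: (cfg_points xi) => [|x s IHs]; first by rewrite big_nil.
by rewrite big_cons IHs /= natrD EFinD diracE.
Qed.

Lemma measurable_config d (X : measurableType d) (f : X -> config) :
  (forall B : set T, measurable (B : set (borel T)) ->
     measurable_fun [set: X] (fun x => cfg_count B (f x))) ->
  measurable_fun [set: X] f.
Proof.
move=> mf; have mP := @measurability _ _ X config setT f cfg_gen.
apply: mP => //.
move=> _ [_ [B [mB [A ->]]] <-].
by have := mf B mB measurableT A I; rewrite setTI.
Qed.

Lemma measurable_cfg_count (B : set T) : measurable (B : set (borel T)) ->
  measurable_fun [set: config] (cfg_count B).
Proof.
move=> mB _ A _; rewrite setTI; apply: sub_sigma_algebra.
by exists B; split => //; exists A.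
Qed.

Lemma cfg_count_msetD (B : set T) (xi eta : multiset T) :
  cfg_count B (msetD xi eta) = (cfg_count B xi + cfg_count B eta)%N.
Proof.
have /seq.permP pD :
    perm_eq (msetD xi eta) (enum_mset xi ++ enum_mset eta).
  by apply/allP => x _ /=; rewrite count_cat !count_mem_mset msetE2.
by rewrite /cfg_count pD count_cat.
Qed.

End configurations.

Arguments cfg_add {R T}.

Section mean_measure.
Local Open Scope ereal_scope.
Context {R : realType} (T : pointedMetricType R).
Variable Q : probability (config T) R.

Definition mean_measure (B : set (borel T)) : \bar R :=
  \int[Q]_xi cfg_measure xi B.

Let measurable_cfg_measure (B : set (borel T)) : measurable B ->
  measurable_fun [set: config T] (fun xi => cfg_measure xi B : \bar R).
Proof.
move=> mB; under eq_fun do rewrite cfg_measureE.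
apply/measurable_EFinP.
apply: (@measurableT_comp _ _ _ _ _ _ (fun n : nat => n%:R : R)) => //.
exact: measurable_cfg_count.
Qed.

Let mean0 : mean_measure set0 = 0.
Proof.
by rewrite /mean_measure; under eq_integral do rewrite measure0;
  rewrite integral0.
Qed.

Let mean_ge0 B : 0 <= mean_measure B.
Proof. exact: integral_ge0. Qed.

Let mean_sigma_additive : semi_sigma_additive mean_measure.
Proof.
move=> F mF tF mUF; rewrite /mean_measure.
have -> : \int[Q]_xi cfg_measure xi (\bigcup_n F n) =
          \sum_(n <oo) \int[Q]_xi cfg_measure xi (F n).
  rewrite -integral_nneseries//.
  - by apply: eq_integral => xi _; rewrite measure_semi_bigcup.
  - by move=> n; exact: measurable_cfg_measure.
apply: is_cvg_nneseries => n _ _; exact: integral_ge0.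
Qed.

HB.instance Definition _ := isMeasure.Build _ _ _ mean_measure
  mean0 mean_ge0 mean_sigma_additive.

End mean_measure.

(* Sum of the first [n] terms of a sequence of point processes. *)
Section pp_sum.
Context {R : realType} {T : pointedMetricType R}.
Context {d : measure_display} {W : measurableType d}.

Definition pp_sum (X : nat -> {mfun W >-> config T}) (n : nat) (w : W) :
  config T := \big[cfg_add/@mset0 T]_(k < n) X k w.

Lemma measurable_pp_sum (X : nat -> {mfun W >-> config T}) (n : nat) :
  measurable_fun [set: W] (pp_sum X n).
Proof.
apply: measurable_config => B mB; elim: n X => [|n IHn] X.
  by under eq_fun do rewrite /pp_sum big_ord0; exact: measurable_cst.
rewrite [X in measurable_fun _ X](_ : _ =
  fun w => (cfg_count B (X 0 w) +
            cfg_count B (pp_sum (fun k => X k.+1) n w))%N); last first.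
  by apply/funext => w; rewrite /pp_sum big_ord_recl cfg_count_msetD.
apply: measurable_fun_addn => //.
by apply: measurableT_comp => //; exact: measurable_cfg_count.
Qed.

HB.instance Definition _ (X : nat -> {mfun W >-> config T}) (n : nat) :=
  isMeasurableFun.Build _ _ _ _ (pp_sum X n) (measurable_pp_sum X n).

End pp_sum.

Section palm.
Local Open Scope ereal_scope.
Context {R : realType} (T : pointedMetricType R).

(* [palm x] is the law of the reduced Palm process at [x] of a point process
   with law [Q]. *)
Definition reduced_palm (Q : probability (config T) R)
    (palm : R.-pker (borel T) ~> config T) : Prop :=
  mean_measure Q [set: borel T] < +oo /\
  forall f : borel T * config T -> R,
    measurable_fun [set: borel T * config T] f -> (forall z, (0 <= f z)%R) ->
    \int[Q]_xi (\sum_(x <- cfg_points xi) (f (x, cfg_remove xi x))%:E) =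
    \int[mean_measure Q]_x \int[palm x]_xi (f (x, xi))%:E.

End palm.

Section metrics.
Context {R : realType} (T : pointedMetricType R).

(* When both masses are 0 the sum is empty and the value is 0. *)
Definition d1 (xi1 xi2 : config T) : R :=
  let m := mass xi1 in
  let avg (s : 'S_m) : R := m%:R^-1 *
    \sum_(i < m) mdist (nth point (cfg_points xi1) i)
                       (nth point (cfg_points xi2) (s i)) in
  if m != mass xi2 then 1 else \big[Order.min/avg 1%g]_(s : 'S_m) avg s.

(* The test functions need not be assumed measurable: on a compact space with
   [mdist <= 1], d1-Lipschitz functions are bounded and measurable. *)
Definition d2 (P Q : probability (config T) R) : \bar R :=
  ereal_sup [set `| \int[P]_xi (f xi)%:E - \int[Q]_xi (f xi)%:E |%E
            | f in [set f : config T -> R |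
                    forall xi eta, `|f xi - f eta| <= d1 xi eta]].

End metrics.

Definition dtv {R : realType} {d : measure_display} {X : measurableType d}
    (P Q : set X -> \bar R) : \bar R :=
  ereal_sup [set `|P A - Q A|%E | A in [set A : set X | measurable A]].

Section partitional_total_variation.
Context {R : realType} (T : pointedMetricType R).

Definition radius (B : set T) (x : T) : R := sup [set mdist s x | s in B].

(* The chosen centers [t] are part of the data of a partition, so that the
   infimum in [vartheta] also ranges over the admissible choices of centers. *)
Definition eps_partition (eps : R) (m : nat) (G : 'I_m -> set T)
    (t : 'I_m -> T) : Prop :=
  [/\ forall i, measurable (G i : set (borel T)) /\ G i !=set0,
      trivIset [set: 'I_m] G,
      \bigcup_i G i = [set: T],
      forall i x, radius (G i) (t i) <= radius (G i) x &
      \big[Order.max/0]_(i < m) radius (G i) (t i) <= eps].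

Definition assemble (m : nat) (G : 'I_m -> set T) (t : 'I_m -> T)
    (xi : config T) : config T :=
  \big[cfg_add/@mset0 T]_(i < m) msetn (cfg_count (G i) xi) (t i).

Context {d : measure_display} {W : measurableType d}.
Variables (P : probability W R) (X : W -> config T).

Definition TV (m : nat) (G : 'I_m -> set T) (t : 'I_m -> T) : \bar R :=
  \big[maxe/0%E]_(i < m)
    dtv (pushforward P (fun w => cfg_add (assemble G t (X w)) (msetn 1%N (t i))))
        (pushforward P (fun w => assemble G t (X w))).

Definition vartheta (eps : R) : \bar R :=
  ereal_inf [set z | exists m (G : 'I_m -> set T) (t : 'I_m -> T),
                       eps_partition eps G t /\ z = TV G t].

(* A negative v is excluded because it has no v-partition, so that
   [vartheta v = +oo]. *)
Definition eps_inf : \bar R :=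
  ereal_inf [set v%:E | v in [set v : R | (vartheta v <= (2 * v)%:E)%E]].

End partitional_total_variation.

Section polynomial_birth_death.
Context {R : realType}.

Definition pbd_weight (a b beta : R) (i : nat) : R :=
  \prod_(j < i) ((a + b * j%:R) / (j.+1%:R * (1 + beta * j%:R))).

Definition pbd (a b beta : R) (i : nat) : R :=
  pbd_weight a b beta i / limn (series (pbd_weight a b beta)).

(* [Pi] is the law of [\sum_(j < Z) \d_(U_j)], with [U] indexed from 0. *)
Definition pbd_process_law (T : pointedMetricType R) (a b beta : R)
    (mu : set (borel T) -> \bar R) (Pi : probability (config T) R) : Prop :=
  exists (d : measure_display) (W : measurableType d) (P : probability W R)
         (Z : {mfun W >-> nat}) (U : nat -> {mfun W >-> borel T}),
  [/\ forall i, P (Z @^-1` [set i]) = (pbd a b beta i)%:E,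
      forall j B, measurable B -> P (U j @^-1` B) = mu B,
      forall (A : set nat) (m : nat) (B : 'I_m -> set (borel T)),
        (forall j, measurable (B j)) ->
        P (Z @^-1` A `&` \bigcap_(j in [set: 'I_m]) (U j @^-1` B j)) =
        (P (Z @^-1` A) * \prod_(j < m) P (U j @^-1` B j))%E &
      forall A, measurable A ->
        Pi A = P [set w | A (seq_mset [seq (U j w : T) | j <- iota 0 (Z w)])]].

End polynomial_birth_death.

Section theorem_data.
Context {R : realType} {T : pointedMetricType R}.

Definition iid_with_law {d} {W : measurableType d} (P : probability W R)
    (n : nat) (X : nat -> {mfun W >-> config T})
    (Q : probability (config T) R) : Prop :=
  (forall k A, (k < n)%N -> measurable A -> P (X k @^-1` A) = Q A) /\
  (forall A : 'I_n -> set (config T), (forall k, measurable (A k)) ->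
     P (\bigcap_(k in [set: 'I_n]) (X k @^-1` A k)) =
     (\prod_(k < n) P (X k @^-1` A k))%E).

Definition factorial_moment (Q : probability (config T) R) (r : nat) : \bar R :=
  'E_Q[fun xi => (mass xi ^_ r)%:R].

Definition theta Q r : R := fine (factorial_moment Q r).

Definition mean_mass (Q : probability (config T) R) : \bar R :=
  'E_Q[fun xi => (mass xi)%:R].

Definition var_mass (Q : probability (config T) R) : \bar R :=
  'V_Q[fun xi => (mass xi)%:R].

(* The law of Xi_(1,x) being [palm x], the inner integral is E|Xi_(1,x)|. *)
Definition pbd_mu (Q : probability (config T) R)
    (palm : R.-pker (borel T) ~> config T) (beta : R) (n : nat)
    (B : set (borel T)) : \bar R :=
  (\int[mean_measure Q]_(x in B)
    ((1 + beta%:E * (\int[palm x]_xi (mass xi)%:R%:E)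
        + (beta * (n%:R - 1) * theta Q 1)%:E)
     * ((theta Q 1 + beta * (theta Q 2 + (n%:R - 1) * theta Q 1 ^+ 2))^-1)%:E))%E.

End theorem_data.

(* Main.v *)
Require Import Defs.
From HB Require Import structures.
From mathcomp Require Import all_boot all_order all_algebra all_fingroup.
From mathcomp Require Import finmap multiset ring lra zify.
From mathcomp Require Import all_classical all_reals all_analysis.
From mathcomp Require Import measurable_realfun.

(* Fix an eps-partition, move every point to the centre of its cell and let tau
   be the value of TV.  For a d1-Lipschitz test function f this costs eps on each
   side, hence the 2 eps.  Let F(k) be the mean of f at k independent relocated
   points of law mu.

   Given the masses, f at the relocated sum differs from F by at most 1/k times
   the l1-distance of two block-count vectors; second moments and the
   Palm formula, which gives lambda = theta_1 mu + O(1/n), bound this by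
   O(r), r = sqrt(L/n), L being the number of centres.  Conversely some block
   carries at most 1/L of the second moment, so by Chebyshev its count has
   an atom of order at least min(r, 1), whereas its atoms are at most tau:
   min(r, 1) = O(tau).

   What is left is the one-dimensional comparison of the total mass S_n with the
   birth-death law, by Stein's equation, whose solution g has |g(i+1) - g(i)|
   <= 1/a.  Expanding g around S_{n-2}, the choice of a, b and beta kills the
   terms of order 0 and 1, and each second difference of g is paid for by
   ||L(S_{n-2} + 1) - L(S_{n-2})|| <= 2 tau, which yields O(tau + 1/n).  The
   tail term is nonnegative and exponentially small, so it may be added. *)

Set Implicit Arguments.
Unset Strict Implicit.
Unset Printing Implicit Defensive.

Import Order.TTheory GRing.Theory Num.Theory.
Import numFieldNormedType.Exports.

Local Open Scope classical_set_scope.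
Local Open Scope ring_scope.

(** * Stein's equation for the birth-death law *)

(** Two summands are split off because the death rate is quadratic: S(S - 1) counts ordered pairs of
    points, which lie in one or in two of the processes, and the other n - 2 remain available for
    smoothing. As g is only controlled through its increments, the expansion is carried out for
    masses cut off at N, with finite sums over coefficients of generating polynomials; N tends to
    infinity once, after all terms have been bounded. The number L of centres is not controlled by
    n, so the relocation error O(r) need not be small by itself; this is why the opposite inequality
    for tau is indispensable. If r <= 1 it gives r = O(tau) and also 1/n <= r^2 <= r = O(tau), so
    that no separate 1/n survives. If r > 1 it gives 1 = O(tau), and the trivial bound on f
    suffices. The constants must not depend on n although a and [beta] do. Uniformity comes from a
    >= c n (1 + beta n), with c depending on b and the moments only: both the Stein remainder and
    the gap between lambda and theta_1 mu are ratios in which [beta] cancels. *)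

Lemma weighted_increment_le (R : realFieldType) (A B F q h al d : R) :
  0 <= A -> A <= F -> 0 <= B -> B <= 1 - (F + q) -> F + q <= 1 ->
  0 <= q -> 0 <= al -> 0 <= d -> 0 <= h -> h <= 1 ->
  F * al <= (F + q) * d -> (1 - (F + q)) * d <= (1 - F) * al ->
  `|(A + q * h - (F + q) * (B + (A + q * h))) * d
    - (A - F * (B + (A + q * h))) * al| <= q * d.
Proof.
move=> A0 AF B0 BF F1 q0 al0 d0 h0 h1 L1 L2.
(* In the application A and B are the parts of the mean of h below and above i, F is the mass below
   i, q the mass at i, and [al], [d] are the birth and death rates at i. The two ratio hypotheses
   make [u] and [v] nonnegative; since A <= F and B <= 1 - (F + q), the subtracted terms amount to
   at most F u + (1 - (F + q)) v = w, so the whole lies between -w and w. *)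
have -> : (A + q * h - (F + q) * (B + (A + q * h))) * d -
    (A - F * (B + (A + q * h))) * al =
  h * (q * ((1 - (F + q)) * d + F * al))
   - A * ((1 - F) * al - (1 - (F + q)) * d)
   - B * ((F + q) * d - F * al) by ring.
set u := (1 - F) * al - _; set v := (F + q) * d - _.
set w := q * _.
have u0 : 0 <= u by rewrite subr_ge0.
have v0 : 0 <= v by rewrite subr_ge0.
have w0 : 0 <= w.
  by apply: mulr_ge0 => //; apply: addr_ge0; apply: mulr_ge0 => //; lra.
have wle : w <= q * d by apply: ler_wpM2l => //; move: L1; lra.
have hw : h * w <= q * d by rewrite (le_trans _ wle)// ler_piMl.
have hw0 : 0 <= h * w by rewrite mulr_ge0.
have Au := ler_wpM2r u0 AF; have Bv := ler_wpM2r v0 BF.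
have Au0 := mulr_ge0 A0 u0; have Bv0 := mulr_ge0 B0 v0.
have uvw : F * u + (1 - (F + q)) * v = w by rewrite /u /v /w; ring.
by rewrite ler_norml; apply/andP; split; lra.
Qed.

Section stein_equation.
Context {R : realType}.
Variables (a b beta : R) (q : nat -> R).
Hypotheses (a0 : 0 < a) (b0 : 0 <= b) (b1 : b <= 1) (beta0 : 0 <= beta).

(** Rates of a birth-death chain: [qS] below is detailed balance, so that [q] is its reversible law.
    The quadratic [death] produces the denominators (j + 1)(1 + beta j) of [pbd_weight]. *)
Definition birth (i : nat) : R := a + b * i%:R.
Definition death (i : nat) : R := i%:R * (1 + beta * (i%:R - 1)).

Hypotheses (q0 : forall i, 0 < q i)
  (qS : forall i, q i.+1 * death i.+1 = q i * birth i)
  (q1 : series q @ \oo --> (1 : R)).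

Lemma birth_gt0 i : 0 < birth i.
Proof. by rewrite ltr_wpDr// mulr_ge0. Qed.

Lemma death0 : death 0 = 0. Proof. by rewrite /death mul0r. Qed.

Lemma death_gt0 i : 0 < death i.+1.
Proof.
by rewrite mulr_gt0// ltr_wpDr// mulr_ge0// -natrB.
Qed.

(** The slope of [birth] is b <= 1, whereas [death] is the identity plus a nondecreasing function on
    the integers. *)
Lemma birth_death_mono i j : (j <= i)%N ->
  birth i - birth j <= death i - death j.
Proof.
rewrite leq_eqVlt => /orP[/eqP->|ji]; first by rewrite !subrr.
have -> : birth i - birth j = b * (i%:R - j%:R) by rewrite /birth; ring.
have -> : death i - death j = (1 + beta * (i%:R + j%:R - 1)) * (i%:R - j%:R).
  by rewrite /death; ring.
apply: ler_wpM2r; first by rewrite subr_ge0 ler_nat ltnW.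
rewrite (le_trans b1)// lerDl mulr_ge0// -natrD subr_ge0 ler1n; lia.
Qed.

Let F i := series q i.

Let F_ge0 i : 0 <= F i.
Proof. by apply: sumr_ge0 => j _; exact: ltW. Qed.

Let F_le1 i : F i <= 1.
Proof.
have := nondecreasing_cvgn_le _ (cvgP _ q1) i.
rewrite (cvg_lim (@Rhausdorff R) q1); apply.
apply/nondecreasing_seqP => n; rewrite /series/= big_nat_recr//= lerDl.
exact: ltW.
Qed.

Let FS i : F i.+1 = F i + q i.
Proof. by rewrite /F /series/= big_nat_recr. Qed.

Let sum_death i :
  \sum_(0 <= j < i.+1) q j * death j = \sum_(0 <= j < i) q j * birth j.
Proof.
rewrite big_nat_recl//= death0 mulr0 add0r; apply: eq_bigr => j _; exact: qS.
Qed.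

(** Detailed balance, summed over the states below i, writes the difference of the two sides as the
    sum over j < i of q(j) times the excess of the increment of [death] over that of [birth] between
    j and i. *)
Lemma pbd_head_ratio i : F i * birth i <= F i.+1 * death i.
Proof.
rewrite -subr_ge0.
suff -> : F i.+1 * death i - F i * birth i = \sum_(0 <= j < i)
    q j * ((death i - death j) - (birth i - birth j)).
  rewrite big_nat_cond; apply: sumr_ge0 => j; rewrite andbT => /= ji.
  by apply: mulr_ge0; [exact: ltW|rewrite subr_ge0 birth_death_mono// ltnW].
transitivity (F i.+1 * death i - \sum_(0 <= j < i.+1) q j * death j
    - (F i * birth i - \sum_(0 <= j < i) q j * birth j)).
  by rewrite sum_death; ring.
rewrite /F /series/= !mulr_suml -!sumrB big_nat_recr//= subrr addr0 -sumrB.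
by apply: eq_bigr => j _; ring.
Qed.

(** The inequality is proved for windows of k states by induction on k and passed to the limit. As
    q(x + 1) = q(x) birth(x) / death(x + 1), each step reduces to birth(x) death(i) <= birth(i)
    death(x + 1) for x >= i. *)
Lemma pbd_tail_ratio i : (0 < i)%N ->
  (1 - F i.+1) * death i <= (1 - F i) * birth i.
Proof.
move=> i0.
have h1 : (F (k + i).+1 - F i.+1) * death i @[k --> \oo] -->
    (1 - F i.+1) * death i.
  apply: cvgMl; apply: cvgB; last exact: cvg_cst.
  rewrite (_ : (fun _ => _) = (fun k => F (k + i.+1)%N)); last first.
    by apply/funext => k; rewrite addnS.
  by rewrite cvg_shiftn.
have h2 : (F (k + i) - F i) * birth i @[k --> \oo] --> (1 - F i) * birth i.
  apply: cvgMl; apply: cvgB; last exact: cvg_cst.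
  by rewrite cvg_shiftn.
apply: (ler_cvg_to h1 h2); apply: nearW => k.
elim: k => [|k IHk]; first by rewrite !add0n !subrr !mul0r.
rewrite addSn FS [F (k + i).+1]FS.
have dk : 0 < death (k + i).+1 by exact: death_gt0.
have -> : q (k + i).+1 = q (k + i) * birth (k + i) / death (k + i).+1.
  by rewrite -qS mulfK// gt_eqF.
suff : birth (k + i) / death (k + i).+1 * death i <= birth i.
  move=> /(ler_wpM2l (ltW (q0 (k + i)))); move: IHk; rewrite FS; nra.
rewrite mulrAC ler_pdivrMr// /birth /death.
have ji : (i%:R : R) <= (k + i)%:R by rewrite ler_nat leq_addl.
have i1 : (1 : R) <= i%:R by rewrite ler1n.
move: ji i1; rewrite -(natr1 (k + i)).
move: ((k + i)%:R : R) (i%:R : R) => x y ji i1.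
have -> : x + 1 - 1 = x by ring.
apply: (@le_trans _ _ ((a + b * x) * (y * (1 + beta * x)))).
  apply: ler_wpM2l; first by rewrite ltW// ltr_wpDr// mulr_ge0//; lra.
  apply: ler_wpM2l; first lra.
  by rewrite lerD2l; apply: (ler_wpM2l beta0); lra.
rewrite !mulrA; apply: ler_wpM2r; first by rewrite addr_ge0// mulr_ge0//; lra.
rewrite -subr_ge0.
have -> : (a + b * y) * (x + 1) - (a + b * x) * y = a * (x + 1 - y) + b * y.
  by ring.
by apply: addr_ge0; apply: mulr_ge0; rewrite ?(ltW a0)//; lra.
Qed.

Variable h : nat -> R.
Hypothesis h01 : forall i, 0 <= h i <= 1.

Let A i := series (fun j => q j * h j) i.
Let hbar := limn (series (fun j => q j * h j)).

Let AS i : A i.+1 = A i + q i * h i.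
Proof. by rewrite /A /series/= big_nat_recr. Qed.

Let A_ge0 i : 0 <= A i.
Proof.
apply: sumr_ge0 => j _; case/andP: (h01 j) => ? _; apply: mulr_ge0 => //.
exact: ltW.
Qed.

Let A_le i j : (i <= j)%N -> A i <= A j /\ A j - A i <= F j - F i.
Proof.
elim: j => [|j IHj]; first by rewrite leqn0 => /eqP ->; rewrite !subrr.
rewrite leq_eqVlt => /orP[/eqP->|]; first by rewrite !subrr.
rewrite ltnS => /IHj; rewrite AS FS; have := q0 j.
by case/andP: (h01 j) => ? ? ? [? ?]; split; nra.
Qed.

Let A_cvg : A @ \oo --> hbar.
Proof.
apply: (nondecreasing_is_cvgn (u_ := A)).
  by apply/nondecreasing_seqP => n; case: (A_le (leqnSn n)).
exists 1 => _ [n _ <-]; have [_] := A_le (leq0n n).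
have := F_le1 n; rewrite /A /F /series/= !big_nil !subr0; lra.
Qed.

Lemma pbd_mean_cvg : series (fun j => q j * h j) @ \oo --> hbar.
Proof. exact: A_cvg. Qed.

Let B_bound i : 0 <= hbar - A i <= 1 - F i.
Proof.
have c1 : A (k + i) - A i @[k --> \oo] --> hbar - A i.
  by apply: cvgB; [rewrite cvg_shiftn|exact: cvg_cst].
have c2 : F (k + i) - F i @[k --> \oo] --> 1 - F i.
  by apply: cvgB; [rewrite cvg_shiftn|exact: cvg_cst].
apply/andP; split.
  have c0 : (0 : R) @[k --> \oo] --> (0 : R) by exact: cvg_cst.
  apply: (ler_cvg_to c0 c1); apply: nearW => k.
  by rewrite subr_ge0; case: (A_le (leq_addl k i)).
apply: (ler_cvg_to c1 c2); apply: nearW => k.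
by case: (A_le (leq_addl k i)).
Qed.

(** This is Stein's equation summed from 0 upwards. At i = 0 it takes the default value of a
    division by 0; the factor [death 0] = 0 removes this value from the equation, and increments are
    only taken from 1 on. *)
Definition stein_sol (i : nat) : R := (A i - F i * hbar) / (death i * q i).

Lemma stein_eq i :
  birth i * stein_sol i.+1 - death i * stein_sol i = h i - hbar.
Proof.
have qi := q0 i; have bi := birth_gt0 i.
have -> : birth i * stein_sol i.+1 = (A i.+1 - F i.+1 * hbar) / q i.
  rewrite /stein_sol (mulrC (death _)) qS; field.
  by rewrite !gt_eqF.
have -> : death i * stein_sol i = (A i - F i * hbar) / q i.
  rewrite /stein_sol; case: i qi {bi} => [|i] qi.
    by rewrite death0 mul0r /A /F /series/= !big_nil mul0r subrr mul0r.
  by have := death_gt0 i; move=> di; field; rewrite !gt_eqF.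
by rewrite AS FS; field; rewrite gt_eqF.
Qed.

(* The factor 1/a comes from writing the increment as a combination of the
   weights h(j), j <> i, with nonpositive coefficients and of h(i). *)
Lemma stein_sol_diff i : (0 < i)%N ->
  `|stein_sol i.+1 - stein_sol i| <= a^-1.
Proof.
move=> i0.
have qi := q0 i; have bi := birth_gt0 i.
have di : 0 < death i by case: i i0 {qi bi} => // i _; exact: death_gt0.
have L1 := pbd_head_ratio i; have L2 := pbd_tail_ratio i0.
have [A0 F0] : A 0%N = 0 /\ F 0%N = 0 by rewrite /A /F /series/= !big_nil.
have [_] := A_le (leq0n i); rewrite A0 F0 !subr0 => AF.
have /andP[B0 B1] := B_bound i.+1.
have Ai := A_ge0 i; have Fi := F_ge0 i.
have /andP[hi0 hi1] := h01 i.
have F1 := F_le1 i.+1.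
have ab : a <= birth i by rewrite lerDl mulr_ge0.
apply: (@le_trans _ _ (birth i)^-1); last by rewrite lef_pV2.
have qb := mulr_gt0 qi bi; have qbd := mulr_gt0 qb di.
have -> : stein_sol i.+1 - stein_sol i =
    ((A i.+1 - F i.+1 * hbar) * death i - (A i - F i * hbar) * birth i)
    / (q i * birth i * death i).
  by rewrite /stein_sol (mulrC (death i.+1)) qS; field; rewrite !gt_eqF.
rewrite normrM (@gtr0_norm _ (_^-1)) ?invr_gt0// ler_pdivrMr//.
have -> : (birth i)^-1 * (q i * birth i * death i) = q i * death i.
  by field; rewrite gt_eqF.
move: L1 L2 B0 B1 F1; rewrite FS AS => L1 L2 B0 B1 F1.
rewrite -[hbar in leLHS](subrK (A i + q i * h i)).
by apply: weighted_increment_le => //; exact/ltW.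
Qed.

End stein_equation.

(** * Generating polynomials of truncated laws *)

Section poly_pairing.
Context {R : realType}.
Implicit Types (A B P : {poly R}) (f g : nat -> R).

(* The expectation of [f] under the (sub)probability with generating polynomial
   [A]; truncating the law makes every series below finite. *)
Definition pairing f A : R := \sum_(i < size A) A`_i * f i.

Lemma pairing_wide f A n : (size A <= n)%N ->
  pairing f A = \sum_(i < n) A`_i * f i.
Proof.
move=> An; rewrite /pairing (big_ord_widen n (fun i => A`_i * f i))//.
rewrite [RHS](bigID (fun i : 'I_n => (i < size A)%N))/= [X in _ + X]big1 ?addr0//.
by move=> i; rewrite -leqNgt => iA; rewrite nth_default ?mul0r.
Qed.

Lemma pairingD f A B : pairing f (A + B) = pairing f A + pairing f B.
Proof.
pose n := maxn (size A) (size B).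
rewrite !(@pairing_wide f _ n) ?leq_maxl ?leq_maxr ?size_polyD//.
by rewrite -big_split; apply: eq_bigr => i _; rewrite coefD mulrDl.
Qed.

Lemma pairingZ f c A : pairing f (c *: A) = c * pairing f A.
Proof.
rewrite (@pairing_wide f _ (size A)) ?size_scale_leq// /pairing mulr_sumr.
by apply: eq_bigr => i _; rewrite coefZ mulrA.
Qed.

Lemma pairing0 f : pairing f 0 = 0.
Proof. by rewrite /pairing size_poly0 big_ord0. Qed.

Lemma eq_pairing f g A : f =1 g -> pairing f A = pairing g A.
Proof. by move=> fg; apply: eq_bigr => i _; rewrite fg. Qed.

Lemma pairing_fD f g A :
  pairing (fun i => f i + g i) A = pairing f A + pairing g A.
Proof. by rewrite -big_split; apply: eq_bigr => i _; rewrite mulrDr. Qed.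

Lemma pairing_fZ c f A : pairing (fun i => c * f i) A = c * pairing f A.
Proof. by rewrite mulr_sumr; apply: eq_bigr => i _; rewrite mulrCA. Qed.

Lemma pairingXn f k A : pairing f ('X^k * A) = pairing (fun i => f (k + i)%N) A.
Proof.
rewrite (@pairing_wide f _ (k + size A)); last first.
  have [->|A0] := eqVneq A 0; first by rewrite mulr0 size_poly0.
  by rewrite size_monicM ?monicXn// size_polyXn.
rewrite big_split_ord/= big1 ?add0r => [|i _]; last first.
  by rewrite coefXnM ltn_ord mul0r.
by apply: eq_bigr => i _; rewrite coefXnM ltnNge leq_addr/= addKn.
Qed.

Lemma pairing_sum f (I : Type) (r : seq I) (F : I -> {poly R}) :
  pairing f (\sum_(i <- r) F i) = \sum_(i <- r) pairing f (F i).
Proof.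
elim: r => [|i r IHr]; first by rewrite !big_nil pairing0.
by rewrite !big_cons pairingD IHr.
Qed.

Lemma pairingM f A B :
  pairing f (A * B) = pairing (fun i => pairing (fun j => f (i + j)%N) B) A.
Proof.
rewrite -{1}(coefK A) poly_def mulr_suml pairing_sum.
by apply: eq_bigr => i _; rewrite -scalerAl pairingZ pairingXn.
Qed.

(** The operator X d/dX. On test functions it is multiplication by i, and on P^n the Leibniz rule
    yields the exchangeability identity E[S f(S)] = n E[X_1 f(S)]. *)
Definition euler A := 'X * A^`().

Lemma eulerM A B : euler (A * B) = euler A * B + A * euler B.
Proof. by rewrite /euler derivM; ring. Qed.

Lemma euler_exp P n : euler (P ^+ n.+1) = n.+1%:R *: (euler P * P ^+ n).
Proof.
by rewrite /euler deriv_exp/= scaler_nat mulrnAr mulrA.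
Qed.

Lemma coef_euler A i : (euler A)`_i = i%:R * A`_i.
Proof.
rewrite /euler coefXM; case: i => [|i]/=; first by rewrite mul0r.
by rewrite coef_deriv mulr_natl.
Qed.

Lemma size_euler A : (size (euler A) <= size A)%N.
Proof. by apply/leq_sizeP => j /leq_sizeP Aj; rewrite coef_euler Aj ?mulr0. Qed.

Lemma pairing_euler f A : pairing f (euler A) = pairing (fun i => i%:R * f i) A.
Proof.
rewrite (pairing_wide f (size_euler A)).
by apply: eq_bigr => i _; rewrite coef_euler mulrAC mulrC mulrCA.
Qed.

(** The two arguments stand for the masses of the two summands that are singled out of the sum. *)
Definition pairing2 (f : nat -> nat -> R) P :=
  pairing (fun x => pairing (f x) P) P.

Lemma eq_pairing2 (f g : nat -> nat -> R) P : (forall x y, f x y = g x y) ->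
  pairing2 f P = pairing2 g P.
Proof. by move=> fg; do 2 apply: eq_pairing => ?; apply: fg. Qed.

Lemma pairing2D (f g : nat -> nat -> R) P :
  pairing2 (fun x y => f x y + g x y) P = pairing2 f P + pairing2 g P.
Proof. by rewrite -pairing_fD; apply: eq_pairing => x; rewrite pairing_fD. Qed.

Lemma pairing2Z c (f : nat -> nat -> R) P :
  pairing2 (fun x y => c * f x y) P = c * pairing2 f P.
Proof. by rewrite -pairing_fZ; apply: eq_pairing => x; rewrite pairing_fZ. Qed.

Lemma pairing2M f g P :
  pairing2 (fun x y => f x * g y) P = pairing f P * pairing g P.
Proof.
rewrite mulrC -pairing_fZ; apply: eq_pairing => x.
by rewrite pairing_fZ mulrC.
Qed.

Lemma pairing_exp f P m : pairing f (P ^+ m.+2) =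
  pairing2 (fun x y => pairing (fun s => f (x + y + s)%N) (P ^+ m)) P.
Proof.
rewrite !exprS !pairingM; apply: eq_pairing => x; rewrite pairingM.
by do 2 apply: eq_pairing => ?; rewrite addnA.
Qed.

Lemma pairing_exp1 f P m : pairing (fun i => i%:R * f i) (P ^+ m.+2) =
  m.+2%:R * pairing2
    (fun x y => x%:R * pairing (fun s => f (x + y + s)%N) (P ^+ m)) P.
Proof.
rewrite -pairing_euler euler_exp pairingZ exprS; congr (_ * _).
rewrite pairingM pairing_euler; apply: eq_pairing => x.
rewrite pairingM -pairing_fZ; apply: eq_pairing => y; congr (_ * _).
by apply: eq_pairing => s; rewrite addnA.
Qed.

(** The operator is [euler] applied twice minus [euler]. Its Leibniz expansion on P^n separates the
    ordered pairs of points inside one summand, n terms, from those in two different summands, n (n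
    - 1) terms. *)
Lemma pairing_exp2 f P m :
  pairing (fun i => i%:R * (i%:R - 1) * f i) (P ^+ m.+2) =
  m.+2%:R * pairing2
    (fun x y => x%:R * (x%:R - 1) *
                pairing (fun s => f (x + y + s)%N) (P ^+ m)) P +
  m.+2%:R * m.+1%:R * pairing2
    (fun x y => x%:R * y%:R * pairing (fun s => f (x + y + s)%N) (P ^+ m)) P.
Proof.
have -> : pairing (fun i => i%:R * (i%:R - 1) * f i) (P ^+ m.+2) =
    pairing f (euler (euler (P ^+ m.+2)) + (-1) *: euler (P ^+ m.+2)).
  rewrite pairingD pairingZ !pairing_euler -pairing_fZ -pairing_fD.
  by apply: eq_pairing => i; ring.
have -> : euler (euler (P ^+ m.+2)) + (-1) *: euler (P ^+ m.+2) =
  m.+2%:R *: ((euler (euler P) + (-1) *: euler P) * (P * P ^+ m)) +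
  (m.+2%:R * m.+1%:R) *: (euler P * (euler P * P ^+ m)).
  have eZ c A : euler (c *: A) = c *: euler A.
    by rewrite /euler derivZ scalerAr.
  rewrite euler_exp eZ eulerM euler_exp exprS !scaleN1r -!mul_polyC polyCM.
  by ring.
rewrite pairingD !pairingZ; congr (_ * _ + _ * _).
  rewrite pairingM pairingD pairingZ !pairing_euler -pairing_fZ -pairing_fD.
  apply: eq_pairing => x; rewrite pairingM.
  have -> (z : R) : x%:R * (x%:R * z) + -1 * (x%:R * z) = x%:R * (x%:R - 1) * z.
    by ring.
  rewrite -pairing_fZ; apply: eq_pairing => y; congr (_ * _).
  by apply: eq_pairing => s; rewrite addnA.
rewrite pairingM pairing_euler; apply: eq_pairing => x.
rewrite pairingM pairing_euler -pairing_fZ; apply: eq_pairing => y.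
rewrite mulrA; congr (_ * _).
by apply: eq_pairing => s; rewrite addnA.
Qed.

Definition nneg_poly P := forall i, 0 <= P`_i.

Lemma nneg_polyM A B : nneg_poly A -> nneg_poly B -> nneg_poly (A * B).
Proof. by move=> A0 B0 i; rewrite coefM sumr_ge0// => j _; rewrite mulr_ge0. Qed.

Lemma nneg_polyX P n : nneg_poly P -> nneg_poly (P ^+ n).
Proof.
move=> P0; elim: n => [|n IHn]; last by rewrite exprS; exact: nneg_polyM.
by move=> i; rewrite expr0 coef1; case: (i == 0%N).
Qed.

Lemma pairing_norm f g P : nneg_poly P -> (forall i, `|f i| <= g i) ->
  `|pairing f P| <= pairing g P.
Proof.
move=> P0 fg; apply: le_trans (ler_norm_sum _ _ _) _; apply: ler_sum => i _.
by rewrite normrM (ger0_norm (P0 i)) ler_wpM2l.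
Qed.

Lemma pairing_ge0 f P : nneg_poly P -> (forall i, 0 <= f i) -> 0 <= pairing f P.
Proof. by move=> P0 f0; apply: sumr_ge0 => i _; rewrite mulr_ge0. Qed.

Lemma pairing2_norm (f g : nat -> nat -> R) P : nneg_poly P ->
  (forall x y, `|f x y| <= g x y) -> `|pairing2 f P| <= pairing2 g P.
Proof. by move=> P0 fg; do 2 apply: pairing_norm => // ?; apply: fg. Qed.

Lemma pairing1 P : pairing (fun=> 1) P = P.[1].
Proof.
by rewrite horner_coef; apply: eq_bigr => i _; rewrite expr1n.
Qed.

Lemma pairing_cst c P : pairing (fun=> c) P = c * P.[1].
Proof.
rewrite -pairing1 -pairing_fZ; apply: eq_pairing => i; by rewrite mulr1.
Qed.

End poly_pairing.

(** * Truncated laws and their convolution powers *)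

Section convolution_powers.
Context {R : realType}.
Variable p : nat -> R.

Definition trunc_poly N : {poly R} := \poly_(i < N) p i.

(* Truncating at [j.+1] does not affect the coefficient of index [j]. *)
Definition conv_power n j : R := (trunc_poly j.+1 ^+ n)`_j.

(** If [v] is the law of S, this is the law of S + 1. *)
Definition delay (v : nat -> R) (s : nat) : R := if s is s'.+1 then v s' else 0.

Lemma eq_coef_exp (A B : {poly R}) k n :
  (forall i, (i <= k)%N -> A`_i = B`_i) ->
  forall i, (i <= k)%N -> (A ^+ n)`_i = (B ^+ n)`_i.
Proof.
move=> AB; elim: n => [|n IHn] i ik; first by rewrite !expr0.
rewrite !exprS !coefM; apply: eq_bigr => -[j /= ji] _; rewrite ltnS in ji.
by rewrite AB ?IHn// ?(leq_trans _ ik)// leq_subr.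
Qed.

Lemma coef_exp_trunc N n j : (j < N)%N -> (trunc_poly N ^+ n)`_j = conv_power n j.
Proof.
move=> jN; apply: (@eq_coef_exp _ _ j) => // i ij.
by rewrite !coef_poly ltnS ij (leq_ltn_trans ij jN).
Qed.

Lemma conv_power0 j : conv_power 0 j = (j == 0%N)%:R.
Proof. by rewrite /conv_power expr0 coef1. Qed.

Lemma conv_powerS n j : conv_power n.+1 j = \sum_(i < j.+1) p i * conv_power n (j - i).
Proof.
rewrite /conv_power exprS coefM; apply: eq_bigr => -[i /= ij] _.
by rewrite coef_poly ij coef_exp_trunc// ltnS leq_subr.
Qed.

Hypothesis p0 : forall i, 0 <= p i.

Lemma nneg_trunc N : nneg_poly (trunc_poly N).
Proof. by move=> i; rewrite coef_poly; case: ifP. Qed.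

Lemma conv_power_ge0 n j : 0 <= conv_power n j.
Proof. exact/nneg_polyX/nneg_trunc. Qed.

Lemma ler_coef_exp (A B : {poly R}) n :
  nneg_poly A -> nneg_poly B -> (forall i, A`_i <= B`_i) ->
  forall i, (A ^+ n)`_i <= (B ^+ n)`_i.
Proof.
move=> A0 B0 AB; elim: n => [|n IHn] i; first by rewrite !expr0.
rewrite !exprS !coefM; apply: ler_sum => j _.
by apply: ler_pM => //; exact: nneg_polyX.
Qed.

Lemma coef_exp_trunc_le N n j : (trunc_poly N ^+ n)`_j <= conv_power n j.
Proof.
have [jN|Nj] := ltnP j N; first by rewrite coef_exp_trunc.
apply: ler_coef_exp; [exact: nneg_trunc|exact: nneg_trunc|move=> i].
rewrite !coef_poly; case: ifP => iN; last by case: ifP.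
by rewrite (leq_trans iN)// ltnW.
Qed.

Lemma trunc1E N : (trunc_poly N).[1] = \sum_(0 <= i < N) p i.
Proof.
rewrite -pairing1 (@pairing_wide _ _ _ N) ?size_poly// big_mkord.
by apply: eq_bigr => i _; rewrite coef_poly ltn_ord mulr1.
Qed.

Lemma pairing_trunc f N :
  pairing f (trunc_poly N) = \sum_(0 <= i < N) p i * f i.
Proof.
rewrite (@pairing_wide _ _ _ N) ?size_poly// big_mkord.
by apply: eq_bigr => i _; rewrite coef_poly ltn_ord.
Qed.

Hypothesis p1 : series p @ \oo --> (1 : R).

Lemma trunc1_cvg : (trunc_poly N).[1] @[N --> \oo] --> (1 : R).
Proof. by under eq_fun do rewrite trunc1E; exact: p1. Qed.

Lemma trunc1_ge0 N : 0 <= (trunc_poly N).[1].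
Proof. by rewrite trunc1E sumr_ge0. Qed.

Lemma trunc1_le1 N : (trunc_poly N).[1] <= 1.
Proof.
rewrite trunc1E; have := nondecreasing_cvgn_le _ (cvgP _ p1) N.
rewrite (cvg_lim (@Rhausdorff R) p1); apply.
by apply/nondecreasing_seqP => n; rewrite /series/= big_nat_recr//= lerDl.
Qed.

Lemma sum_conv_power_le1 n J : \sum_(0 <= j < J) conv_power n j <= 1.
Proof.
have -> : \sum_(0 <= j < J) conv_power n j = \sum_(0 <= j < J) (trunc_poly J ^+ n)`_j.
  by apply: eq_big_nat => j /andP[_ jJ]; rewrite coef_exp_trunc.
apply: (@le_trans _ _ (trunc_poly J ^+ n).[1]); last first.
  by rewrite horner_exp exprn_ile1 ?trunc1_ge0 ?trunc1_le1.
have nX := nneg_polyX n (nneg_trunc J).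
rewrite -pairing1 (@pairing_wide _ _ _ (maxn J (size (trunc_poly J ^+ n)))).
  rewrite big_mkord; set K := maxn _ _.
  rewrite (big_ord_widen K (fun i => (trunc_poly J ^+ n)`_i)) ?leq_maxl//.
  rewrite [leRHS](bigID (fun i : 'I_K => (i < J)%N))/=.
  under [X in _ <= X + _]eq_bigr do rewrite mulr1.
  by rewrite lerDl; apply: sumr_ge0 => i _; rewrite mulr1.
by rewrite leq_maxr.
Qed.

(** All differences are nonnegative, so the sum may be extended past the degree of the truncated
    power. There the true power contributes at most 1, and the truncated one exactly the n-th power
    of the mass kept. *)
Lemma conv_power_trunc_gap n N J :
  \sum_(0 <= j < J) (conv_power n j - (trunc_poly N ^+ n)`_j) <= 1 - (trunc_poly N).[1] ^+ n.
Proof.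
set A := trunc_poly N ^+ n; pose K := maxn J (size A).
apply: (@le_trans _ _ (\sum_(0 <= j < K) (conv_power n j - A`_j))).
  rewrite (big_cat_nat (leq0n J) (leq_maxl J (size A)))//= lerDl.
  by apply: sumr_ge0 => j _; rewrite subr_ge0 coef_exp_trunc_le.
rewrite sumrB lerB ?sum_conv_power_le1// -horner_exp -pairing1.
rewrite (@pairing_wide _ _ _ K) ?leq_maxr// big_mkord.
by under eq_bigr do rewrite mulr1.
Qed.

(** Summation by parts moves the difference from [u] to the law, where [V] is available; truncation
    is paid twice, for the law and for its shift. With [u] the first differences of g, this is what
    makes the mean of a second difference small. *)
Lemma pairing_increment (u : nat -> R) (Gamma V : R) m N :
  (forall k, `|u k| <= Gamma) ->
  (forall K, \sum_(0 <= s < K) `|delay (conv_power m) s - conv_power m s| <= V) ->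
  `|pairing (fun s => u s.+1 - u s) (trunc_poly N ^+ m)|
    <= Gamma * (V + 2 * (1 - (trunc_poly N).[1] ^+ m)).
Proof.
move=> uG vV; set M := trunc_poly N ^+ m.
have G0 : 0 <= Gamma by apply: le_trans (uG 0%N).
have [K MK] : exists K, (size M <= K)%N by exists (size M).
rewrite (pairing_wide _ MK) -(big_mkord xpredT (fun s => M`_s * (u s.+1 - u s))).
have -> : \sum_(0 <= s < K) M`_s * (u s.+1 - u s) =
    \sum_(0 <= s < K.+1) (delay (fun i => M`_i) s - M`_s) * u s.
  under [LHS]eq_bigr do rewrite mulrBr; under [RHS]eq_bigr do rewrite mulrBl.
  rewrite !sumrB; congr (_ - _).
    by rewrite [RHS]big_nat_recl//= mul0r add0r.
  by rewrite big_nat_recr//= (nth_default _ MK) mul0r addr0.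
apply: le_trans (ler_norm_sum _ _ _) _.
apply: (@le_trans _ _ (\sum_(0 <= s < K.+1) Gamma *
    (`|delay (conv_power m) s - conv_power m s| + (delay (conv_power m) s - delay (fun i => M`_i) s)
     + (conv_power m s - M`_s)))).
  apply: ler_sum => s _; rewrite normrM mulrC ler_pM//.
  have d0 : 0 <= conv_power m s - M`_s by rewrite subr_ge0 coef_exp_trunc_le.
  have d1 : 0 <= delay (conv_power m) s - delay (fun i => M`_i) s.
    by case: s {d0} => [|s] /=; rewrite ?subrr// subr_ge0 coef_exp_trunc_le.
  have -> : delay (fun i => M`_i) s - M`_s = (delay (conv_power m) s - conv_power m s)
      - (delay (conv_power m) s - delay (fun i => M`_i) s) + (conv_power m s - M`_s) by ring.
  have := ler_norm (delay (conv_power m) s - conv_power m s).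
  have := lerNnormlW (lexx `|delay (conv_power m) s - conv_power m s|).
  move: d0 d1 `|delay (conv_power m) s - conv_power m s| => d0 d1 z z1 z2.
  by rewrite ler_norml; apply/andP; split; lra.
rewrite -mulr_sumr ler_wpM2l// !big_split/= -addrA lerD// mulr2n mulrDl mul1r.
apply: lerD; rewrite -big_split/=; last exact: conv_power_trunc_gap.
rewrite big_nat_recl//= subrr add0r; exact: conv_power_trunc_gap.
Qed.

(** The mean of P^m is m P'(1) P(1)^(m - 1), and P(1) <= 1 for a truncated law. *)
Lemma pairing_id_exp_le m N (mu : R) :
  pairing (fun i => i%:R) (trunc_poly N) <= mu ->
  pairing (fun i => i%:R) (trunc_poly N ^+ m) <= m%:R * mu.
Proof.
move=> mmu; case: m => [|m].
  rewrite expr0 mul0r; have sz : (size (1%:P : {poly R}) <= 1)%N.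
    by rewrite size_polyC leq_b1.
  by rewrite (pairing_wide _ sz) big_ord1 mulr0.
have -> : pairing (fun i => i%:R) (trunc_poly N ^+ m.+1) =
    pairing (fun=> 1) (euler (trunc_poly N ^+ m.+1)).
  by rewrite pairing_euler; apply: eq_pairing => i; rewrite mulr1.
rewrite euler_exp pairingZ ler_wpM2l// pairing1 hornerM horner_exp.
have -> : (euler (trunc_poly N)).[1] = pairing (fun i => i%:R) (trunc_poly N).
  rewrite -pairing1 pairing_euler; apply: eq_pairing => i; exact: mulr1.
apply: le_trans mmu; rewrite ler_piMr//.
  by apply: pairing_ge0 => //; exact: nneg_trunc.
by rewrite exprn_ile1 ?trunc1_ge0 ?trunc1_le1.
Qed.

End convolution_powers.

(** * Second-order expansion of Stein's operator along a sum *)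

Lemma second_order_remainder (R : realFieldType) (G : nat -> R) (Gamma delta : R) :
  (forall k, `|G k.+1 - G k| <= Gamma) ->
  (forall k, `|(G k.+2 - G k.+1) - (G k.+1 - G k)| <= delta) ->
  forall k, `|G k - G 0%N - k%:R * (G 1%N - G 0%N)| <= delta * k%:R ^+ 2 / 2 /\
            `|G k - G 0%N - k%:R * (G 1%N - G 0%N)| <= 2 * Gamma * k%:R.
Proof.
move=> G1 G2.
have Gd k : `|(G k.+1 - G k) - (G 1%N - G 0%N)| <= delta * k%:R.
  elim: k => [|k IHk]; first by rewrite subrr normr0 mulr0.
  rewrite -natr1 mulrDr mulr1.
  by move: IHk (G2 k); rewrite !ler_norml => /andP[? ?] /andP[? ?]; apply/andP; split; lra.
have d0 : 0 <= delta by apply: le_trans (G2 0%N).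
move=> k; split; last first.
  elim: k => [|k IHk]; first by rewrite subrr sub0r mul0r oppr0 normr0 mulr0.
  rewrite -natr1; move: IHk (G1 k) (G1 0%N); rewrite !ler_norml.
  by move=> /andP[? ?] /andP[? ?] /andP[? ?]; apply/andP; split; lra.
elim: k => [|k IHk].
  by rewrite subrr sub0r mul0r oppr0 normr0 expr2 mul0r mulr0 mul0r.
rewrite -natr1; move: IHk (Gd k); rewrite !ler_norml.
move=> /andP[? ?] /andP[? ?]; apply/andP.
have -> : delta * (k%:R + 1) ^+ 2 / 2 =
   delta * k%:R ^+ 2 / 2 + delta * k%:R + delta / 2 by field.
by split; lra.
Qed.

(* With m_i the moments of |Xi_1|, these are the coefficients of g(S + 1),
   S = S_{n-2}, and of its first increment in the expansion of
   E[birth(S_n) g(S_n + 1) - death(S_n) g(S_n)], and the bounds for the terms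
   that involve second and first differences of g only. *)
Definition order0_coef {R : realType} (a b beta n m0 m1 m2 : R) : R :=
  a * (m0 * m0) + b * n * (m1 * m0) - n * (m1 * m0)
  - beta * n * (m2 * m0 - m1 * m0) - beta * n * (n - 1) * (m1 * m1).

Definition order1_coef {R : realType} (a b beta n m0 m1 m2 m3 : R) : R :=
  a * (m1 * m0 + m0 * m1) + b * n * (m2 * m0 + m1 * m1)
  - n * (m2 * m0 + m1 * m1 - m1 * m0)
  - beta * n * (m3 * m0 - 2 * (m2 * m0) + m1 * m0 + m2 * m1 - m1 * m1)
  - beta * n * (n - 1) * (m2 * m1 + m1 * m2 - m1 * m1).

Definition remainder2_coef {R : realType} (a b beta n m0 m1 m2 m3 : R) : R :=
  a * (m2 * m0 + m0 * m2) + (b + 1) * n * (m3 * m0 + m1 * m2)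
  + beta * n * (n - 1) * (m3 * m1 + m1 * m3).

Definition remainder1_coef {R : realType} (beta n m0 m1 m2 m3 : R) : R :=
  beta * n * (m3 * m0 + m2 * m1).

Section stein_finite.
Context {R : realType}.

Definition birth_part (a b n : R) (x y : nat) : R := a + b * n * x%:R.

Definition death_part (beta n : R) (x y : nat) : R :=
  n * x%:R + beta * n * (x%:R * (x%:R - 1))
  + beta * n * (n - 1) * (x%:R * y%:R).

(** The offset 1 keeps [g] at positive arguments, the only ones between which its increments are
    controlled. *)
Definition shifted (g : nat -> R) (M : {poly R}) k :=
  pairing (fun s => g (k + s).+1) M.

Definition moment (P : {poly R}) k := pairing (fun i => i%:R ^+ k) P.

(** By exchangeability the factors S and S(S - 1) of the rates become polynomials in the first two
    masses x and y. The death part carries g(x + y + s), which is [G] at x + y - 1; the predecessor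
    of 0 is harmless, because every term of [death_part] has the factor x. *)
Lemma pairing_stein_op (a b beta : R) m (g : nat -> R) (P : {poly R}) :
  let n := m.+2%:R in let G := shifted g (P ^+ m) in
  pairing (fun i => birth a b i * g i.+1 - death beta i * g i)
    (P ^+ m.+2) =
  pairing2 (fun x y => birth_part a b n x y * G (x + y)
                       - death_part beta n x y * G (x + y).-1) P.
Proof.
move=> n G.
have -> : pairing (fun i => birth a b i * g i.+1 - death beta i * g i)
    (P ^+ m.+2) =
  a * pairing (fun i => g i.+1) (P ^+ m.+2)
  + b * pairing (fun i => i%:R * g i.+1) (P ^+ m.+2)
  + (-1) * pairing (fun i => i%:R * g i) (P ^+ m.+2)
  + (- beta) * pairing (fun i => i%:R * (i%:R - 1) * g i) (P ^+ m.+2).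
  rewrite -!pairing_fZ -!pairing_fD; apply: eq_pairing => i.
  by rewrite /birth /death; ring.
rewrite pairing_exp 2!pairing_exp1 pairing_exp2.
have GE (c : nat -> nat -> R) :
    pairing2 (fun x y => x%:R * c x y *
      pairing (fun s => g (x + y + s)%N) (P ^+ m)) P =
    pairing2 (fun x y => x%:R * c x y * G (x + y).-1) P.
  apply: eq_pairing2 => -[|x] y; first by rewrite !mul0r.
  congr (_ * _); rewrite addSn /=; apply: eq_pairing => s; by rewrite addSn.
have GE1 : pairing2 (fun x y => x%:R *
      pairing (fun s => g (x + y + s)%N) (P ^+ m)) P =
    pairing2 (fun x y => x%:R * G (x + y).-1) P.
  rewrite -[RHS](eq_pairing2 (f := fun x y => x%:R * 1 * G (x + y).-1)); last first.
    by move=> x y; rewrite mulr1.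
  by rewrite -GE; apply: eq_pairing2 => x y; rewrite mulr1.
rewrite (GE (fun x y => x%:R - 1)) (GE (fun x y => y%:R)) GE1.
rewrite mulrDr !mulrA -!pairing2Z -!pairing2D.
apply: eq_pairing2 => x y; rewrite /birth_part /death_part /n -(natr1 m.+1) /G /shifted.
by ring.
Qed.

(** [G] is expanded at 0. The coefficients of [G 0] and of the first increment need not vanish at
    truncated moments, so both terms are kept, multiplied by bounds that do not depend on N; they
    disappear in the limit only. *)
Lemma stein_finite_bound (p : nat -> R) (a b beta : R) m (g : nat -> R)
    (Gamma V mu : R) N :
  (forall i, 0 <= p i) -> series p @ \oo --> (1 : R) ->
  0 <= a -> 0 <= b -> 0 <= beta ->
  (forall k, `|g k.+2 - g k.+1| <= Gamma) ->
  let n := m.+2%:R in let mom := moment (trunc_poly p N) in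
  (forall K, \sum_(0 <= s < K) `|delay (conv_power p m) s - conv_power p m s| <= V) ->
  mom 1%N <= mu ->
  `|pairing (fun i => birth a b i * g i.+1 - death beta i * g i)
      (trunc_poly p N ^+ m.+2)| <=
  `|order0_coef a b beta n (mom 0%N) (mom 1%N) (mom 2%N)|
      * (`|g 1%N| + Gamma * (m%:R * mu))
  + `|order1_coef a b beta n (mom 0%N) (mom 1%N) (mom 2%N) (mom 3%N)| * Gamma
  + Gamma * (V + 2 * (1 - mom 0%N ^+ m))
      * remainder2_coef a b beta n (mom 0%N) (mom 1%N) (mom 2%N) (mom 3%N)
  + 2 * Gamma * remainder1_coef beta n (mom 0%N) (mom 1%N) (mom 2%N) (mom 3%N).
Proof.
move=> p0 p1 a0 b0 beta0 g1 n mom vV m1mu; rewrite pairing_stein_op.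
set M := trunc_poly p N ^+ m; set G := shifted g M; rewrite -/n.
have P0 : nneg_poly (trunc_poly p N) by exact: nneg_trunc.
have M0 : nneg_poly M by exact: nneg_polyX.
have mom0 : mom 0%N = (trunc_poly p N).[1].
  by rewrite -pairing1; apply: eq_pairing => i; rewrite expr0.
have M1 : M.[1] <= 1.
  by rewrite horner_exp exprn_ile1 ?trunc1_ge0 ?trunc1_le1.
have Gam0 : 0 <= Gamma by apply: le_trans (g1 0%N).
set delta := Gamma * (V + _).
have GD k : G k.+1 - G k =
    pairing (fun s => g (k + s).+2 - g (k + s).+1) M.
  rewrite /G /shifted -mulN1r -pairing_fZ -pairing_fD; apply: eq_pairing => s.
  by rewrite mulN1r addSn.
have G1 k : `|G k.+1 - G k| <= Gamma.
  rewrite GD; apply: (@le_trans _ _ (pairing (fun=> Gamma) M)).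
    exact: pairing_norm.
  by rewrite pairing_cst ler_piMr.
have G2 k : `|(G k.+2 - G k.+1) - (G k.+1 - G k)| <= delta.
  rewrite !GD -mulN1r -pairing_fZ -pairing_fD /delta mom0.
  rewrite (eq_pairing (g := fun s => (g (k + s.+1).+2 - g (k + s.+1).+1)
     - (g (k + s).+2 - g (k + s).+1))); last first.
    by move=> s; rewrite mulN1r addSn addnS.
  by apply: (pairing_increment p0 p1 (u := fun s => g (k + s).+2 - g (k + s).+1)).
have G0 : `|G 0%N| <= `|g 1%N| + Gamma * (m%:R * mu).
  apply: (@le_trans _ _ (pairing (fun s => `|g 1%N| * 1 + Gamma * s%:R) M)).
    apply: pairing_norm => // s; rewrite add0n mulr1.
    elim: s => [|s IHs]; first by rewrite mulr0 addr0.
    rewrite -(subrK (g s.+1) (g s.+2)) (le_trans (ler_normD _ _))//.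
    by rewrite -natr1; move: (g1 s) IHs; lra.
  rewrite pairing_fD !pairing_fZ pairing1 lerD ?ler_piMr//.
  apply: ler_wpM2l => //; apply: pairing_id_exp_le => //.
have n0 : 0 <= n by rewrite /n.
have n1 : 0 <= n - 1 by rewrite subr_ge0 /n ler1n.
have GR := second_order_remainder G1 G2.
pose D := G 1%N - G 0%N.
pose Rk k := G k - G 0%N - k%:R * D.
have bp0 x y : 0 <= birth_part a b n x y.
  by rewrite /birth_part addr_ge0// !mulr_ge0.
have x0 (x : nat) : 0 <= x%:R * (x%:R - 1) :> R.
  case: x => [|x]; first by rewrite mul0r.
  by rewrite mulr_ge0// subr_ge0 ler1n.
rewrite (@eq_pairing2 _ _ (fun x y =>
   (G 0%N * (birth_part a b n x y - death_part beta n x y)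
   + D * (birth_part a b n x y * (x%:R + y%:R)
          - death_part beta n x y * (x%:R + y%:R - 1)))
   + (birth_part a b n x y * Rk (x + y)%N - death_part beta n x y * Rk (x + y).-1))); last first.
  (* As real numbers (x + y).-1 and x + y - 1 differ at x = y = 0 only, where [death_part] is 0. *)
  move=> x y; rewrite /Rk; case: x => [|x].
    case: y => [|y]; first by rewrite /birth_part /death_part; ring.
    rewrite add0n /death_part !mul0r !(mulr0, mul0r, addr0).
    by ring.
  rewrite addSn /= -(natr1 (x + y)) -(natr1 x) natrD; ring.
rewrite 2!pairing2D; clearbody n.
pose xy i j := fun x y : nat => (x%:R ^+ i * y%:R ^+ j : R).
have xyE i j : pairing2 (xy i j) (trunc_poly p N) = mom i * mom j.
  exact: pairing2M.
have xyd i j x y : xy i j x y = x%:R ^+ i * y%:R ^+ j by [].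
clearbody mom xy.
have -> : pairing2 (fun x y => G 0%N * (birth_part a b n x y - death_part beta n x y))
    (trunc_poly p N) = order0_coef a b beta n (mom 0%N) (mom 1%N) (mom 2%N) * G 0%N.
  rewrite pairing2Z mulrC; congr (_ * _).
  rewrite (@eq_pairing2 _ _ (fun x y => a * xy 0%N 0%N x y
    + (b * n - n + beta * n) * xy 1%N 0%N x y + (- (beta * n)) * xy 2%N 0%N x y
    + (- (beta * n * (n - 1))) * xy 1%N 1%N x y)); last first.
    move=> x y; rewrite !xyd /birth_part /death_part !expr0 !expr1.
    ring.
  rewrite !pairing2D !pairing2Z !xyE /order0_coef; ring.
have -> : pairing2 (fun x y => D * (birth_part a b n x y * (x%:R + y%:R)
          - death_part beta n x y * (x%:R + y%:R - 1))) (trunc_poly p N) =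
    order1_coef a b beta n (mom 0%N) (mom 1%N) (mom 2%N) (mom 3%N) * D.
  rewrite pairing2Z mulrC; congr (_ * _).
  rewrite (@eq_pairing2 _ _ (fun x y => a * xy 1%N 0%N x y + a * xy 0%N 1%N x y
    + (b * n - n + 2 * (beta * n)) * xy 2%N 0%N x y
    + (b * n - n + beta * n + beta * n * (n - 1)) * xy 1%N 1%N x y
    + (n - beta * n) * xy 1%N 0%N x y + (- (beta * n)) * xy 3%N 0%N x y
    + (- (beta * n) - (beta * n * (n - 1))) * xy 2%N 1%N x y
    + (- (beta * n * (n - 1))) * xy 1%N 2%N x y)); last first.
    move=> x y; rewrite !xyd /birth_part /death_part !expr0 !expr1.
    ring.
  by rewrite !pairing2D !pairing2Z !xyE /order1_coef; ring.
have RB : `|pairing2 (fun x y => birth_part a b n x y * Rk (x + y)%N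
      - death_part beta n x y * Rk (x + y).-1) (trunc_poly p N)| <=
    delta * remainder2_coef a b beta n (mom 0%N) (mom 1%N) (mom 2%N) (mom 3%N)
    + 2 * Gamma * remainder1_coef beta n (mom 0%N) (mom 1%N) (mom 2%N) (mom 3%N).
  have d0 : 0 <= delta by apply: le_trans (G2 0%N).
  have RBE : delta * remainder2_coef a b beta n (mom 0%N) (mom 1%N) (mom 2%N) (mom 3%N)
      + 2 * Gamma * remainder1_coef beta n (mom 0%N) (mom 1%N) (mom 2%N) (mom 3%N) =
    pairing2 (fun x y => (delta * a) * xy 2%N 0%N x y + (delta * a) * xy 0%N 2%N x y
      + (delta * ((b + 1) * n)) * xy 3%N 0%N x y
      + (delta * ((b + 1) * n)) * xy 1%N 2%N x y
      + (delta * (beta * n * (n - 1))) * xy 3%N 1%N x y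
      + (delta * (beta * n * (n - 1))) * xy 1%N 3%N x y
      + (2 * Gamma * (beta * n)) * xy 3%N 0%N x y
      + (2 * Gamma * (beta * n)) * xy 2%N 1%N x y) (trunc_poly p N).
    rewrite !pairing2D !pairing2Z !xyE /remainder2_coef /remainder1_coef; ring.
  rewrite RBE; apply: pairing2_norm => // x y.
  set X : R := x%:R; set Y : R := y%:R.
  have X0 : 0 <= X by [].
  have Y0 : 0 <= Y by [].
  (* [death_part] is u + v, and u takes the quadratic remainder, of size [delta]. In v the factor
     x(x - 1) is already present, and a quadratic remainder would call for fourth moments; the
     linear remainder stays within third moments, at the price of [Gamma] in place of [delta]. *)
  pose u := n * X + beta * n * (n - 1) * (X * Y).
  pose v := beta * n * (X * (X - 1)).
  have u0 : 0 <= u by rewrite /u addr_ge0// ?mulr_ge0.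
  have v0 : 0 <= v by exact: mulr_ge0 (mulr_ge0 beta0 n0) (x0 x).
  have b0' := bp0 x y.
  have sq (z : R) : 0 <= z -> z <= X + Y -> delta * z ^+ 2 / 2 <= delta * (X ^+ 2 + Y ^+ 2).
    move=> z0 zXY; rewrite -mulrA ler_wpM2l// ler_pdivrMr//.
    apply: (@le_trans _ _ ((X + Y) ^+ 2)); first by rewrite lerXn2r ?nnegrE ?addr_ge0.
    have := sqr_ge0 (X - Y); nra.
  have E1 : `|birth_part a b n x y * Rk (x + y)%N|
      <= birth_part a b n x y * (delta * (X ^+ 2 + Y ^+ 2)).
    rewrite normrM (ger0_norm b0') ler_wpM2l//.
    by have [+ _] := GR (x + y)%N => /le_trans; apply; rewrite sq// natrD.
  have E2 : `|death_part beta n x y * Rk (x + y).-1|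
      <= u * (delta * (X ^+ 2 + Y ^+ 2)) + v * (2 * Gamma * (X + Y)).
    have -> : death_part beta n x y = u + v by rewrite /death_part /u /v; ring.
    rewrite normrM (ger0_norm (addr_ge0 u0 v0)) mulrDl.
    have le1 : (x + y).-1%:R <= X + Y by rewrite -natrD ler_nat leq_pred.
    have [R1 R2] := GR (x + y).-1.
    apply: lerD; apply: ler_wpM2l => //.
      by apply: (le_trans R1); rewrite sq.
    by apply: (le_trans R2); rewrite ler_wpM2l// mulr_ge0.
  apply: le_trans (ler_normB _ _) _; apply: le_trans (lerD E1 E2) _.
  have E3 : 0 <= 2 * Gamma * (beta * n) * (X * (X + Y)).
    by rewrite !mulr_ge0// addr_ge0.
  rewrite -subr_ge0; apply: (le_trans E3); rewrite le_eqVlt; apply/orP; left.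
  by apply/eqP; rewrite !xyd /birth_part /u /v -/X -/Y !expr0 !expr1; ring.
rewrite -addrA; apply: le_trans (ler_normD _ _) _; rewrite -[leRHS]addrA -[leRHS]addrA.
apply: lerD; first by rewrite normrM ler_wpM2l.
apply: le_trans (ler_normD _ _) _; apply: lerD => //.
by rewrite normrM ler_wpM2l// G1.
Qed.

End stein_finite.

(** The finite bound holds at every truncation level N. As N tends to infinity the mass defects tend
    to 0 and the coefficients tend to their values at the true moments, where those of order 0 and 1
    are zero. *)
Lemma stein_bound {R : realType} (p : nat -> R) (a b beta : R) m
    (q h : nat -> R) (V EH M1 M2 M3 : R) :
  let n := m.+2%:R in let hbar := limn (series (fun j => q j * h j)) in
  (forall i, 0 <= p i) -> series p @ \oo --> (1 : R) ->
  moment (trunc_poly p N) 1 @[N --> \oo] --> M1 ->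
  moment (trunc_poly p N) 2 @[N --> \oo] --> M2 ->
  moment (trunc_poly p N) 3 @[N --> \oo] --> M3 ->
  0 < a -> 0 <= b -> b <= 1 -> 0 <= beta ->
  (forall i, 0 < q i) ->
  (forall i, q i.+1 * death beta i.+1 = q i * birth a b i) ->
  series q @ \oo --> (1 : R) ->
  (forall i, 0 <= h i <= 1) ->
  (forall K, \sum_(0 <= s < K) `|delay (conv_power p m) s - conv_power p m s| <= V) ->
  order0_coef a b beta n 1 M1 M2 = 0 ->
  order1_coef a b beta n 1 M1 M2 M3 = 0 ->
  series (fun j => conv_power p m.+2 j * h j) @ \oo --> EH ->
  `|EH - hbar| <= a^-1 * (V * remainder2_coef a b beta n 1 M1 M2 M3
                          + 2 * remainder1_coef beta n 1 M1 M2 M3).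
Proof.
move=> n hbar p0 p1 cM1 cM2 cM3 a0 b0 b1 beta0 q0 qS q1 h01 vV e0 e1 cE.
pose g := stein_sol beta q h.
pose P N := trunc_poly p N; pose mom N k := moment (P N) k.
have h1 i : `|h i| <= 1.
  by case/andP: (h01 i) => ? ?; rewrite ger0_norm.
have mom0E N : mom N 0%N = (P N).[1].
  by rewrite -pairing1; apply: eq_pairing => i; rewrite expr0.
have c0 : mom N 0%N @[N --> \oo] --> (1 : R).
  by under eq_fun do rewrite mom0E; exact: trunc1_cvg.
have mom1 N : mom N 1%N <= M1.
  rewrite -(cvg_lim (@Rhausdorff R) cM1).
  apply: (@nondecreasing_cvgn_le R (fun k => mom k 1%N)); last exact: cvgP cM1.
  apply/nondecreasing_seqP => k; rewrite /mom /moment /P !pairing_trunc.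
  by rewrite big_nat_recr//= lerDl mulr_ge0.
have g1 k : `|g k.+2 - g k.+1| <= a^-1.
  exact: (stein_sol_diff a0 b0 b1 beta0 q0 qS q1 h01).
have hbar1 : `|hbar| <= 1.
  have c := pbd_mean_cvg q0 q1 h01.
  have h0 : 0 <= hbar.
    apply: limr_ge; first exact: cvgP c.
    apply: nearW => k; apply: sumr_ge0 => i _.
    by case/andP: (h01 i) => ? ?; rewrite mulr_ge0// ltW.
  rewrite ger0_norm//; apply: (ler_cvg_to c q1).
  apply: nearW => k; apply: ler_sum => i _.
  by case/andP: (h01 i) => ? ?; rewrite ler_piMr// ltW.
have gap N : `|EH - pairing h (P N ^+ m.+2)| <= 1 - mom N 0%N ^+ m.+2.
  have PE K : (size (P N ^+ m.+2) <= K)%N ->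
      pairing h (P N ^+ m.+2) = series (fun j => (P N ^+ m.+2)`_j * h j) K.
    by move=> sK; rewrite (pairing_wide _ sK) /series/= big_mkord.
  have cD : `|series (fun j => conv_power p m.+2 j * h j) K - pairing h (P N ^+ m.+2)|
      @[K --> \oo] --> `|EH - pairing h (P N ^+ m.+2)|.
    by apply: cvg_norm; apply: cvgB => //; exact: cvg_cst.
  apply: (ler_cvg_to cD (cvg_cst _)).
  exists (size (P N ^+ m.+2)) => //= K sK.
  rewrite (PE K)// /series/= -sumrB mom0E.
  apply: le_trans (ler_norm_sum _ _ _) _.
  apply: le_trans (conv_power_trunc_gap p0 p1 m.+2 N K).
  apply: ler_sum => j _; rewrite -mulrBl normrM.
  have d0 : 0 <= conv_power p m.+2 j - (P N ^+ m.+2)`_j.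
    by rewrite subr_ge0 coef_exp_trunc_le.
  by rewrite (ger0_norm d0) ler_piMr.
have TN N : `|pairing h (P N ^+ m.+2) - hbar * mom N 0%N ^+ m.+2| <=
  `|order0_coef a b beta n (mom N 0%N) (mom N 1%N) (mom N 2%N)|
      * (`|g 1%N| + a^-1 * (m%:R * M1))
  + `|order1_coef a b beta n (mom N 0%N) (mom N 1%N) (mom N 2%N) (mom N 3%N)|
      * a^-1
  + a^-1 * (V + 2 * (1 - mom N 0%N ^+ m))
      * remainder2_coef a b beta n (mom N 0%N) (mom N 1%N) (mom N 2%N) (mom N 3%N)
  + 2 * a^-1
      * remainder1_coef beta n (mom N 0%N) (mom N 1%N) (mom N 2%N) (mom N 3%N).
  have := stein_finite_bound p0 p1 (ltW a0) b0 beta0 g1 vV (mom1 N).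
  congr (`|_| <= _).
  rewrite (eq_pairing (g := fun i => h i + - hbar)); last first.
    by move=> i; rewrite (stein_eq a0 b0 beta0 q0 qS).
  by rewrite pairing_fD pairing_cst horner_exp mom0E mulNr.
pose RHS N :=
  `|order0_coef a b beta n (mom N 0%N) (mom N 1%N) (mom N 2%N)|
      * (`|g 1%N| + a^-1 * (m%:R * M1))
  + `|order1_coef a b beta n (mom N 0%N) (mom N 1%N) (mom N 2%N) (mom N 3%N)|
      * a^-1
  + a^-1 * (V + 2 * (1 - mom N 0%N ^+ m))
      * remainder2_coef a b beta n (mom N 0%N) (mom N 1%N) (mom N 2%N) (mom N 3%N)
  + 2 * a^-1
      * remainder1_coef beta n (mom N 0%N) (mom N 1%N) (mom N 2%N) (mom N 3%N)
  + 2 * (1 - mom N 0%N ^+ m.+2).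
have bnd N : `|EH - hbar| <= RHS N.
  (* Three errors: truncation of the law of the sum, Stein's equation under the truncated law, and
     the missing mass in front of [hbar]. *)
  have -> : EH - hbar = (EH - pairing h (P N ^+ m.+2))
    + (pairing h (P N ^+ m.+2) - hbar * mom N 0%N ^+ m.+2)
    - hbar * (1 - mom N 0%N ^+ m.+2) by ring.
  have := gap N; have := TN N.
  have hb : `|hbar * (1 - mom N 0%N ^+ m.+2)| <= 1 - mom N 0%N ^+ m.+2.
    have m0 : 0 <= 1 - mom N 0%N ^+ m.+2.
      by rewrite subr_ge0 mom0E exprn_ile1 ?trunc1_ge0 ?trunc1_le1.
    by rewrite normrM (ger0_norm m0) ler_piMl.
  rewrite /RHS => t1 t2; apply: le_trans (ler_normB _ _) _.
  have := ler_normD (EH - pairing h (P N ^+ m.+2))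
    (pairing h (P N ^+ m.+2) - hbar * mom N 0%N ^+ m.+2).
  by lra.
have c1 : mom N 1%N @[N --> \oo] --> M1 by [].
have c2 : mom N 2%N @[N --> \oo] --> M2 by [].
have c3 : mom N 3%N @[N --> \oo] --> M3 by [].
have cRHS : RHS N @[N --> \oo] -->
  `|order0_coef a b beta n 1 M1 M2| * (`|g 1%N| + a^-1 * (m%:R * M1))
  + `|order1_coef a b beta n 1 M1 M2 M3| * a^-1
  + a^-1 * (V + 2 * (1 - 1 ^+ m)) * remainder2_coef a b beta n 1 M1 M2 M3
  + 2 * a^-1 * remainder1_coef beta n 1 M1 M2 M3
  + 2 * (1 - 1 ^+ m.+2).
  have cX k : mom N 0%N ^+ k @[N --> \oo] --> (1 : R) ^+ k.
    elim: k => [|k IHk].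
      under eq_fun do rewrite expr0; rewrite expr0; exact: cvg_cst.
    under eq_fun do rewrite exprS; rewrite exprS; exact: cvgM.
  rewrite /RHS /order0_coef /order1_coef /remainder2_coef /remainder1_coef.
  clearbody mom; clear -c0 c1 c2 c3 cX.
  repeat lazymatch goal with
  | |- context [fmap (fun N => mom N 0%N) _] => exact: c0
  | |- context [fmap (fun N => mom N 1%N) _] => exact: c1
  | |- context [fmap (fun N => mom N 2%N) _] => exact: c2
  | |- context [fmap (fun N => mom N 3%N) _] => exact: c3
  | |- context [fmap (fun N => mom N 0%N ^+ _) _] => exact: cX
  | |- context [fmap (fun N => `|_|) _] => apply: cvg_norm
  | |- context [fmap (fun N => _ + - _) _] => apply: cvgB
  | |- context [fmap (fun N => _ + _) _] => apply: cvgD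
  | |- context [fmap (fun N => _ * _) _] => apply: cvgM
  | |- _ => exact: cvg_cst
  end.
have : `|EH - hbar| <= lim (RHS N @[N --> \oo]).
  by apply: limr_ge; [exact: cvgP cRHS|exact: nearW].
rewrite (cvg_lim (@Rhausdorff R) cRHS) e0 e1 normr0 !mul0r !expr1n subrr mulr0 !addr0 !add0r.
by move/le_trans; apply; rewrite le_eqVlt; apply/orP; left; apply/eqP; ring.
Qed.

(** * The metric d1 and relocation of points *)

Section d1_bounds.
Context {R : realType} {T : pointedMetricType R}.
Implicit Types (xi eta : config T) (s : seq T).

(** [d1] minimises over permutations of the particular enumerations given by [cfg_points]. Any other
    listings differ from these by permutations p1 and p2, and p1^-1 p2 is then one competitor in the
    minimum. *)
Lemma d1_perm_le xi eta s1 s2 :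
  perm_eq (cfg_points xi) s1 -> perm_eq (cfg_points eta) s2 ->
  size s1 = size s2 ->
  d1 xi eta <= (size s1)%:R^-1 *
    \sum_(i < size s1) mdist (nth point s1 i) (nth point s2 i).
Proof.
move=> P1 P2 S; have m1 : size s1 = mass xi by rewrite /mass (perm_size P1).
have m2 : mass eta = mass xi by rewrite -m1 S /mass (perm_size P2).
rewrite /d1 m2 eqxx /= m1.
have t1P : size s1 == mass xi by rewrite m1.
have t2P : size s2 == mass xi by rewrite -S m1.
have u1P : size (cfg_points xi) == mass xi by [].
have u2P : size (cfg_points eta) == mass xi by rewrite -m2.
have : perm_eq (Tuple t1P) (Tuple u1P) by rewrite /= perm_sym.
move=> /tuple_permP[p1 /= E1].
have : perm_eq (Tuple t2P) (Tuple u2P) by rewrite /= perm_sym.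
move=> /tuple_permP[p2 /= E2].
have n1 (i : 'I_(mass xi)) : nth point s1 i = nth point (cfg_points xi) (p1 i).
  by rewrite E1 nth_mktuple (tnth_nth point).
have n2 (i : 'I_(mass xi)) : nth point s2 i = nth point (cfg_points eta) (p2 i).
  by rewrite E2 nth_mktuple (tnth_nth point).
apply: (@le_trans _ _ ((mass xi)%:R^-1 * \sum_(i < mass xi)
   mdist (nth point (cfg_points xi) i)
         (nth point (cfg_points eta) ((p1^-1 * p2)%g i)))).
  exact: bigmin_le.
rewrite ler_wpM2l// (reindex_inj (@perm_inj _ p1))/=.
by apply: ler_sum => i _; rewrite permM permK n1 n2.
Qed.

Lemma d1_eq_mass_le1 xi eta : (forall x y : T, mdist x y <= 1) ->
  d1 xi eta <= 1.
Proof.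
move=> d0_le1; rewrite /d1; case: ifP => // _.
apply: (le_trans (bigmin_le_id _ _ _ _)).
have [m0|m0] := eqVneq (mass xi) 0%N; first by rewrite m0 invr0 mul0r.
rewrite ler_pdivrMl ?ltr0n ?lt0n// mulr1.
apply: (@le_trans _ _ (\sum_(i < mass xi) 1)); first exact: ler_sum.
by rewrite sumr_const card_ord.
Qed.

Lemma mass_seq_mset s : mass (seq_mset s : config T) = size s.
Proof. by rewrite /mass /cfg_points (perm_size (perm_eq_seq_mset s)). Qed.

Lemma cfg_count_seq_mset (B : set T) s :
  cfg_count B (seq_mset s) = count (fun x => x \in B) s.
Proof. exact/seq.permP/perm_eq_seq_mset. Qed.

Lemma cfg_countT xi : cfg_count [set: T] xi = mass xi.
Proof.
rewrite /cfg_count /mass -(count_predT (cfg_points xi)).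
by apply: eq_count => x; rewrite in_setT.
Qed.

Lemma cfg_count_le_mass (B : set T) xi : (cfg_count B xi <= mass xi)%N.
Proof. exact: count_size. Qed.

Lemma cfg_count_msetn (B : set T) k x :
  cfg_count B (msetn k x) = ((x \in B) * k)%N.
Proof. by rewrite /cfg_count enum_msetn count_nseq. Qed.

Lemma mass_add xi eta : mass (cfg_add xi eta) = (mass xi + mass eta)%N.
Proof. by rewrite -!cfg_countT cfg_count_msetD. Qed.

Lemma mass_msetn k x : mass (msetn k x : config T) = k.
Proof. by rewrite -cfg_countT cfg_count_msetn in_setT mul1n. Qed.

Lemma cfg_count_big (B : set T) I (r : seq I) (F : I -> config T) :
  cfg_count B (\big[cfg_add/@mset0 T]_(i <- r) F i) =
  (\sum_(i <- r) cfg_count B (F i))%N.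
Proof.
elim: r => [|i r IHr]; last by rewrite !big_cons cfg_count_msetD IHr.
by rewrite !big_nil /cfg_count enum_mset0.
Qed.

Definition relocate (r : T -> T) xi : config T :=
  seq_mset [seq r x | x <- cfg_points xi].

Lemma mass_relocate r xi : mass (relocate r xi) = mass xi.
Proof. by rewrite mass_seq_mset size_map. Qed.

Lemma cfg_count_relocate r (B : set T) xi :
  cfg_count B (relocate r xi) = cfg_count (r @^-1` B) xi.
Proof.
rewrite cfg_count_seq_mset count_map; apply: eq_count => x /=.
by apply/idP/idP; rewrite !inE.
Qed.

Lemma d1_relocate r eps xi : 0 <= eps -> (forall x, mdist x (r x) <= eps) ->
  d1 xi (relocate r xi) <= eps.
Proof.
move=> eps0 reps.
have := @d1_perm_le xi (relocate r xi) (cfg_points xi)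
  [seq r x | x <- cfg_points xi].
rewrite size_map => /(_ (perm_refl _) (perm_eq_seq_mset _) erefl) /le_trans.
apply.
have [m0|m0] := eqVneq (size (cfg_points xi)) 0%N.
  by rewrite m0 invr0 mul0r.
rewrite ler_pdivrMl ?ltr0n ?lt0n//.
apply: (@le_trans _ _ (\sum_(i < size (cfg_points xi)) eps)).
  by apply: ler_sum => i _; rewrite (nth_map point).
by rewrite sumr_const card_ord mulr_natl.
Qed.

Lemma sum_count_mem (ys s : seq T) : uniq ys -> {subset s <= ys} ->
  size s = (\sum_(y <- ys) count_mem y s)%N.
Proof.
move=> uys; elim: s => [|x s IHs] sys; first by rewrite big1.
rewrite /= big_split/= -IHs; last first.
  by move=> z zs; apply: sys; rewrite inE zs orbT.
rewrite (bigD1_seq x)//=; last by apply: sys; rewrite mem_head.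
by rewrite eqxx big1// => y /negbTE yx; rewrite eq_sym yx.
Qed.

Lemma cfg_count_set1 y xi : cfg_count [set y] xi = (xi : multiset T) y.
Proof.
rewrite -count_mem_mset; apply: eq_count => x.
by apply/idP/idP; rewrite !inE => /eqP.
Qed.

(* Match the common part of the two configurations with itself. *)
Lemma d1_mismatch (ys : seq T) xi eta : (forall x y : T, mdist x y <= 1) ->
  mass xi = mass eta -> uniq ys -> {subset cfg_points xi <= ys} ->
  d1 xi eta <= (mass xi)%:R^-1 *
    \sum_(y <- ys) `|(cfg_count [set y] xi)%:R - (cfg_count [set y] eta)%:R|.
Proof.
move=> d0_le1 M uys xiys.
pose c := enum_mset (msetI (xi : multiset T) (eta : multiset T)).
pose r1 := enum_mset (msetB (xi : multiset T) (eta : multiset T)).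
pose r2 := enum_mset (msetB (eta : multiset T) (xi : multiset T)).
have P1 : perm_eq (cfg_points xi) (c ++ r1).
  apply/allP => x _ /=; rewrite count_cat !count_mem_mset !msetE2.
  by rewrite subnE minnE; lia.
have P2 : perm_eq (cfg_points eta) (c ++ r2).
  apply/allP => x _ /=; rewrite count_cat !count_mem_mset !msetE2; lia.
have S : size (c ++ r1) = size (c ++ r2).
  by rewrite -(perm_size P1) -(perm_size P2).
apply: le_trans (d1_perm_le P1 P2 S) _; rewrite -(perm_size P1).
rewrite ler_wpM2l//.
apply: (@le_trans _ _ (size r1)%:R).
  rewrite (perm_size P1) size_cat big_split_ord/= big1 ?add0r; last first.
    by move=> i _; rewrite !nth_cat ltn_ord mdistxx.
  apply: (@le_trans _ _ (\sum_(i < size r1) 1)); first exact: ler_sum.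
  by rewrite sumr_const card_ord.
have r1ys : {subset r1 <= ys}.
  move=> x xr; apply: xiys; rewrite (perm_mem P1) mem_cat xr; exact: orbT.
rewrite (sum_count_mem uys r1ys) natr_sum; apply: ler_sum => y _.
rewrite !cfg_count_set1 count_mem_mset msetE2.
have [le|lt] := leqP ((xi : multiset T) y) ((eta : multiset T) y).
  by rewrite (eqP le) normr_ge0.
by rewrite natrB ?(ltnW lt)// ler_norm.
Qed.

End d1_bounds.

(** A preimage under [g] is a countable union of fibres of [c]. This makes an arbitrary f measurable
    after a relocation, since the result depends on finitely many integer counts. *)
Lemma measurable_fun_countable_factor d d' (X : measurableType d)
    (Y : measurableType d') (C : countType) (c : X -> C) (g : X -> Y) :
  (forall k, measurable (c @^-1` [set k])) ->
  (forall x y, c x = c y -> g x = g y) -> measurable_fun [set: X] g.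
Proof.
move=> mc cg _ B mB; rewrite setTI.
have -> : g @^-1` B = \bigcup_(k : C)
    (if `[< exists2 x, c x = k & B (g x) >] then c @^-1` [set k] else set0).
  apply/seteqP; split => [x Bx|x [k _]] /=.
    by exists (c x) => //; case: ifPn => // /asboolP; apply; exists x.
  by case: ifPn => // /asboolP[y yk By] /= xk; rewrite (cg x y)// yk xk.
apply: countable_bigcupT_measurable => // k.
by case: ifP => _ //; exact: mc.
Qed.

Lemma measurable_fun_fiber_nat d (X : measurableType d) (N : X -> nat) :
  (forall k, measurable (N @^-1` [set k])) -> measurable_fun [set: X] N.
Proof. by move=> mN; apply: (@measurable_fun_countable_factor _ _ _ _ _ N). Qed.

(** * Relocation to finitely many centres *)

Section finite_relocation.
Context {R : realType} {T : pointedMetricType R}.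
Implicit Types (xi eta : config T).

Lemma measurable_mass : measurable_fun [set: config T] (@mass R T).
Proof.
rewrite (_ : @mass R T = cfg_count [set: T]); last first.
  by apply/funext => xi; rewrite cfg_countT.
exact: measurable_cfg_count.
Qed.

Definition cell_counts m (cell : T -> 'I_m) xi : {ffun 'I_m -> nat} :=
  [ffun i => cfg_count (cell @^-1` [set i]) xi].

Lemma relocate_countE m (cell : T -> 'I_m) (t : 'I_m -> T) xi y :
  cfg_count [set y] (relocate (t \o cell) xi) =
  (\sum_(i | t i == y) cell_counts cell xi i)%N.
Proof.
rewrite cfg_count_relocate /cfg_count -sum1_count big_mkcond.
under [RHS]eq_bigr do rewrite ffunE /cfg_count -sum1_count big_mkcond.
rewrite exchange_big/=; apply: eq_bigr => x _; rewrite -big_mkcondr/=.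
rewrite (eq_bigl (fun i => (i == cell x) && (t (cell x) == y))); last first.
  move=> i /=; have [->|ix] := eqVneq i (cell x).
    by rewrite (_ : x \in _) ?andbT//; rewrite inE.
  rewrite (_ : x \in _ = false) ?andbF//.
  by apply/negP; rewrite inE /= => xi'; rewrite xi' eqxx in ix.
rewrite big_mkcondr/= big_pred1_eq; congr (if _ then _ else _).
by apply/idP/idP; rewrite inE /= => /eqP.
Qed.

Lemma relocate_cell_counts m (cell : T -> 'I_m) (t : 'I_m -> T) xi eta :
  cell_counts cell xi = cell_counts cell eta ->
  relocate (t \o cell) xi = relocate (t \o cell) eta.
Proof.
move=> /ffunP E; apply/msetP => y; rewrite -!cfg_count_set1 !relocate_countE.
by apply: eq_bigr => i _; rewrite E.
Qed.

Lemma assembleE m (G : 'I_m -> set T) (cell : T -> 'I_m) (t : 'I_m -> T) xi :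
  (forall i, G i = cell @^-1` [set i]) ->
  assemble G t xi = relocate (t \o cell) xi.
Proof.
move=> GE; apply/msetP => y; rewrite -!cfg_count_set1 relocate_countE.
rewrite cfg_count_big [RHS]big_mkcond; apply: eq_bigr => i _.
rewrite cfg_count_msetn ffunE GE; have [<-|ty] := eqVneq (t i) y.
  by rewrite (_ : t i \in _) ?mul1n//; rewrite inE.
by rewrite (_ : t i \in _ = false) ?mul0n//; apply/negP; rewrite inE => /eqP; exact/negP.
Qed.

Definition measurable_cells m (cell : T -> 'I_m) :=
  forall i, measurable (cell @^-1` [set i] : set (borel T)).

Lemma measurable_cell_counts m (cell : T -> 'I_m) k : measurable_cells cell ->
  measurable (cell_counts cell @^-1` [set k]).
Proof.
move=> mcell.
have -> : cell_counts cell @^-1` [set k] = \bigcap_(i in [set: 'I_m])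
    (cfg_count (cell @^-1` [set i]) @^-1` [set k i]).
  apply/seteqP; split => [xi <- i _|xi H]/=; first by rewrite ffunE.
  by apply/ffunP => i; rewrite ffunE; apply: (H i).
apply: fin_bigcap_measurable => // i _.
rewrite -[X in measurable X]setTI.
exact: (measurable_cfg_count (mcell i)).
Qed.

Lemma measurable_relocated d (Y : measurableType d) (f : config T -> Y) m
    (cell : T -> 'I_m) (t : 'I_m -> T) : measurable_cells cell ->
  measurable_fun [set: config T] (fun xi => f (relocate (t \o cell) xi)).
Proof.
move=> mcell; apply: (@measurable_fun_countable_factor _ _ _ _ _
  (cell_counts cell)) => [k|xi eta E]; first exact: measurable_cell_counts.
by rewrite (relocate_cell_counts t E).
Qed.

(** A finite subcover by balls is made disjoint by sending x to the first ball of the list that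
    contains it; the cells are then differences of open sets and finite unions of open sets. *)
Lemma compact_cells eps : compact [set: T] -> 0 < eps ->
  exists m (cell : T -> 'I_m) (t : 'I_m -> T),
    measurable_cells cell /\ forall x, mdist x (t (cell x)) <= eps.
Proof.
move=> cT eps0; have := cT; rewrite compact_cover.
move=> /(_ T setT (fun x => (ball x eps)°)); case.
- by move=> x _; exact: open_interior.
- by move=> x _; exists x => //; exact: nbhsx_ballx.
move=> D _ coverD; pose s : seq T := enum_fset D.
pose O (c : T) : set T := (ball c eps)°.
have has_s x : has (fun c => x \in O c) s.
  have [c /= cD xc] := coverD x Logic.I; apply/hasP; exists c => //.
  by rewrite inE.
have find_s x : (find (fun c => x \in O c) s < size s)%N.
  by rewrite -has_find.
pose cell x := Ordinal (find_s x).
exists (size s), cell, (nth point s); split=> [i|x]; last first.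
  have := nth_find point (has_s x); rewrite inE => /interior_subset.
  by rewrite ballEmdist /= metric_sym => /ltW.
have mO c : measurable (O c : set (borel T)).
  by apply: sub_sigma_algebra; exact: open_interior.
have -> : cell @^-1` [set i] = O (nth point s i) `&`
    \bigcap_(j in [set j | (j < i)%N]) ~` O (nth point s j).
  apply/seteqP; split => [x /= ci|x /= [xi nx]].
    have fi : find (fun c => x \in O c) s = i by rewrite -ci.
    split; first by have := nth_find point (has_s x); rewrite fi inE.
    move=> j /= ji; have := @before_find _ point (fun c => x \in O c) s j.
    by rewrite fi => /(_ ji) => /negP; rewrite inE.
  apply/val_inj => /=; apply/eqP; rewrite eqn_leq; apply/andP; split.
    rewrite leqNgt; apply/negP => fi.
    have := @before_find _ point (fun c => x \in O c) s i fi.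
    by move/negP; rewrite inE.
  rewrite leqNgt; apply/negP => fi; apply: (nx _ fi).
  by have := nth_find point (has_s x); rewrite inE.
apply: measurableI => //.
by apply: bigcap_measurableType => j _; apply: measurableC.
Qed.

(** The relocations along finer and finer cells move f by at most 1/(k + 1), and f composed with
    each of them is measurable; f is their limit. *)
Lemma measurable_d1_lipschitz (f : config T -> R) : compact [set: T] ->
  (forall xi eta, `|f xi - f eta| <= d1 xi eta) ->
  measurable_fun [set: config T] f.
Proof.
move=> cT fL.
have ex (k : nat) : exists h : config T -> R, measurable_fun [set: config T] h /\
    forall xi, `|f xi - h xi| <= k.+1%:R^-1.
  have k0 : (0 : R) < k.+1%:R^-1 by rewrite invr_gt0.
  have [m [cell [t [mcell cellt]]]] := compact_cells cT k0.
  exists (fun xi => f (relocate (t \o cell) xi)); split.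
    exact: measurable_relocated.
  by move=> xi; apply: le_trans (fL _ _) _; apply: d1_relocate => //; exact: ltW.
have [h hP] := choice ex.
apply: (@measurable_fun_cvg _ _ _ setT h) => [k|xi _]; first by case: (hP k).
apply/cvgrPdist_le => e e0; near=> k.
apply: (le_trans (proj2 (hP k) xi)).
by apply: ltW; near: k; exact: (near_infty_natSinv_lt (PosNum e0)).
Unshelve. all: by end_near. Qed.

End finite_relocation.

Lemma leeB_abseC (R : realDomainType) (x y : \bar R) :
  x \is a fin_num -> y \is a fin_num -> (x - y <= `|y - x|)%E.
Proof.
by case: x => [x| |]//; case: y => [y| |]//= _ _; rewrite lee_fin distrC ler_norm.
Qed.

(** * Lower bounds for the partitional total variation *)

Section partition_total_variation.
Context {R : realType} {T : pointedMetricType R}.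

Lemma eps_partition_cell eps m (G : 'I_m -> set T) (t : 'I_m -> T) :
  (forall x y : T, mdist x y <= 1) -> eps_partition eps G t ->
  0 <= eps /\ exists cell : T -> 'I_m,
    [/\ forall i, G i = cell @^-1` [set i], measurable_cells cell &
        forall x, mdist x (t (cell x)) <= eps].
Proof.
move=> d0_le1 [mG tG GT _ Geps]; split.
  by apply: le_trans Geps; apply: bigmax_ge_id.
have ex x : exists i, G i x.
  by have : [set: T] x by []; rewrite -GT => -[i _ Gix]; exists i.
have [cell cellP] := choice ex.
have GE i : G i = cell @^-1` [set i].
  apply/seteqP; split=> [x Gix /=|x /= <-]; last exact: cellP.
  apply/eqP/negPn/negP => /eqP ci.
  by apply: ci; apply: (tG _ _ I I); exists x.
exists cell; split => //; first by move=> i; rewrite -GE; case: (mG i).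
move=> x.
(* The radius is a real supremum; distances being at most 1, it is a genuine upper bound and not a
   default value. *)
have h1 : mdist x (t (cell x)) <= Defs.radius (G (cell x)) (t (cell x)).
  apply: ub_le_sup; last by exists x => //; exact: cellP.
  by exists 1 => _ [s _ <-].
have h2 : Defs.radius (G (cell x)) (t (cell x)) <= eps.
  by apply: le_trans Geps; exact: (le_bigmax _ (fun i => Defs.radius (G i) (t i))).
exact: (le_trans h1 h2).
Qed.

Lemma measurable_set1_borel (y : T) : measurable ([set y] : set (borel T)).
Proof.
rewrite -[X in measurable X]setCK; apply: measurableC.
apply: sub_sigma_algebra; apply: closed_openC.
exact: (accessible_closed_set1 (hausdorff_accessible (@metric_hausdorff _ T))).
Qed.

Context {d : measure_display} {W : measurableType d}.
Variables (P : probability W R) (V : W -> config T).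

Lemma TV_ge_test m (G : 'I_m -> set T) (cell : T -> 'I_m) (t : 'I_m -> T) i
    (A : set (config T)) : (forall i, G i = cell @^-1` [set i]) ->
  measurable A ->
  (`|P [set w | A (cfg_add (relocate (t \o cell) (V w)) (msetn 1%N (t i)))]
    - P [set w | A (relocate (t \o cell) (V w))]| <= TV P V G t)%E.
Proof.
move=> GE mA.
have aE : (fun w => assemble G t (V w)) = (fun w => relocate (t \o cell) (V w)).
  by apply/funext => w; exact: assembleE.
apply: (@le_trans _ _ (dtv
   (pushforward P (fun w => cfg_add (assemble G t (V w)) (msetn 1%N (t i))))
   (pushforward P (fun w => assemble G t (V w))))).
  apply: ereal_sup_ubound; exists A => //.
  rewrite /pushforward aE; congr (`| P _ - _ |)%E.
  by apply/seteqP; split => w /=; rewrite (assembleE _ _ GE).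
exact: (le_bigmax _ (fun i => dtv
   (pushforward P (fun w => cfg_add (assemble G t (V w)) (msetn 1%N (t i))))
   (pushforward P (fun w => assemble G t (V w))))).
Qed.

Hypothesis mV : measurable_fun [set: W] V.

Lemma measurable_cfg_count_comp (B : set T) (A : set nat) :
  measurable (B : set (borel T)) ->
  measurable [set w | A (cfg_count B (V w))].
Proof.
move=> mB; rewrite -[X in measurable X]setTI.
apply: (measurableT_comp (measurable_cfg_count mB) mV) => //.
Qed.

Lemma measurable_mass_comp (A : set nat) : measurable [set w | A (mass (V w))].
Proof.
rewrite -[X in measurable X]setTI.
exact: (measurableT_comp measurable_mass mV).
Qed.

(** The test event is that at most k points sit at [t i]. After one more point is put there it says
    that there were fewer than k before, so the two probabilities differ by exactly the atom at
    k. *)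
Lemma TV_ge_point m (G : 'I_m -> set T) (cell : T -> 'I_m) (t : 'I_m -> T) i k :
  (forall i, G i = cell @^-1` [set i]) -> measurable_cells cell ->
  (P [set w | cfg_count ((t \o cell) @^-1` [set t i]) (V w) = k] <= TV P V G t)%E.
Proof.
move=> GE mcell.
have mH : measurable ((t \o cell) @^-1` [set t i] : set (borel T)).
  have -> : (t \o cell) @^-1` [set t i] =
      \bigcup_(j in [set j | t j = t i]) cell @^-1` [set j].
    apply/seteqP; split=> [x /= xi|x [j /= <- <-]//].
    by exists (cell x).
  by apply: fin_bigcup_measurable => //; exact: finite_finset.
pose A : set (config T) := [set xi | (cfg_count [set t i] xi <= k)%N].
have mA : measurable A.
  rewrite -[X in measurable X]setTI.
  apply: (measurable_cfg_count (measurable_set1_borel (t i)) measurableT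
     (Y := [set j | (j <= k)%N])) => //.
apply: le_trans (TV_ge_test t i GE mA).
set N := fun w => cfg_count ((t \o cell) @^-1` [set t i]) (V w).
have -> : [set w | A (relocate (t \o cell) (V w))] = [set w | (N w <= k)%N].
  by apply/seteqP; split => w /=; rewrite /A /= cfg_count_relocate.
have -> : [set w | A (cfg_add (relocate (t \o cell) (V w)) (msetn 1%N (t i)))]
    = [set w | (N w < k)%N].
  apply/seteqP; split => w /=; rewrite /A /= cfg_count_msetD cfg_count_relocate
    cfg_count_msetn (_ : _ \in _) ?muln1 ?addn1// inE//.
have mle : measurable [set w | (N w <= k)%N].
  exact: (@measurable_cfg_count_comp _ [set j | (j <= k)%N]).
have mlt : measurable [set w | (N w < k)%N].
  exact: (@measurable_cfg_count_comp _ [set j | (j < k)%N]).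
have -> : [set w | N w = k] = [set w | (N w <= k)%N] `\` [set w | (N w < k)%N].
  apply/seteqP; split => w /=; first by move=> ->; rewrite leqnn ltnn.
  by move=> [le1 /negP]; rewrite -leqNgt => le2; apply/eqP; rewrite eqn_leq le1.
rewrite measureD//; last by rewrite ltey_eq fin_num_measure.
rewrite setIidr; last by move=> w /= /ltnW.
by apply: leeB_abseC; exact: fin_num_measure.
Qed.

(** Relocation preserves the mass, and an added point raises it by 1 whatever its centre;
    [cell point] only supplies an index. *)
Lemma TV_ge_mass m (G : 'I_m -> set T) (cell : T -> 'I_m) (t : 'I_m -> T)
    (A : set nat) : (forall i, G i = cell @^-1` [set i]) ->
  (`|P [set w | A (mass (V w)).+1] - P [set w | A (mass (V w))]|
    <= TV P V G t)%E.
Proof.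
move=> GE; pose B : set (config T) := [set xi | A (mass xi)].
have mB : measurable B.
  rewrite -[X in measurable X]setTI; exact: measurable_mass.
apply: le_trans (TV_ge_test t (cell point) GE mB).
have E1 : [set w | B (cfg_add (relocate (t \o cell) (V w))
    (msetn 1%N (t (cell point))))] = [set w | A (mass (V w)).+1].
  by apply/funext => w; rewrite /B /= mass_add mass_msetn mass_relocate addn1.
have E2 : [set w | B (relocate (t \o cell) (V w))] = [set w | A (mass (V w))].
  by apply/funext => w; rewrite /B /= mass_relocate.
by rewrite E1 E2.
Qed.

End partition_total_variation.

(** * Expectations *)

Section expected_value.
Context {R : realType} {d : measure_display} {W : measurableType d}.
Variable P : probability W R.
Implicit Types f g : W -> R.

Definition EV f : R := \int[P]_w f w.

Definition integ f : Prop := P.-integrable [set: W] (EFin \o f).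

Lemma EV_EFin f : integ f -> (EV f)%:E = (\int[P]_w (f w)%:E)%E.
Proof. by move=> If; rewrite /EV /Rintegral fineK// integrable_fin_num. Qed.

Lemma integ_cst (c : R) : integ (fun=> c).
Proof. exact: finite_measure_integrable_cst. Qed.

Lemma integ_measurable f : integ f -> measurable_fun [set: W] f.
Proof. by move=> /integrableP[/measurable_EFinP]. Qed.

Lemma integ_le f g : measurable_fun [set: W] f -> (forall w, `|f w| <= g w) ->
  integ g -> integ f.
Proof.
move=> mf fg Ig; apply: le_integrable Ig => //; first exact/measurable_EFinP.
by move=> w _ /=; rewrite lee_fin (le_trans (fg w))// ler_norm.
Qed.

Lemma integ_bounded f (c : R) : measurable_fun [set: W] f ->
  (forall w, `|f w| <= c) -> integ f.
Proof. by move=> mf fc; apply: (integ_le mf fc); exact: integ_cst. Qed.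

Lemma integD f g : integ f -> integ g -> integ (fun w => f w + g w).
Proof. by move=> If Ig; have := integrableD measurableT If Ig. Qed.

Lemma integZ (c : R) f : integ f -> integ (fun w => c * f w).
Proof. by move=> If; have := integrableZl measurableT c If. Qed.

Lemma integB f g : integ f -> integ g -> integ (fun w => f w - g w).
Proof. by move=> If Ig; have := integrableB measurableT If Ig. Qed.

Lemma integ_sum I (r : seq I) (F : I -> W -> R) :
  (forall i, integ (F i)) -> integ (fun w => \sum_(i <- r) F i w).
Proof.
move=> IF; elim: r => [|i r IHr].
  by under eq_fun do rewrite big_nil; exact: integ_cst.
by under eq_fun do rewrite big_cons; exact: integD.
Qed.

Lemma integ_norm f : integ f -> integ (fun w => `|f w|).
Proof. exact: integrable_norm. Qed.

Lemma EV_cst (c : R) : EV (fun=> c) = c.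
Proof.
rewrite /EV Rintegral_cst// [X in fine X](_ : _ = 1%E) ?mulr1//.
exact: probability_setT.
Qed.

Lemma EVD f g : integ f -> integ g -> EV (fun w => f w + g w) = EV f + EV g.
Proof. by move=> *; exact: RintegralD. Qed.

Lemma EVB f g : integ f -> integ g -> EV (fun w => f w - g w) = EV f - EV g.
Proof. by move=> *; exact: RintegralB. Qed.

Lemma EVZ (c : R) f : integ f -> EV (fun w => c * f w) = c * EV f.
Proof. by move=> *; exact: RintegralZl. Qed.

Lemma EV_sum I (r : seq I) (F : I -> W -> R) : (forall i, integ (F i)) ->
  EV (fun w => \sum_(i <- r) F i w) = \sum_(i <- r) EV (F i).
Proof.
move=> IF; elim: r => [|i r IHr].
  by under eq_fun do rewrite big_nil; rewrite EV_cst big_nil.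
under eq_fun do rewrite big_cons.
by rewrite EVD ?IHr ?big_cons//; exact: integ_sum.
Qed.

Lemma EV_le f g : integ f -> integ g -> (forall w, f w <= g w) -> EV f <= EV g.
Proof. by move=> If Ig fg; apply: le_Rintegral => // w _. Qed.

Lemma EV_ge0 f : (forall w, 0 <= f w) -> 0 <= EV f.
Proof. by move=> f0; apply: Rintegral_ge0. Qed.

Lemma EV_norm f : integ f -> `|EV f| <= EV (fun w => `|f w|).
Proof. by move=> If; exact: le_normr_Rintegral. Qed.

Lemma EV_eq f g : f =1 g -> EV f = EV g.
Proof. by move=> /funext ->. Qed.

Lemma EV_indic (A : set W) : measurable A ->
  integ (\1_A) /\ EV (\1_A) = fine (P A).
Proof.
move=> mA; split; last by rewrite /EV /Rintegral integral_indic ?setIT.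
by apply: (@integ_bounded _ 1) => // w; rewrite indicE ger0_norm// lern1 leq_b1.
Qed.

End expected_value.

Lemma EV_comp (R : realType) d d' (W : measurableType d) (S : measurableType d')
    (P : probability W R) (Q : probability S R) (X : {mfun W >-> S})
    (f : S -> R) :
  (forall A, measurable A -> P (X @^-1` A) = Q A) ->
  integ Q f -> integ P (f \o X) /\ EV P (f \o X) = EV Q f.
Proof.
move=> XQ If; have mf := integ_measurable If.
have QE A : measurable A -> A `<=` [set: S] -> Q A = pushforward P X A.
  by move=> mA _; rewrite -XQ.
have mfE : measurable_fun [set: S] (EFin \o f) by exact/measurable_EFinP.
have mX : measurable_fun [set: W] X by [].
have IX : P.-integrable (X @^-1` [set: S]) ((EFin \o f) \o X).
  rewrite preimage_setT; apply/integrableP; split.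
    exact: measurableT_comp.
  have /integrableP[_] := If; apply: le_lt_trans.
  rewrite (eq_measure_integral (pushforward P X))//.
  rewrite ge0_integral_pushforward ?preimage_setT//.
  exact: measurableT_comp.
split; first by move: IX; rewrite preimage_setT.
rewrite /EV /Rintegral; congr fine.
rewrite [RHS](eq_measure_integral (pushforward P X))//.
by rewrite (integral_pushforward mX mfE IX)// preimage_setT.
Qed.

(** By uniqueness of the product measure, the joint law of [X] and [Y] is the product of their laws;
    Fubini's theorem then factors the integral. *)
Lemma EV_indep (R : realType) d d1 d2 (W : measurableType d)
    (S1 : measurableType d1) (S2 : measurableType d2) (P : probability W R)
    (X : {mfun W >-> S1}) (Y : {mfun W >-> S2}) (f : S1 -> R) (g : S2 -> R) :
  (forall A B, measurable A -> measurable B ->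
     P (X @^-1` A `&` Y @^-1` B) = P (X @^-1` A) * P (Y @^-1` B))%E ->
  measurable_fun [set: S1] f -> measurable_fun [set: S2] g ->
  integ P (f \o X) -> integ P (g \o Y) ->
  EV P (fun w => f (X w) * g (Y w)) = EV P (f \o X) * EV P (g \o Y).
Proof.
move=> indep mf mg IX IY.
pose DX : probability S1 R := distribution P X.
pose DY : probability S2 R := distribution P Y.
have mXY : measurable_fun [set: W] (fun w => (X w, Y w)).
  exact: measurable_fun_pair.
pose m' := pushforward P (fun w => (X w, Y w)).
have m'E A : measurable A -> (DX \x DY)%E A = m' A.
  by apply: product_measure_unique => A1 A2 mA1 mA2; exact: indep.
pose F (z : S1 * S2) : \bar R := (f z.1 * g z.2)%:E.
have mF : measurable_fun [set: S1 * S2] F.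
  by apply/measurable_EFinP; apply: measurable_funM; apply: measurableT_comp.
have mfX : measurable_fun [set: W] (f \o X) by exact: measurableT_comp.
have IfX : integ DX f.
  apply/integrableP; split; first exact/measurable_EFinP.
  have /integrableP[_] := IX; apply: le_lt_trans.
  rewrite ge0_integral_pushforward ?preimage_setT//.
  by do 2 apply: measurableT_comp => //; exact/measurable_EFinP.
have IgY : integ DY g.
  apply/integrableP; split; first exact/measurable_EFinP.
  have /integrableP[_] := IY; apply: le_lt_trans.
  rewrite ge0_integral_pushforward ?preimage_setT//.
  by do 2 apply: measurableT_comp => //; exact/measurable_EFinP.
have [_ EX] : integ P (f \o X) /\ EV P (f \o X) = EV DX f by exact: EV_comp.
have [_ EY] : integ P (g \o Y) /\ EV P (g \o Y) = EV DY g by exact: EV_comp.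
rewrite EX EY.
have inner h x : integ DY h ->
    (\int[DY]_y (x * h y)%:E = (x * EV DY h)%:E)%E.
  by move=> Ih; rewrite -(EVZ _ Ih) EV_EFin//; exact: integZ.
have IF : (DX \x DY)%E.-integrable setT F.
  apply/(integrable12ltyP _ _ mF).
  have -> : (fun x => \int[DY]_y `|F (x, y)|)%E =
      (fun x => (EV DY (fun y => `|g y|) * `|f x|)%:E).
    apply/funext => x; rewrite mulrC -inner; last exact: integ_norm.
    by apply: eq_integral => y _; rewrite /F abse_EFin normrM.
  by rewrite -EV_EFin ?ltry//; apply: integZ; exact: integ_norm.
have E1 : (\int[DX \x DY]_z F z = (EV DX f * EV DY g)%:E)%E.
  rewrite -integral12_prod_meas1// /fubini_F.
  have -> : (fun x => \int[DY]_y F (x, y))%E = (fun x => (EV DY g * f x)%:E).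
    by apply/funext => x; rewrite mulrC -inner.
  rewrite -EV_EFin; last exact: integZ.
  by rewrite EVZ// mulrC.
have E2 : (\int[DX \x DY]_z F z = \int[m']_z F z)%E.
  by apply: eq_measure_integral => A mA _; exact: m'E.
have IFm : P.-integrable ((fun w => (X w, Y w)) @^-1` [set: S1 * S2])
    (F \o (fun w => (X w, Y w))).
  rewrite preimage_setT; apply/integrableP; split; first exact: measurableT_comp.
  move/integrableP : IF => [_]; apply: le_lt_trans.
  rewrite (eq_measure_integral m')//; last by move=> A mA _; exact: m'E.
  rewrite ge0_integral_pushforward ?preimage_setT//.
  exact: measurableT_comp.
have E3 := integral_pushforward mXY mF IFm measurableT.
rewrite {1}/EV /Rintegral.
rewrite [X in fine X](_ : _ = \int[m']_z F z)%E; last first.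
  by rewrite E3 preimage_setT.
by rewrite -E2 E1.
Qed.

(** The square expands into n diagonal terms and at most n^2 products of two means. The mean e is
    kept because block counts compared with their share under mu are not centred: their means are
    only O(1/n), summed over the blocks. *)
Lemma second_moment_sum (R : realType) d d' (W : measurableType d)
    (S : measurableType d') (P : probability W R) (n : nat)
    (X : nat -> {mfun W >-> S}) (y : S -> R) (v e : R) :
  measurable_fun [set: S] y ->
  (forall k l A B, (k < n)%N -> (l < n)%N -> k != l ->
     measurable A -> measurable B ->
     P (X k @^-1` A `&` X l @^-1` B) = P (X k @^-1` A) * P (X l @^-1` B))%E ->
  (forall k, (k < n)%N -> integ P (fun w => y (X k w) ^+ 2)) ->
  (forall k, (k < n)%N -> EV P (fun w => y (X k w) ^+ 2) <= v) ->
  (forall k, (k < n)%N -> EV P (fun w => y (X k w)) = e) ->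
  integ P (fun w => (\sum_(k < n) y (X k w)) ^+ 2) /\
  EV P (fun w => (\sum_(k < n) y (X k w)) ^+ 2) <= n%:R * v + (n%:R * e) ^+ 2.
Proof.
move=> my ind Iy Ev Ee.
have mY k : measurable_fun [set: W] (fun w => y (X k w)).
  exact: measurableT_comp.
have I1 (k : 'I_n) : integ P (fun w => y (X k w)).
  apply: (integ_le (g := fun w => 1 + y (X k w) ^+ 2)) => //.
    move=> w; have := sqr_ge0 (`|y (X k w)| - 1).
    rewrite -(real_normK (num_real (y (X k w)))); move: `|_| => z; nra.
  by apply: integD; [exact: integ_cst|exact: Iy].
have I2 (k l : 'I_n) : integ P (fun w => y (X k w) * y (X l w)).
  apply: (integ_le (g := fun w => y (X k w) ^+ 2 + y (X l w) ^+ 2)).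
  - exact: measurable_funM.
  - move=> w; rewrite normrM -(real_normK (num_real (y (X k w)))).
    rewrite -(real_normK (num_real (y (X l w)))).
    have := normr_ge0 (y (X k w)); have := normr_ge0 (y (X l w)).
    move: `|y (X k w)| `|y (X l w)| => z t; have := sqr_ge0 (z - t); nra.
  - by apply: integD; exact: Iy.
have -> : (fun w => (\sum_(k < n) y (X k w)) ^+ 2) =
    (fun w => \sum_(k < n) \sum_(l < n) y (X k w) * y (X l w)).
  by apply/funext => w; rewrite expr2 big_distrlr.
split; first by apply: integ_sum => k; apply: integ_sum => l.
rewrite EV_sum; last by move=> k; exact: integ_sum.
apply: (@le_trans _ _ (\sum_(k < n) (v + n%:R * e ^+ 2))); last first.
  rewrite sumr_const card_ord -[leLHS]mulr_natl le_eqVlt; apply/orP; left.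
  by apply/eqP; ring.
apply: ler_sum => k _; rewrite EV_sum// (bigD1 k)//=; apply: lerD.
  by apply: le_trans (Ev k (ltn_ord k)).
rewrite (eq_bigr (fun=> e ^+ 2)) => [|l lk]; last first.
  have ikl A B : measurable A -> measurable B ->
      P (X k @^-1` A `&` X l @^-1` B) = (P (X k @^-1` A) * P (X l @^-1` B))%E.
    by move=> mA mB; apply: ind => //; rewrite eq_sym.
  have -> := EV_indep ikl my my (I1 k) (I1 l).
  have -> : EV P (y \o X k) = e by exact: Ee.
  by have -> : EV P (y \o X l) = e by exact: Ee.
rewrite sumr_const -[leLHS]mulr_natl ler_wpM2r ?sqr_ge0// ler_nat.
by rewrite -[leqRHS](card_ord n); exact: max_card.
Qed.

Lemma EV_fibers_cvg (R : realType) d (W : measurableType d)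
    (P : probability W R) (N : W -> nat) (f : W -> R) :
  measurable_fun [set: W] N -> (forall w, 0 <= f w) -> integ P f ->
  series (fun j => EV P (fun w => f w * (N w == j)%:R)) @ \oo --> EV P f.
Proof.
move=> mN f0 If; have mf := integ_measurable If.
pose F j := N @^-1` [set j].
have mF j : measurable (F j) by rewrite -[F j]setTI; exact: mN.
have UF : \bigcup_j F j = [set: W] by apply/seteqP; split => // w _; exists (N w).
have tF : trivIset setT F by move=> i j _ _ [w [/= <- <-]].
have IfN j : integ P (fun w => f w * (N w == j)%:R).
  apply: (integ_le (g := f)) => // [|w]; last first.
    rewrite normrM (ger0_norm (f0 w)) ger0_norm// ler_piMr// lern1; exact: leq_b1.
  apply: measurable_funM => //.
  rewrite (_ : (fun w => _) = \1_(F j)); first exact: measurable_indic.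
  apply/funext => w; rewrite indicE; congr (_%:R); congr nat_of_bool.
  by apply/idP/idP; rewrite inE /F /= => /eqP.
have FE j : (\int[P]_(w in F j) (f w)%:E = (EV P (fun w => f w * (N w == j)%:R))%:E)%E.
  rewrite EV_EFin// integral_mkcond; apply: eq_integral => w _.
  rewrite patchE; case: ifPn => [|/negP].
    by rewrite inE => /= ->; rewrite eqxx mulr1.
  by rewrite inE /F /= => /eqP/negbTE ->; rewrite mulr0.
have := @ge0_integral_bigcup _ _ _ P F (EFin \o f) mF.
rewrite UF => /(_ _ _ tF) H.
have {}H : (\int[P]_x (f x)%:E = \sum_(i <oo) (EV P (fun w => f w * (N w == i)%:R))%:E)%E.
  rewrite H//; first by apply: eq_eseriesr => i _; exact: FE.
  - exact/measurable_EFinP.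
  - by move=> x _; rewrite lee_fin.
rewrite -EV_EFin// in H.
have c : (\sum_(0 <= i < K) (EV P (fun w => f w * (N w == i)%:R))%:E)%E @[K --> \oo]
    --> (EV P f)%:E.
  rewrite H; apply: is_cvg_nneseries => i _ _; rewrite lee_fin.
  by apply: EV_ge0 => w; rewrite mulr_ge0.
have E : series (fun j => EV P (fun w => f w * (N w == j)%:R)) =
  fine \o (fun K => \sum_(0 <= i < K) (EV P (fun w => f w * (N w == i)%:R))%:E)%E.
  by apply/funext => K /=; rewrite sumEFin.
by rewrite E; exact: fine_cvg c.
Qed.

Lemma EV_nat_cvg (R : realType) d (W : measurableType d)
    (P : probability W R) (N : W -> nat) (h : nat -> R) :
  measurable_fun [set: W] N -> (forall j, 0 <= h j) -> integ P (h \o N) ->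
  series (fun j => fine (P (N @^-1` [set j])) * h j) @ \oo --> EV P (h \o N).
Proof.
move=> mN h0 Ih.
have mF j : measurable (N @^-1` [set j]).
  by rewrite -[X in measurable X]setTI; exact: mN.
rewrite (_ : (fun j => fine _ * _) =
    (fun j => EV P (fun w => (h \o N) w * (N w == j)%:R))).
  by apply: EV_fibers_cvg => // w; exact: h0.
apply/funext => j; have [I1 <-] := EV_indic P (mF j).
rewrite mulrC -EVZ//; apply: EV_eq => w /=; rewrite indicE.
have [Nj|Nj] := eqVneq (N w) j; first by rewrite mem_set// Nj.
by rewrite memNset ?mulr0// => /= E; rewrite E eqxx in Nj.
Qed.

Lemma measurable_nat_pred d (W : measurableType d) (N : W -> nat) (A : pred nat) :
  measurable_fun [set: W] N -> measurable [set w | A (N w)].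
Proof.
by move=> mN; rewrite -[X in measurable X]setTI; exact: (mN measurableT [set j | A j]).
Qed.

Lemma EV_bool (R : realType) d (W : measurableType d) (P : probability W R)
    (c : pred W) : measurable [set w | c w] ->
  integ P (fun w => (c w)%:R) /\ EV P (fun w => (c w)%:R) = fine (P [set w | c w]).
Proof.
move=> mc; have := EV_indic P mc.
rewrite (_ : \1_[set w | c w] = (fun w => (c w)%:R))//; apply/funext => w.
by rewrite indicE; congr (nat_of_bool _)%:R; apply/idP/idP; rewrite inE.
Qed.

(** * The law of a sum of independent masses *)

Section sum_law.
Context {R : realType} {d : measure_display} {W : measurableType d}.

Lemma sum_law_conv_power (P : probability W R) n (N : nat -> W -> nat) (p : nat -> R) :
  (forall k, measurable_fun [set: W] (N k)) ->
  (forall k i, (k < n)%N -> fine (P (N k @^-1` [set i])) = p i) ->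
  (forall A : nat -> set nat,
     fine (P (\bigcap_(k in [set: 'I_n]) (N k @^-1` A k))) =
     \prod_(k < n) fine (P (N k @^-1` A k))) ->
  forall m j, (m <= n)%N ->
    fine (P [set w | (\sum_(k < m) N k w)%N = j]) = conv_power p m j.
Proof.
move=> mN Np Nind m j mn.
pose F m (A : nat -> pred nat) w := [forall k : 'I_n, (m <= k)%N ==> A k (N k w)].
pose S m w := (\sum_(k < m) N k w)%N.
have mS k : measurable_fun [set: W] (S k).
  elim: k => [|k IHk].
    by rewrite (_ : S 0%N = fun=> 0%N)//; apply/funext => w; rewrite /S big_ord0.
  rewrite (_ : S k.+1 = fun w => (S k w + N k w)%N).
    exact: measurable_fun_addn.
  by apply/funext => w; rewrite /S big_ord_recr.
have mF k A : measurable [set w | F k A w].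
  rewrite (_ : [set w | F k A w] = \bigcap_(l in [set: 'I_n])
      [set w | (k <= l)%N ==> A l (N l w)]).
    apply: fin_bigcap_measurable => // l _.
    by apply: (measurable_nat_pred (fun x => (k <= l)%N ==> A l x)).
  apply/seteqP; split=> [w /= /forallP H l _|w H]; first exact: H.
  by apply/forallP => l; exact: (H l).
(* The induction has to keep the later summands in view: the event also restricts every [N l] with l
   >= k. Splitting according to the value of [N k] then adds one restriction, encoded in [A']. *)
have claim k A i : (k <= n)%N ->
    EV P (fun w => ((S k w == i) && F k A w)%:R) =
    conv_power p k i * \prod_(l < n | (k <= l)%N) fine (P [set w | A l (N l w)]).
  elim: k A i => [|k IHk] A i kn.
    rewrite conv_power0 -(Nind (fun l => [set x | A l x])).
    have [_ EF] := EV_bool P (mF 0%N A).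
    rewrite (_ : \bigcap_(l in _) _ = [set w | F 0%N A w]); last first.
      apply/seteqP; split=> [w H|w /= /forallP H l _]; last exact: (H l).
      by apply/forallP => l; exact: (H l).
    rewrite -EF -EVZ; last by have [] := EV_bool P (mF 0%N A).
    apply: EV_eq => w; rewrite /S big_ord0 eq_sym.
    by case: (i == 0%N); rewrite ?mul1r ?mul0r.
  pose A' (l x : nat) : pred nat := if x == k then (fun z => z == l) else A x.
  have FA l w : F k (A' l) w = F k.+1 A w && (N k w == l).
    apply/forallP/andP => [H|[/forallP H Nl] x].
      split; last by have := H (Ordinal kn); rewrite leqnn /= /A' eqxx.
      apply/forallP => x; apply/implyP => kx; have := H x.
      by rewrite (ltnW kx)/= /A' gtn_eqF.
    rewrite /A'; have [->|xk] := eqVneq (x : nat) k; first by rewrite leqnn.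
    by have := H x; rewrite [(k < x)%N]ltn_neqAle eq_sym xk.
  have -> : (fun w => ((S k.+1 w == i) && F k.+1 A w)%:R) =
      (fun w => \sum_(l < i.+1) ((S k w == i - l)%N && F k (A' l) w)%:R) :> (W -> R).
    apply/funext => w; rewrite /S big_ord_recr/= -/(S k w).
    under eq_bigr do rewrite FA.
    have [Ni|iN] := leqP (N k w) i.
      rewrite (bigD1 (Ordinal (Ni : (N k w < i.+1)%N)))//= eqxx andbT.
      rewrite big1 ?addr0 => [|l /negbTE lN]; last first.
        by rewrite [N k w == l]eq_sym (_ : (l : nat) == N k w = false) ?andbF.
      by rewrite -{1}(subnK Ni) eqn_add2r.
    rewrite big1 => [|l _]; last first.
      by rewrite [N k w == l]gtn_eqF ?andbF// (leq_trans (ltn_ord l)).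
    by rewrite [_ == i]gtn_eqF// (leq_trans iN)// leq_addl.
  rewrite EV_sum => [|l]; last first.
    have mm : measurable [set w | (S k w == i - l)%N && F k (A' l) w].
      rewrite (_ : [set w | _] = [set w | pred1 (i - l)%N (S k w)] `&`
        [set w | F k (A' l) w]); last by apply/seteqP; split => w /= /andP.
      by apply: measurableI => //; exact: measurable_nat_pred.
    by have [] := EV_bool P mm.
  rewrite conv_powerS mulr_suml; apply: eq_bigr => l _.
  rewrite IHk ?(ltnW kn)// (bigD1 (Ordinal kn))//= {1}/A' eqxx/=.
  rewrite (_ : [set w | N k w == l] = N k @^-1` [set (l : nat)]); last first.
    by apply/seteqP; split => w /= /eqP.
  rewrite Np// mulrA (mulrC (conv_power _ _ _)); congr (_ * _).
  rewrite (eq_bigl (fun x : 'I_n => (k < x)%N)) => [|x]; last first.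
    by rewrite ltn_neqAle andbC eq_sym.
  by apply: eq_bigr => x kx; rewrite /A' gtn_eqF.
have := claim m (fun _ => predT) j mn.
rewrite big1 ?mulr1 => [<-|l _]; last first.
  by rewrite (_ : [set w | _] = [set: W]) ?probability_setT//; apply/seteqP; split.
have mj : measurable [set w | pred1 j (S m w)] by exact: measurable_nat_pred.
have [_] := EV_bool P mj.
rewrite (_ : [set w | pred1 j (S m w)] = [set w | S m w = j]); last first.
  by apply/seteqP; split => w /= /eqP.
move=> <-; apply: EV_eq => w /=; congr (nat_of_bool _)%:R.
by rewrite (_ : F m _ w) ?andbT//; apply/forallP => l; rewrite implybT.
Qed.

End sum_law.

(** * Sums of a random number of independent points *)

Section mixed_sum.
Context {R : realType} {T : pointedMetricType R}.
Context {d : measure_display} {W : measurableType d}.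
Implicit Types (U : nat -> {mfun W >-> borel T}) (Z : {mfun W >-> nat}).

Definition point_sum U (k : nat) (w : W) : config T :=
  seq_mset [seq (U j w : T) | j <- iota 0 k].

Definition mixed_sum Z U (w : W) : config T := point_sum U (Z w) w.

Lemma cfg_count_point_sum U k (B : set T) w :
  cfg_count B (point_sum U k w) = (\sum_(j < k) ((U j w : T) \in B))%N.
Proof.
rewrite cfg_count_seq_mset count_map -sum1_count big_mkcond/=.
rewrite -[k in iota 0 k]subn0 -/(index_iota 0 k) big_mkord.
by apply: eq_bigr => j _; case: (_ \in _).
Qed.

Lemma mass_point_sum U k w : mass (point_sum U k w) = k.
Proof. by rewrite mass_seq_mset size_map size_iota. Qed.

Lemma measurable_cfg_count_point_sum U k (B : set T) :
  measurable (B : set (borel T)) ->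
  measurable_fun [set: W] (fun w => cfg_count B (point_sum U k w)).
Proof.
move=> mB; rewrite (_ : (fun _ => _) =
    (fun w => \sum_(j < k) ((U j w : T) \in B))%N); last first.
  by apply/funext => w; exact: cfg_count_point_sum.
elim: k => [|k IHk].
  by rewrite (_ : (fun _ => _) = fun=> 0%N)//; apply/funext => w; rewrite big_ord0.
rewrite (_ : (fun _ => _) =
    (fun w => (\sum_(j < k) ((U j w : T) \in B) + ((U k w : T) \in B))%N)).
  apply: measurable_fun_addn => //; apply: measurable_fun_fiber_nat => i.
  rewrite (_ : _ @^-1` _ = U k @^-1` [set x | nat_of_bool (x \in B) = i]); last by [].
  have mi : measurable ([set x | nat_of_bool (x \in B) = i] : set (borel T)).
    case: i => [|[|i]].
    - rewrite (_ : [set x | _] = ~` B); first exact: measurableC.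
      apply/seteqP; split=> x /=; first by move=> + xB; rewrite mem_set.
      by move=> xB; rewrite memNset.
    - rewrite (_ : [set x | _] = B)//.
      apply/seteqP; split=> x /=; first by case: (boolP (x \in B)) => // /set_mem.
      by move=> xB; rewrite mem_set.
    - rewrite (_ : [set x | _] = set0)//; apply/seteqP; split=> x //=.
      by case: (_ \in _).
  by rewrite -[X in measurable X]setTI; exact: (measurable_funP (U k)).
by apply/funext => w; rewrite big_ord_recr.
Qed.

Lemma measurable_mixed_sum Z U : measurable_fun [set: W] (mixed_sum Z U).
Proof.
apply: measurable_config => B mB; apply: measurable_fun_fiber_nat => i.
rewrite (_ : _ @^-1` _ = \bigcup_k (Z @^-1` [set k] `&`
    (fun w => cfg_count B (point_sum U k w)) @^-1` [set i])); last first.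
  by apply/seteqP; split=> [w /= wi|w [k _ [/= <-]]]//; exists (Z w).
apply: bigcupT_measurable => k; apply: measurableI.
  by rewrite -[X in measurable X]setTI; exact: (measurable_funP Z).
rewrite -[X in measurable X]setTI.
exact: (measurable_cfg_count_point_sum U k mB).
Qed.

HB.instance Definition _ Z U :=
  isMeasurableFun.Build _ _ _ _ (mixed_sum Z U) (measurable_mixed_sum Z U).

(** For a fixed number k of points the relocated sample is a function of this finite code, so means
    of f reduce to finitely many product probabilities. *)
Definition cell_code m (cell : T -> 'I_m) U k (w : W) : {ffun 'I_k -> 'I_m} :=
  [ffun j : 'I_k => cell (U j w)].

Lemma measurable_cell_code m (cell : T -> 'I_m) U k c : measurable_cells cell ->
  measurable (cell_code cell U k @^-1` [set c]) /\
  cell_code cell U k @^-1` [set c] =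
  \bigcap_(j in [set: 'I_k]) (U j @^-1` (cell @^-1` [set c j])).
Proof.
move=> mcell.
have E : cell_code cell U k @^-1` [set c] =
  \bigcap_(j in [set: 'I_k]) (U j @^-1` (cell @^-1` [set c j])).
  apply/seteqP; split=> [w /= <- j _|w H] /=; first by rewrite ffunE.
  by apply/ffunP => j; rewrite ffunE; exact: (H j).
split => //; rewrite E; apply: fin_bigcap_measurable => // j _.
by rewrite -[X in measurable X]setTI; exact: (measurable_funP (U j)).
Qed.

Lemma relocate_point_sum m (cell : T -> 'I_m) (t : 'I_m -> T) U k w :
  relocate (t \o cell) (point_sum U k w) =
  seq_mset [seq t (cell_code cell U k w j) | j <- enum 'I_k].
Proof.
rewrite /relocate; apply/eq_seq_msetP.
apply: (@perm_trans _ [seq (t \o cell) x | x <- [seq (U j w : T) | j <- iota 0 k]]).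
  by apply: perm_map; exact: perm_eq_seq_mset.
rewrite -val_enum_ord -!map_comp.
by rewrite (eq_map (g := fun j : 'I_k => t (cell_code cell U k w j)))// => j /=; rewrite ffunE.
Qed.

Lemma measurable_relocate_point_sum d' (Y : measurableType d')
    (f : config T -> Y) m (cell : T -> 'I_m) (t : 'I_m -> T) U k :
  measurable_cells cell ->
  measurable_fun [set: W] (fun w => f (relocate (t \o cell) (point_sum U k w))).
Proof.
move=> mcell; apply: (@measurable_fun_countable_factor _ _ _ _ _
  (cell_code cell U k)) => [c|w w' E].
  by have [] := measurable_cell_code U c mcell.
by rewrite !relocate_point_sum E.
Qed.

Variables (P : probability W R) (Z : {mfun W >-> nat}).
Variable U : nat -> {mfun W >-> borel T}.
Hypothesis indep : forall (A : set nat) (m : nat) (B : 'I_m -> set (borel T)),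
  (forall j, measurable (B j)) ->
  P (Z @^-1` A `&` \bigcap_(j in [set: 'I_m]) (U j @^-1` B j)) =
  (P (Z @^-1` A) * \prod_(j < m) P (U j @^-1` B j))%E.

(** On the event Z = k, f is a finite combination of indicators of codes. Each code is an
    intersection of one event for each of the first k points, to which [indep] applies jointly with
    Z = k and, with no condition on Z, for the right-hand side. *)
Lemma EV_mixed_sum_fiber m (cell : T -> 'I_m) (t : 'I_m -> T)
    (f : config T -> R) k : measurable_cells cell ->
  EV P (fun w => f (relocate (t \o cell) (mixed_sum Z U w)) * (Z w == k)%:R) =
  fine (P (Z @^-1` [set k]))
    * EV P (fun w => f (relocate (t \o cell) (point_sum U k w))).
Proof.
move=> mcell.
pose g (c : {ffun 'I_k -> 'I_m}) : R :=
  f (seq_mset [seq t (c j) | j <- enum 'I_k]).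
pose E c := cell_code cell U k @^-1` [set c].
have mE c : measurable (E c) by have [] := measurable_cell_code U c mcell.
have mZ : measurable (Z @^-1` [set k]).
  by rewrite -[X in measurable X]setTI; exact: (measurable_funP Z).
have fE w : f (relocate (t \o cell) (point_sum U k w)) =
    \sum_c g c * \1_(E c) w.
  rewrite relocate_point_sum (bigD1 (cell_code cell U k w))//=.
  rewrite indicE mem_set// mulr1 big1 ?addr0// => c /eqP cw.
  by rewrite indicE memNset ?mulr0// => /= /esym.
rewrite (@EV_eq _ _ _ P _ (fun w => \sum_c g c * \1_(Z @^-1` [set k] `&` E c) w)); last first.
  move=> w /=; under eq_bigr do rewrite indicI /= mulrCA; rewrite -big_distrr/= -fE mulrC.
  rewrite indicE; have [Zk|Zk] := eqVneq (Z w) k.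
    by rewrite mem_set// /mixed_sum Zk.
  by rewrite !mul0r memNset ?mul0r// => /= Zk'; rewrite Zk' eqxx in Zk.
rewrite [in RHS](@EV_eq _ _ _ P _ (fun w => \sum_c g c * \1_(E c) w))//.
have I1 c : integ P (\1_(E c)) by have [] := EV_indic P (mE c).
have mZE c : measurable (Z @^-1` [set k] `&` E c) by exact: measurableI.
have I2 c : integ P (\1_(Z @^-1` [set k] `&` E c)) by have [] := EV_indic P (mZE c).
rewrite !EV_sum; [|by move=> c; exact: integZ|by move=> c; exact: integZ].
rewrite mulr_sumr; apply: eq_bigr => c _; rewrite !EVZ// mulrCA; congr (_ * _).
have [_ ->] := EV_indic P (mZE c); have [_ ->] := EV_indic P (mE c).
rewrite /E; have [_ ->] := measurable_cell_code U c mcell.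
rewrite indep => [|j]; last exact: mcell.
have := @indep setT k (fun j => cell @^-1` [set c j]) (fun j => mcell (c j)).
rewrite preimage_setT setTI probability_setT mul1e => ->.
rewrite fineM ?fin_num_measure//.
by apply: prode_fin_num => j _; rewrite fin_num_measure// -[X in measurable X]setTI; exact: (measurable_funP (U j)).
Qed.

End mixed_sum.

(** The product formula is used with the whole space at all indices other than k and l. *)
Lemma indep_family_pair (R : realType) d d' (W : measurableType d)
    (S : measurableType d') (P : probability W R) n (X : nat -> {mfun W >-> S}) :
  (forall A : 'I_n -> set S, (forall k, measurable (A k)) ->
     P (\bigcap_(k in [set: 'I_n]) (X k @^-1` A k)) =
     \prod_(k < n) P (X k @^-1` A k))%E ->
  forall k l A B, (k < n)%N -> (l < n)%N -> k != l ->
     measurable A -> measurable B ->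
     P (X k @^-1` A `&` X l @^-1` B) = (P (X k @^-1` A) * P (X l @^-1` B))%E.
Proof.
move=> ind k l A B kn ln kl mA mB.
pose C (j : 'I_n) := if (j : nat) == k then A else if (j : nat) == l then B else setT.
have mC j : measurable (C j) by rewrite /C; case: ifP => // _; case: ifP.
have := ind C mC.
have -> : \bigcap_(j in [set: 'I_n]) (X j @^-1` C j) = X k @^-1` A `&` X l @^-1` B.
  apply/seteqP; split=> [w H|w [/= Aw Bw] j _] /=.
    split; first by have := H (Ordinal kn) Logic.I; rewrite /C/= eqxx.
    have := H (Ordinal ln) Logic.I.
    by rewrite /C/= [l == k]eq_sym (negbTE kl) eqxx.
  by rewrite /C; case: eqP => [->//|_]; case: eqP => [->|].
move=> ->; rewrite (bigD1 (Ordinal kn))//= (bigD1 (Ordinal ln))/=; last first.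
  by rewrite -val_eqE/= eq_sym.
rewrite big1 ?mule1; last first.
  move=> j /andP[jk jl]; rewrite /C -!val_eqE/= in jk jl *.
  by rewrite (negbTE jk) (negbTE jl) preimage_setT probability_setT.
by rewrite /C/= !eqxx [l == k]eq_sym (negbTE kl).
Qed.

(** * Relocated configurations against independent samples of equal size *)

Section relocated_gap.
Context {R : realType} {T : pointedMetricType R}.
Implicit Types (xi : config T).

Definition centers m (t : 'I_m -> T) : seq T := undup [seq t i | i <- enum 'I_m].

(** Several cells may share a centre. A relocated configuration only distinguishes the unions of
    such cells, so blocks are indexed by distinct centres instead of cells. *)
Definition block m (cell : T -> 'I_m) (t : 'I_m -> T) (y : T) : set T :=
  (t \o cell) @^-1` [set y].

Lemma measurable_block m (cell : T -> 'I_m) (t : 'I_m -> T) y :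
  measurable_cells cell -> measurable (block cell t y : set (borel T)).
Proof.
move=> mcell; rewrite (_ : block cell t y =
    \bigcup_(j in [set j | t j = y]) cell @^-1` [set j]).
  by apply: fin_bigcup_measurable => //; exact: finite_finset.
by apply/seteqP; split=> [x /= xi|x [j /= <- <-]//]; exists (cell x).
Qed.

Lemma sum_blocks m (cell : T -> 'I_m) (t : 'I_m -> T) x :
  (\sum_(y <- centers t) (x \in block cell t y))%N = 1%N.
Proof.
rewrite (bigD1_seq (t (cell x)))//= ?undup_uniq//; last first.
  by rewrite mem_undup; apply: map_f; rewrite mem_enum.
rewrite mem_set// big1// => y /eqP yx; rewrite memNset//= => /esym.
exact: yx.
Qed.

Lemma sum_cfg_count_blocks m (cell : T -> 'I_m) (t : 'I_m -> T) xi :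
  (\sum_(y <- centers t) cfg_count (block cell t y) xi)%N = mass xi.
Proof.
rewrite -(mass_relocate (t \o cell) xi) /mass.
rewrite (@sum_count_mem _ _ (centers t)) ?undup_uniq//.
  apply: eq_bigr => y _; rewrite -cfg_count_relocate /cfg_count.
  by apply: eq_count => x /=; apply/idP/eqP; rewrite inE.
move=> y; rewrite /relocate /cfg_points (perm_mem (perm_eq_seq_mset _)).
move=> /mapP[x _ ->]; rewrite mem_undup.
by apply/mapP; exists (cell x) => //; rewrite mem_enum.
Qed.

(** The count is binomial with parameters k and mu, of variance k mu (1 - mu). *)
Lemma block_variance_sum (d : measure_display) (W : measurableType d)
    (P : probability W R) (U : nat -> {mfun W >-> borel T}) (B : set (borel T))
    (mu : R) k : measurable B ->
  (forall j, P (U j @^-1` B) = mu%:E) ->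
  (forall A : 'I_k -> set (borel T), (forall j, measurable (A j)) ->
     P (\bigcap_(j in [set: 'I_k]) (U j @^-1` A j)) =
     \prod_(j < k) P (U j @^-1` A j))%E ->
  integ P (fun w => ((cfg_count B (point_sum U k w))%:R - k%:R * mu) ^+ 2) /\
  EV P (fun w => ((cfg_count B (point_sum U k w))%:R - k%:R * mu) ^+ 2)
    <= k%:R * mu.
Proof.
move=> mB PB ind.
pose y (x : borel T) : R := \1_B x - mu.
have mu01 : 0 <= mu <= 1.
  by rewrite -!lee_fin -(PB 0%N) measure_ge0 probability_le1// -[X in measurable X]setTI; exact: (measurable_funP (U 0%N)).
have E : (fun w => ((cfg_count B (point_sum U k w))%:R - k%:R * mu) ^+ 2) =
    (fun w => (\sum_(j < k) y (U j w)) ^+ 2).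
  apply/funext => w; rewrite cfg_count_point_sum natr_sum /y sumrB sumr_const.
  rewrite card_ord mulr_natl; congr ((_ - _) ^+ 2).
have mU j : measurable (U j @^-1` B).
  by rewrite -[X in measurable X]setTI; exact: (measurable_funP (U j)).
have my : measurable_fun [set: borel T] y by apply: measurable_funB.
have myU j : measurable_fun [set: W] (fun w => y (U j w)).
  exact: measurableT_comp.
have Iind j : integ P (\1_(U j @^-1` B)) by have [] := EV_indic P (mU j).
have Eind j : EV P (\1_(U j @^-1` B)) = mu.
  by have [_ ->] := EV_indic P (mU j); rewrite PB.
have yE j w : y (U j w) = \1_(U j @^-1` B) w - mu.
  by rewrite /y !indicE.
have E1 j : EV P (fun w => y (U j w)) = 0.
  under eq_fun do rewrite yE.
  rewrite (EVB (Iind j) (integ_cst P mu)) EV_cst Eind; exact: subrr.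
have y2E j w : y (U j w) ^+ 2 = (1 - 2 * mu) * \1_(U j @^-1` B) w + mu ^+ 2.
  by rewrite yE indicE; case: (_ \in _); rewrite /= ?mulr1n ?mulr0n; ring.
have I2 j : integ P (fun w => y (U j w) ^+ 2).
  under eq_fun do rewrite y2E.
  by apply: integD; [exact: integZ|exact: integ_cst].
have E2 j : EV P (fun w => y (U j w) ^+ 2) <= mu.
  under eq_fun do rewrite y2E.
  rewrite EVD; [|exact: integZ|exact: integ_cst].
  by rewrite EVZ// Eind EV_cst; case/andP: mu01; nra.
rewrite E.
have [I3] := @second_moment_sum _ _ _ _ _ P k U y mu 0 my
  (indep_family_pair ind) (fun j _ => I2 j) (fun j _ => E2 j) (fun j _ => E1 j).
by rewrite mulr0 expr0n addr0.
Qed.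

Lemma sum_block_probability (d : measure_display) (W : measurableType d)
    (P : probability W R) (U : {mfun W >-> borel T})
    m (cell : T -> 'I_m) (t : 'I_m -> T) (mu : T -> R) :
  measurable_cells cell ->
  (forall y, P (U @^-1` block cell t y) = (mu y)%:E) ->
  \sum_(y <- centers t) mu y = 1.
Proof.
move=> mcell PU; rewrite -[RHS](EV_cst P 1).
rewrite (@EV_eq _ _ _ P (fun=> 1)
  (fun w => \sum_(y <- centers t) \1_(U @^-1` block cell t y) w)).
  have mUb y : measurable (U @^-1` block cell t y).
    rewrite -[X in measurable X]setTI; apply: (measurable_funP U) => //.
    exact: measurable_block.
  rewrite EV_sum; last by move=> y; have [] := EV_indic P (mUb y).
  by apply: eq_bigr => y _; have [_ ->] := EV_indic P (mUb y); rewrite PU.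
move=> w; rewrite -[LHS](_ : 1%N%:R = 1)// -(sum_blocks cell t (U w)).
by rewrite natr_sum; apply: eq_bigr => y _; rewrite indicE.
Qed.

(* Couple the relocated points with an independent sample of the same size. *)
Lemma relocated_gap_le (d : measure_display) (W : measurableType d)
    (P : probability W R) (U : nat -> {mfun W >-> borel T})
    m (cell : T -> 'I_m) (t : 'I_m -> T) (f : config T -> R)
    (mu : T -> R) (s : R) xi :
  (forall x y : T, mdist x y <= 1) -> measurable_cells cell ->
  (forall j y, P (U j @^-1` block cell t y) = (mu y)%:E) ->
  (forall k (A : 'I_k -> set (borel T)), (forall j, measurable (A j)) ->
     P (\bigcap_(j in [set: 'I_k]) (U j @^-1` A j)) =
     \prod_(j < k) P (U j @^-1` A j))%E ->
  (forall xi eta, `|f xi - f eta| <= d1 xi eta) -> (forall xi, `|f xi| <= 2) ->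
  0 < s -> (0 < mass xi)%N ->
  `|f (relocate (t \o cell) xi)
    - EV P (fun w => f (relocate (t \o cell) (point_sum U (mass xi) w)))| <=
  (mass xi)%:R^-1 * ((size (centers t))%:R * s + (mass xi)%:R / s / 2
    + (\sum_(y <- centers t)
        ((cfg_count (block cell t y) xi)%:R - (mass xi)%:R * mu y) ^+ 2) / s / 2).
Proof.
move=> d0_le1 mcell PU ind fL f2 s0 M0.
set M := mass xi; set r := t \o cell.
have mf := measurable_relocate_point_sum f t U M mcell.
have If : integ P (fun w => f (relocate r (point_sum U M w))).
  apply: (@integ_bounded _ _ _ _ _ 2) => //; exact: mf.
pose c y (w : W) : R :=
  ((cfg_count (block cell t y) (point_sum U M w))%:R - M%:R * mu y) ^+ 2.
pose e y : R := ((cfg_count (block cell t y) xi)%:R - M%:R * mu y) ^+ 2.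
have cP y : integ P (c y) /\ EV P (c y) <= M%:R * mu y.
  exact: (block_variance_sum (measurable_block t y mcell)
      (fun j => PU j y) (@ind M)).
pose g y (w : W) : R := s + (2 * s)^-1 * (c y w) + (2 * s)^-1 * e y.
have Ig y : integ P (g y).
  apply: integD; last exact: integ_cst.
  by apply: integD; [exact: integ_cst|apply: integZ; case: (cP y)].
(* This plays the role of the Cauchy-Schwarz inequality, with a free weight s that will be set to
   1/r. It trades absolute deviations for squares, whose means are additive over independent
   terms. *)
have amgm (x : R) : `|x| <= s / 2 + (2 * s)^-1 * x ^+ 2.
  rewrite -(real_normK (num_real x)); move: `|x| => z.
  have -> : s / 2 + (2 * s)^-1 * z ^+ 2 = z + (2 * s)^-1 * (z - s) ^+ 2.
    by field; rewrite gt_eqF.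
  by rewrite lerDl mulr_ge0 ?sqr_ge0// invr_ge0 mulr_ge0// ltW.
have bnd w : `|f (relocate r xi) - f (relocate r (point_sum U M w))| <=
    M%:R^-1 * \sum_(y <- centers t) g y w.
  apply: le_trans (fL _ _) _.
  apply: le_trans (d1_mismatch (ys := centers t) d0_le1 _ _ _) _.
  - by rewrite !mass_relocate mass_point_sum.
  - exact: undup_uniq.
  - move=> y; rewrite /cfg_points (perm_mem (perm_eq_seq_mset _)).
    move=> /mapP[x _ ->]; rewrite mem_undup.
    by apply/mapP; exists (cell x) => //; rewrite mem_enum.
  rewrite mass_relocate ler_wpM2l//; apply: ler_sum => y _.
  rewrite !cfg_count_relocate -/(block cell t y).
  set u := (cfg_count _ xi)%:R; set v := (cfg_count _ _)%:R.
  have -> : u - v = (u - M%:R * mu y) - (v - M%:R * mu y) by ring.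
  apply: le_trans (ler_normB _ _) _; have := amgm (u - M%:R * mu y).
  have := amgm (v - M%:R * mu y); rewrite /g /c /e -/u -/v; lra.
have Is : integ P (fun w => M%:R^-1 * \sum_(y <- centers t) g y w).
  by apply: integZ; exact: integ_sum.
have step1 : `|f (relocate r xi) - EV P (fun w => f (relocate r (point_sum U M w)))|
    <= EV P (fun w => M%:R^-1 * \sum_(y <- centers t) g y w).
  have Ic := integ_cst P (f (relocate r xi)).
  rewrite -[in leLHS](EV_cst P (f (relocate r xi))) -EVB//.
  apply: le_trans (EV_norm (integB Ic If)) _; apply: EV_le => //.
  by apply: integ_norm; exact: integB.
apply: le_trans step1 _; rewrite EVZ; last exact: integ_sum.
rewrite ler_wpM2l// EV_sum//.
have sum_mu := sum_block_probability mcell (PU 0%N).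
have Eg y : EV P (g y) <= s + (2 * s)^-1 * (M%:R * mu y) + (2 * s)^-1 * e y.
  have [Ic Ec] := cP y.
  rewrite /g EVD; [|by apply: integD; [exact: integ_cst|exact: integZ]|exact: integ_cst].
  rewrite EVD; [|exact: integ_cst|exact: integZ].
  rewrite !EV_cst EVZ// lerD2r lerD2l; apply: ler_wpM2l => //.
  by rewrite invr_ge0 mulr_ge0// ltW.
apply: (le_trans (ler_sum _ (fun y _ => Eg y))).
rewrite !big_split/= -!mulr_sumr sum_mu mulr1.
rewrite big_const_seq count_predT iter_addr_0 -[s *+ _]mulr_natl /e.
rewrite le_eqVlt; apply/orP; left; apply/eqP; congr (_ + _ + _); field.
all: by rewrite gt_eqF.
Qed.

End relocated_gap.

(** * Moments, Palm formula and sums of independent point processes *)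

Section mass_moments.
Context {R : realType} {T : pointedMetricType R}.

Lemma integ_mass_pow (Q : probability (config T) R) k : (k <= 3)%N ->
  (factorial_moment Q 3 < +oo)%E ->
  integ Q (fun xi => (mass xi)%:R ^+ k).
Proof.
move=> k3; rewrite /factorial_moment unlock => fin3.
have mnat (h : nat -> R) : measurable_fun [set: config T] (fun xi => h (mass xi)).
  by apply: (measurableT_comp (g := @mass R T)) => //; exact: measurable_mass.
have I3 : integ Q (fun xi => (mass xi ^_ 3)%:R).
  apply/integrableP; split.
    by apply/measurable_EFinP; exact: (mnat (fun x => (x ^_ 3)%:R)).
  by move: fin3; under eq_integral do rewrite -[(_%:R)%:E]gee0_abs ?lee_fin//.
(* The summand 8 = 2^3 covers masses up to 2, where x(x - 1)(x - 2) vanishes; from 3 on, x^3 <= 9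
   x(x - 1)(x - 2). *)
apply: (integ_le (g := fun xi => 8 + 9 * (mass xi ^_ 3)%:R)).
- exact: (mnat (fun x => x%:R ^+ k)).
- move=> xi; rewrite ger0_norm ?exprn_ge0// -natrX -natrM -natrD ler_nat.
  case: (mass xi) => [|[|[|x]]].
  + by case: k k3 => [|k] _; rewrite ?expn0// exp0n.
  + by rewrite exp1n.
  + by rewrite (@leq_trans (2 ^ 3))// leq_pexp2l.
  + apply: (@leq_trans (x.+3 ^ 3)); first by rewrite leq_pexp2l.
    by rewrite !ffactnS ffactn0 /= !expnS expn0 !muln1; nia.
- by apply: integD; [exact: integ_cst|exact: integZ].
Qed.

Lemma theta_moments (Q : probability (config T) R) :
  (factorial_moment Q 3 < +oo)%E ->
  let M k := EV Q (fun xi => (mass xi)%:R ^+ k) in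
  [/\ M 1%N = theta Q 1, M 2%N = theta Q 2 + theta Q 1 &
      M 3%N = theta Q 3 + 3 * theta Q 2 + theta Q 1].
Proof.
move=> fin3 M.
have I k : (k <= 3)%N -> integ Q (fun xi => (mass xi)%:R ^+ k).
  by move=> k3; exact: integ_mass_pow.
have thetaE r : theta Q r = EV Q (fun xi => (mass xi ^_ r)%:R).
  by rewrite /theta /factorial_moment unlock.
have t1 : theta Q 1 = M 1%N.
  by rewrite thetaE; apply: EV_eq => xi; rewrite ffactn1 expr1.
have t2 : theta Q 2 = M 2%N - M 1%N.
  rewrite thetaE /M -(EVB (I 2%N isT) (I 1%N isT)); apply: EV_eq => xi.
  by case: (mass xi) => [|x]; rewrite !ffactnS ffactn0 /= muln1 natrM -?natr1; ring.
have t3 : theta Q 3 = M 3%N - 3 * M 2%N + 2 * M 1%N.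
  have I32 := integZ 3 (I 2%N isT); have I21 := integZ 2 (I 1%N isT).
  rewrite thetaE /M -(EVZ 3 (I 2%N isT)) -(EVZ 2 (I 1%N isT)).
  rewrite -(EVB (I 3%N isT) I32) -(EVD (integB (I 3%N isT) I32) I21).
  apply: EV_eq => xi; case: (mass xi) => [|[|x]];
    by rewrite !ffactnS ffactn0 /= muln1 !natrM -?natr1; ring.
by split; rewrite ?t1 ?t2 ?t3; ring.
Qed.

Lemma mean_massE (Q : probability (config T) R) :
  (factorial_moment Q 3 < +oo)%E -> mean_mass Q = (theta Q 1)%:E.
Proof.
move=> fin3; have [<- _ _] := theta_moments fin3.
rewrite EV_EFin; last exact: integ_mass_pow.
by rewrite /mean_mass unlock; apply: eq_integral => xi _; rewrite expr1.
Qed.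

Lemma var_massE (Q : probability (config T) R) :
  (factorial_moment Q 3 < +oo)%E ->
  var_mass Q = (theta Q 2 + theta Q 1 - theta Q 1 ^+ 2)%:E.
Proof.
move=> fin3; have [M1 M2 _] := theta_moments fin3.
have mE := mean_massE fin3; rewrite /mean_mass in mE.
have I1 : integ Q (fun xi => (mass xi)%:R).
  by have := integ_mass_pow (isT : (1 <= 3)%N) fin3; under eq_fun do rewrite expr1.
have I2 := integ_mass_pow (isT : (2 <= 3)%N) fin3.
rewrite /var_mass /variance unlock /covariance.
rewrite mE unlock /=.
transitivity ((EV Q (fun xi => (mass xi)%:R ^+ 2
    + (- (2 * theta Q 1)) * (mass xi)%:R + theta Q 1 ^+ 2))%:E).
  rewrite EV_EFin; last first.
    by apply: integD; [apply: integD => //; exact: integZ|exact: integ_cst].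
  apply: eq_integral => xi _; congr (_%:E).
  transitivity (((mass xi)%:R - theta Q 1) * ((mass xi)%:R - theta Q 1)) => //.
  by ring.
rewrite EVD; [|by apply: integD => //; exact: integZ|exact: integ_cst].
rewrite EVD//; last exact: integZ.
rewrite EVZ// EV_cst M2.
have <- : EV Q (fun xi => (mass xi)%:R ^+ 1) = EV Q (fun xi => (mass xi)%:R).
  by apply: EV_eq => xi; rewrite expr1.
by rewrite M1; congr (_%:E); ring.
Qed.

End mass_moments.

(** The coefficient is the mean birth rate of the sum minus its mean death rate, and this [a]
    balances the two. *)
Lemma order0_coef_eq0 (R : realType) (b beta n t1 t2 : R) :
  order0_coef (n * ((1 - b) * t1 + beta * t2 + beta * (n - 1) * t1 ^+ 2))
    b beta n 1 t1 (t2 + t1) = 0.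
Proof. by rewrite /order0_coef; ring. Qed.

(** The coefficient equals n (t1^2 - t2 + b (t2 - t1^2 + t1)). The factor of b is the variance of
    one mass, so 1 - b is the ratio of mean to variance. *)
Lemma order1_coef_eq0_case1 (R : realType) (n t1 t2 t3 b : R) :
  0 < t1 -> 0 <= t2 - t1 ^+ 2 ->
  b = (t2 - t1 ^+ 2) / (t2 - t1 ^+ 2 + t1) ->
  [/\ 0 <= b, b < 1 &
   order1_coef (n * ((1 - b) * t1 + 0 * t2 + 0 * (n - 1) * t1 ^+ 2))
    b 0 n 1 t1 (t2 + t1) (t3 + 3 * t2 + t1) = 0].
Proof.
move=> t10 v0 ->; have d0 : 0 < t2 - t1 ^+ 2 + t1 by rewrite ltr_wpDl.
split.
- by rewrite divr_ge0// ltW.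
- by rewrite ltr_pdivrMr// mul1r ltrDl.
by rewrite /order1_coef; field; rewrite gt_eqF.
Qed.

(** With b = 0 and this [a], the coefficient equals n (t1^2 - t2 - beta den), so that [beta] is its
    root. *)
Lemma order1_coef_eq0_case2 (R : realType) (n t1 t2 t3 beta : R) :
  let den := (n - 1) * t1 * (t1 - 2 * (t1 ^+ 2 - t2))
             + (t3 + t2 - t1 * t2) in
  0 < den -> beta = (t1 ^+ 2 - t2) / den ->
   order1_coef (n * ((1 - 0) * t1 + beta * t2 + beta * (n - 1) * t1 ^+ 2))
    0 beta n 1 t1 (t2 + t1) (t3 + 3 * t2 + t1) = 0.
Proof.
by move=> den d0 ->; rewrite /order1_coef /den; field; rewrite gt_eqF.
Qed.

(** Put v = t1^2 - t2, so that the variance is t1 - v. In Case 2, v > 0 is underdispersion, and a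
    variance of at least half the mean means t1 - 2 v >= 0, which times t1 is the slope in n of the
    denominator of [beta]. If the slope is positive, the range of n makes the denominator positive;
    if it is 0, the condition on theta_3 does. *)
Lemma dispersion_cases (R : realType) (T : pointedMetricType R)
  (Q : probability (config T) R) (b : R) (beta : nat -> R) (n_range : set nat) :
  (factorial_moment Q 3 < +oo)%E ->
    [/\ (mean_mass Q <= var_mass Q)%E,
        b = (theta Q 2 - theta Q 1 ^+ 2)
            / (theta Q 2 - theta Q 1 ^+ 2 + theta Q 1),
        forall n, beta n = 0 &
        n_range = [set n | (2 < n)%N]]
    \/
    [/\ (2^-1%:E * mean_mass Q < var_mass Q)%E /\
          (var_mass Q < mean_mass Q)%E
        \/ (2^-1%:E * mean_mass Q = var_mass Q)%E /\
          theta Q 2 * (theta Q 1 - 1) < theta Q 3,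
        b = 0,
        forall n, beta n =
          (theta Q 1 ^+ 2 - theta Q 2)
          / ((n%:R - 1) * theta Q 1
               * (theta Q 1 - 2 * (theta Q 1 ^+ 2 - theta Q 2))
             + (theta Q 3 + theta Q 2 - theta Q 1 * theta Q 2)) &
        n_range = [set n : nat | 1 + Num.max
          ((theta Q 1 * theta Q 2 - theta Q 2 - theta Q 3)
           / (theta Q 1 * (theta Q 1 - 2 * (theta Q 1 ^+ 2 - theta Q 2)))) 0
          < n%:R]] ->
  0 < theta Q 1 ->
  [/\ 0 <= b, b < 1 & forall n, n_range n ->
    [/\ (2 <= n)%N, 0 <= beta n &
      order1_coef (n%:R * ((1 - b) * theta Q 1 + beta n * theta Q 2
          + beta n * (n%:R - 1) * theta Q 1 ^+ 2))
        b (beta n) n%:R 1 (theta Q 1) (theta Q 2 + theta Q 1)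
        (theta Q 3 + 3 * theta Q 2 + theta Q 1) = 0]].
Proof.
move=> fin3; rewrite mean_massE// var_massE//.
move: (theta Q 1) (theta Q 2) (theta Q 3) => t1 t2 t3 cases t10.
case: cases => [[Vle bE betaE ->]|[Vlt bE betaE ->]].
  rewrite lee_fin in Vle.
  have v0 : 0 <= t2 - t1 ^+ 2 by lra.
  have [b0 b1 _] := order1_coef_eq0_case1 0 t3 t10 v0 bE.
  split => // n n2; rewrite betaE; split => //; first exact: ltnW.
  by have [_ _ ->] := order1_coef_eq0_case1 n%:R t3 t10 v0 bE.
have [v0 w0 k0] : [/\ 0 < t1 ^+ 2 - t2, 0 <= t1 - 2 * (t1 ^+ 2 - t2) &
    0 < t1 - 2 * (t1 ^+ 2 - t2) \/
    (t1 - 2 * (t1 ^+ 2 - t2) = 0 /\ 0 < t3 + t2 - t1 * t2)].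
  case: Vlt => [[]|[]].
    by rewrite -EFinM !lte_fin => ? ?; split; [lra|lra|left; lra].
  by rewrite -EFinM => -[e] d; split; [lra|lra|right; split; lra].
rewrite bE; split => // n /= nr.
have n1 : 1 < n%:R :> R.
  by apply: le_lt_trans nr; rewrite lerDl le_max lexx orbT.
have den0 : 0 < (n%:R - 1) * t1 * (t1 - 2 * (t1 ^+ 2 - t2)) + (t3 + t2 - t1 * t2).
  case: k0 => [k0|[-> k0]]; last by rewrite mulr0 add0r.
  have : (t1 * t2 - t2 - t3) / (t1 * (t1 - 2 * (t1 ^+ 2 - t2))) < n%:R - 1.
    by rewrite ltrBrDl; apply: le_lt_trans nr; rewrite lerD2l le_max lexx.
  by rewrite ltr_pdivrMr ?mulr_gt0// mulrA; lra.
split; first by rewrite -(ltr_nat R).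
  by rewrite betaE divr_ge0// ltW.
exact: order1_coef_eq0_case2 den0 (betaE n).
Qed.

(** * The Palm formula and the gap between mean measure and mu *)

Section pbd_mean_measure.
Context {R : realType} {T : pointedMetricType R}.

Lemma mass_cfg_remove (xi : config T) x : x \in cfg_points xi ->
  mass (cfg_remove xi x) = (mass xi).-1.
Proof.
move=> xxi.
have : perm_eq (cfg_points xi) (x :: cfg_points (cfg_remove xi x)).
  apply/allP => z _ /=; rewrite !count_mem_mset msetE2 msetnE.
  have : (0 < (xi : multiset T) x)%N by rewrite mset_gt0.
  by rewrite eq_sym; have [->|_] := eqVneq z x; lia.
by move=> /perm_size /= E; rewrite /mass E.
Qed.

Lemma mean_measureE (Q : probability (config T) R) (B : set (borel T)) :
  (factorial_moment Q 3 < +oo)%E -> measurable B ->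
  integ Q (fun xi => (cfg_count B xi)%:R) /\
  mean_measure Q B = (EV Q (fun xi => (cfg_count B xi)%:R))%:E.
Proof.
move=> fin3 mB.
have I : integ Q (fun xi => (cfg_count B xi)%:R).
  have := integ_mass_pow (isT : (1 <= 3)%N) fin3; apply: integ_le.
    apply: (measurableT_comp (f := fun k : nat => k%:R : R)) => //.
    exact: measurable_cfg_count.
  by move=> xi; rewrite expr1 ger0_norm// ler_nat cfg_count_le_mass.
split => //; rewrite EV_EFin//; apply: eq_integral => xi _.
exact: cfg_measureE.
Qed.

(** The Palm formula for f(x, xi) = 1_B(x) |xi|: every point in B sees all the others. The
    predecessor of mass 0 does not matter, the count being 0 as well. *)
Lemma palm_mass_integral (Q : probability (config T) R)
    (palm : R.-pker (borel T) ~> config T) (B : set (borel T)) :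
  reduced_palm Q palm -> (factorial_moment Q 3 < +oo)%E -> measurable B ->
  integ Q (fun xi => (cfg_count B xi)%:R * (mass xi).-1%:R) /\
  (\int[mean_measure Q]_(x in B) \int[palm x]_xi (mass xi)%:R%:E =
    (EV Q (fun xi => (cfg_count B xi)%:R * (mass xi).-1%:R))%:E)%E.
Proof.
move=> [_ palmE] fin3 mB.
have mc : measurable_fun [set: config T] (fun xi => (cfg_count B xi)%:R : R).
  apply: (measurableT_comp (f := fun k : nat => k%:R : R)) => //.
  exact: measurable_cfg_count.
have I : integ Q (fun xi => (cfg_count B xi)%:R * (mass xi).-1%:R).
  have := integ_mass_pow (isT : (2 <= 3)%N) fin3; apply: integ_le.
    apply: measurable_funM => //.
    apply: (measurableT_comp (f := fun k : nat => k.-1%:R : R)) => //.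
    exact: measurable_mass.
  move=> xi; rewrite ger0_norm ?mulr_ge0// expr2 ler_pM// ler_nat.
    exact: cfg_count_le_mass.
  exact: leq_pred.
split => //.
pose f (z : borel T * config T) : R := \1_B z.1 * (mass z.2)%:R.
have mf : measurable_fun [set: borel T * config T] f.
  apply: measurable_funM.
    by apply: (measurableT_comp (f := \1_B : borel T -> R)) => //; exact: measurable_indic.
  apply: (measurableT_comp (f := fun k : nat => k%:R : R)) => //.
  by apply: measurableT_comp => //; exact: measurable_mass.
have := palmE f mf (fun z => mulr_ge0 (ler0n _ _) (ler0n _ _)).
have -> : (\int[mean_measure Q]_x \int[palm x]_xi (f (x, xi))%:E =
    \int[mean_measure Q]_(x in B) \int[palm x]_xi (mass xi)%:R%:E)%E.
  rewrite [RHS]integral_mkcond; apply: eq_integral => x _; rewrite patchE.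
  rewrite /f /= indicE; case: ifPn => xB.
    by apply: eq_integral => xi _; rewrite mul1r.
  by under eq_integral do rewrite mul0r; rewrite integral0.
move=> <-; rewrite EV_EFin//; apply: eq_integral => xi _.
rewrite sumEFin; congr (_%:E); rewrite /f /=.
rewrite big_seq (eq_bigr (fun x => (x \in B)%:R * (mass xi).-1%:R)); last first.
  by move=> x xxi; rewrite indicE mass_cfg_remove.
rewrite -big_seq -mulr_suml; congr (_ * _).
by rewrite /cfg_count -sum1_count natr_sum [LHS]big_mkcond/= [RHS]big_mkcond/=;
  apply: eq_bigr => x _; case: (_ \in _).
Qed.

Lemma pbd_muE (Q : probability (config T) R)
    (palm : R.-pker (borel T) ~> config T) (beta : R) n (B : set (borel T)) :
  reduced_palm Q palm -> (factorial_moment Q 3 < +oo)%E -> measurable B ->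
  0 <= beta -> (0 < n)%N ->
  let den := theta Q 1 + beta * (theta Q 2 + (n%:R - 1) * theta Q 1 ^+ 2) in
  0 < den -> 0 <= theta Q 1 ->
  pbd_mu Q palm beta n B =
   (den^-1 * ((1 + beta * (n%:R - 1) * theta Q 1)
        * EV Q (fun xi => (cfg_count B xi)%:R)
      + beta * EV Q (fun xi => (cfg_count B xi)%:R * (mass xi).-1%:R)))%:E.
Proof.
move=> palmP fin3 mB beta0 n0 den den0 t10.
have [_ LE] := mean_measureE fin3 mB.
have [_ EE] := palm_mass_integral palmP fin3 mB.
pose e (x : borel T) := (\int[palm x]_xi (mass xi)%:R%:E)%E.
have e0 x : (0 <= e x)%E by apply: integral_ge0 => xi _; rewrite lee_fin.
have me : measurable_fun [set: borel T] e.
  apply: measurable_fun_integral_kernel => //.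
    by move=> U mU; exact: measurable_kernel.
  apply/measurable_EFinP.
  apply: (measurableT_comp (f := fun k : nat => k%:R : R)) => //.
    exact: measurable_mass.
have n1 : 0 <= n%:R - 1 :> R by rewrite subr_ge0 ler1n.
rewrite /pbd_mu -/den.
transitivity ((den^-1)%:E * \int[mean_measure Q]_(x in B)
    ((1 + beta * (n%:R - 1) * theta Q 1)%:E + beta%:E * e x))%E.
  rewrite -ge0_integralZl//; last 3 first.
  - apply: emeasurable_funD => //; apply: emeasurable_funM => //.
    exact: measurable_funTS.
  - move=> x _; apply: adde_ge0; last by apply: mule_ge0; rewrite ?lee_fin.
    by rewrite lee_fin addr_ge0// !mulr_ge0.
  - by rewrite lee_fin invr_ge0 ltW.
  apply: eq_integral => x _; rewrite muleC; congr (_ * _)%E.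
  by rewrite -/(e x) EFinD addeAC.
have c0 : 0 <= 1 + beta * (n%:R - 1) * theta Q 1 by rewrite addr_ge0// !mulr_ge0.
have be0 (x : borel T) : B x -> (0 <= beta%:E * e x)%E.
  by move=> _; apply: mule_ge0; rewrite ?lee_fin.
have meB : measurable_fun B e by exact: measurable_funTS.
have mbe : measurable_fun B (fun x => beta%:E * e x)%E.
  exact: emeasurable_funM.
rewrite [X in (_ * X)%E]ge0_integralD//.
rewrite integral_cst// [X in (_ * X + _)%E]LE.
rewrite [X in (_ * (_ + X))%E]ge0_integralZl//.
by rewrite [X in (_ * (_ + _ * X))%E]EE.
Qed.

(** On a block, lambda - theta_1 mu is beta / den times theta_2 lambda - theta_1 e, with e the
    integral of the mean Palm mass; over all blocks lambda and e add up to theta_1 and theta_2.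
    Since den >= beta n theta_1^2 / 2, the factor beta / den is O(1/n) uniformly in [beta], whatever
    the number of blocks. *)
Lemma pbd_mu_block_gap (Q : probability (config T) R)
    (palm : R.-pker (borel T) ~> config T) (beta : R) n
    m (cell : T -> 'I_m) (t : 'I_m -> T) (mu : T -> R) :
  reduced_palm Q palm -> (factorial_moment Q 3 < +oo)%E ->
  measurable_cells cell -> 0 <= beta -> (2 <= n)%N -> 0 < theta Q 1 ->
  (forall y, pbd_mu Q palm beta n (block cell t y) = (mu y)%:E) ->
  \sum_(y <- centers t) `|EV Q (fun xi => (cfg_count (block cell t y) xi)%:R)
     - theta Q 1 * mu y| <= 4 * theta Q 2 / theta Q 1 / n%:R.
Proof.
move=> palmP fin3 mcell beta0 n2 t10 muE.
have t20 : 0 <= theta Q 2.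
  have [M1 M2 _] := theta_moments fin3.
  have -> : theta Q 2 = EV Q (fun xi => (mass xi)%:R ^+ 2) - EV Q (fun xi => (mass xi)%:R ^+ 1).
    by rewrite M1 M2; ring.
  rewrite -EVB; [|exact: integ_mass_pow|exact: integ_mass_pow].
  apply: EV_ge0 => xi; case: (mass xi) => [|x]; first by rewrite expr1 expr2 mul0r subrr.
  by rewrite expr1 expr2 -[X in _ - X]mul1r -mulrBl mulr_ge0// subr_ge0 ler1n.
have n1 : 0 <= n%:R - 1 :> R by rewrite subr_ge0 ler1n ltnW.
set t1 := theta Q 1; set t2 := theta Q 2.
pose den := t1 + beta * (t2 + (n%:R - 1) * t1 ^+ 2).
have den0 : 0 < den.
  by rewrite ltr_wpDr// mulr_ge0// addr_ge0// mulr_ge0// sqr_ge0.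
have mb y := measurable_block t y mcell.
pose l y := EV Q (fun xi => (cfg_count (block cell t y) xi)%:R).
pose e y := EV Q (fun xi => (cfg_count (block cell t y) xi)%:R * (mass xi).-1%:R).
have l0 y : 0 <= l y by apply: EV_ge0.
have e0 y : 0 <= e y by apply: EV_ge0 => xi; rewrite mulr_ge0.
have Il y : integ Q (fun xi => (cfg_count (block cell t y) xi)%:R).
  by have [] := mean_measureE fin3 (mb y).
have Ie y : integ Q (fun xi => (cfg_count (block cell t y) xi)%:R * (mass xi).-1%:R).
  by have [] := palm_mass_integral palmP fin3 (mb y).
have muy y : mu y = den^-1 * ((1 + beta * (n%:R - 1) * t1) * l y + beta * e y).
  have := pbd_muE palmP fin3 (mb y) beta0 (ltnW n2) den0 (ltW t10).
  by rewrite muE => -[].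
have sl : \sum_(y <- centers t) l y = t1.
  have [tE _ _] := theta_moments fin3.
  rewrite /t1 -tE /l -(EV_sum (centers t) Il); apply: EV_eq => xi.
  by rewrite -natr_sum sum_cfg_count_blocks expr1.
have se : \sum_(y <- centers t) e y = t2.
  have -> : t2 = EV Q (fun xi => (mass xi ^_ 2)%:R).
    by rewrite /t2 /theta /factorial_moment unlock.
  rewrite /e -(EV_sum (centers t) Ie); apply: EV_eq => xi.
  by rewrite -mulr_suml -natr_sum sum_cfg_count_blocks -natrM !ffactnS ffactn0 muln1.
have gap y : `|l y - t1 * mu y| <= beta / den * (t2 * l y + t1 * e y).
  have -> : l y - t1 * mu y = beta / den * (t2 * l y - t1 * e y).
    by rewrite muy /den; field; rewrite gt_eqF.
  rewrite normrM ger0_norm ?divr_ge0//; last exact: ltW.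
  apply: ler_wpM2l; first by rewrite divr_ge0// ltW.
  apply: le_trans (ler_normB _ _) _.
  by rewrite !ger0_norm// mulr_ge0// ltW.
apply: le_trans (ler_sum _ (fun y _ => gap y)) _.
rewrite -mulr_sumr big_split/= -!mulr_sumr sl se.
have dn : beta * (n%:R * t1 ^+ 2 / 2) <= den.
  rewrite /den; apply: (@le_trans _ _ (beta * (t2 + (n%:R - 1) * t1 ^+ 2))); last first.
    by rewrite lerDr ltW.
  apply: ler_wpM2l => //.
  apply: (@le_trans _ _ ((n%:R - 1) * t1 ^+ 2)); last by rewrite lerDr.
  rewrite -mulrA mulrCA mulrA [leLHS]mulrC -mulrA -[leRHS]mulr1.
  have : (2 : R) <= n%:R by rewrite (ler_nat R 2).
  have := sqr_ge0 t1; nra.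
have nn0 : 0 < n%:R :> R by rewrite ltr0n ltnW.
have t1s : 0 < t1 ^+ 2 by rewrite exprn_gt0.
have -> : 4 * t2 / t1 / n%:R = (2 * t1 * t2) * (2 / (n%:R * t1 ^+ 2)).
  by field; rewrite !gt_eqF.
have -> : beta / den * (t2 * t1 + t1 * t2) = (2 * t1 * t2) * (beta / den) by ring.
apply: ler_wpM2l; first by rewrite !mulr_ge0// ltW.
rewrite ler_pdivrMr// [leRHS]mulrC mulrA ler_pdivlMr ?mulr_gt0//.
by move: dn; lra.
Qed.

End pbd_mean_measure.

Lemma law_finite_sum (R : realType) d (W : measurableType d)
    (P : probability W R) (N : W -> nat) K (A : pred nat) :
  measurable_fun [set: W] N ->
  fine (P [set w | (N w < K)%N && A (N w)]) =
  \sum_(0 <= s < K | A s) fine (P [set w | N w == s]).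
Proof.
move=> mN.
have mNp B : measurable [set w | (B : pred nat) (N w)].
  exact: measurable_nat_pred.
have [_ <-] := EV_bool P (mNp (fun x => (x < K)%N && A x)).
rewrite [RHS](eq_bigr (fun s => EV P (fun w => (N w == s)%:R))); last first.
  by move=> s _; have [_ ->] := EV_bool P (mNp (pred1 s)).
rewrite -big_filter -EV_sum; last first.
  by move=> s; have [] := EV_bool P (mNp (pred1 s)).
apply: EV_eq => w; rewrite big_filter.
have [NK|NK] := boolP ((N w < K)%N && A (N w)); last first.
  rewrite big_nat_cond big1// => s /andP[/andP[_ sK] As].
  by case: eqP => // Ns; move: NK; rewrite Ns sK As.
move/andP: NK => [NK AN].
rewrite big_mkcond (bigD1_seq (N w))/= ?mem_index_iota ?iota_uniq//.
rewrite AN eqxx big1 ?addr0// => s /negbTE sN.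
by rewrite eq_sym sN; case: (A s).
Qed.

Lemma fine_prod (R : realType) I (r : seq I) (F : I -> \bar R) :
  (forall i, F i \is a fin_num) ->
  fine (\prod_(i <- r) F i)%E = \prod_(i <- r) fine (F i).
Proof.
move=> Ff; elim: r => [|i r IHr]; first by rewrite !big_nil.
rewrite !big_cons fineM// ?IHr//.
by elim: (r) => [|j s IHs]; rewrite ?big_nil// big_cons fin_numM.
Qed.

(** * Laws and second moments of sums of i.i.d. processes *)

Section iid_sums.
Context {R : realType} {T : pointedMetricType R}.
Context {d : measure_display} {W : measurableType d}.
Implicit Types (Xi : nat -> {mfun W >-> config T}).

Lemma mass_pp_sum Xi k w : mass (pp_sum Xi k w) = (\sum_(j < k) mass (Xi j w))%N.
Proof.
rewrite -cfg_countT cfg_count_big; apply: eq_bigr => j _; exact: cfg_countT.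
Qed.

Lemma measurable_mass_mfun (X : {mfun W >-> config T}) :
  measurable_fun [set: W] (fun w => mass (X w)).
Proof. by apply: measurableT_comp => //; exact: measurable_mass. Qed.

Definition mass_law (Q : probability (config T) R) (i : nat) : R :=
  fine (Q (@mass R T @^-1` [set i])).

Lemma measurable_mass_preimage (A : set nat) :
  measurable (@mass R T @^-1` A : set (config T)).
Proof. by rewrite -[X in measurable X]setTI; exact: measurable_mass. Qed.

Lemma iid_pp_sum_law P n Xi (Q : probability (config T) R) k j :
  iid_with_law P n Xi Q -> (k <= n)%N ->
  fine (P [set w | mass (pp_sum Xi k w) = j]) = conv_power (mass_law Q) k j.
Proof.
move=> [law ind] kn.
rewrite (_ : [set w | _] = [set w | (\sum_(i < k) mass (Xi i w))%N = j]); last first.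
  by apply/seteqP; split => w /=; rewrite mass_pp_sum.
apply: (sum_law_conv_power (n := n) (N := fun i w => mass (Xi i w))) => //.
- by move=> i; exact: measurable_mass_mfun.
- move=> i x ni; rewrite /mass_law; congr fine.
  rewrite -(law i _ ni (measurable_mass_preimage [set x])).
  by congr (P _).
- move=> A; have := ind (fun i => @mass R T @^-1` A i)
    (fun i => measurable_mass_preimage (A i)).
  rewrite (_ : \bigcap_(i in _) _ = \bigcap_(i in [set: 'I_n])
    ((fun w => mass (Xi i w)) @^-1` A i))// => ->.
  apply: fine_prod => i; apply: fin_num_measure.
  by rewrite -[X in measurable X]setTI; exact: measurable_mass_mfun.
Qed.

Lemma iid_second_moment P n Xi (Q : probability (config T) R) k
    (y : config T -> R) :
  iid_with_law P n Xi Q -> (k <= n)%N -> measurable_fun [set: config T] y ->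
  integ Q (fun xi => y xi ^+ 2) -> integ Q y ->
  integ P (fun w => (\sum_(j < k) y (Xi j w)) ^+ 2) /\
  EV P (fun w => (\sum_(j < k) y (Xi j w)) ^+ 2) <=
    k%:R * EV Q (fun xi => y xi ^+ 2) + (k%:R * EV Q y) ^+ 2.
Proof.
move=> [law ind] kn my Iy2 Iy.
have comp2 j : (j < k)%N -> integ P ((fun xi => y xi ^+ 2) \o Xi j) /\
    EV P ((fun xi => y xi ^+ 2) \o Xi j) = EV Q (fun xi => y xi ^+ 2).
  by move=> jk; apply: EV_comp => // A mA; apply: law => //; exact: leq_trans kn.
have comp1 j : (j < k)%N -> integ P (y \o Xi j) /\ EV P (y \o Xi j) = EV Q y.
  by move=> jk; apply: EV_comp => // A mA; apply: law => //; exact: leq_trans kn.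
apply: (@second_moment_sum _ _ _ _ _ P k Xi y _ _ my).
- move=> i l A B ik lk il mA mB; apply: (indep_family_pair ind) => //.
    exact: leq_trans kn.
  exact: leq_trans kn.
- by move=> j /comp2[].
- by move=> j /comp2[_ E]; rewrite [leLHS]E.
- by move=> j /comp1[_ E].
Qed.

(** The sum is split by the sign of the difference. Each half is, up to sign, a difference of
    probabilities of one event for S + 1 and for S, hence at most [tau]. *)
Lemma conv_power_mass_tv P n Xi (Q : probability (config T) R) k (tau : R) :
  iid_with_law P n Xi Q -> (k <= n)%N ->
  (forall A : set nat,
    `|fine (P [set w | A (mass (pp_sum Xi k w)).+1])
      - fine (P [set w | A (mass (pp_sum Xi k w))])| <= tau) ->
  forall K, \sum_(0 <= s < K)
    `|delay (conv_power (mass_law Q) k) s - conv_power (mass_law Q) k s|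
    <= 2 * tau.
Proof.
move=> iid kn tvP K; set v := conv_power (mass_law Q) k.
pose S w := mass (pp_sum Xi k w).
have mS : measurable_fun [set: W] S.
  apply: measurableT_comp; first exact: measurable_mass.
  exact: measurable_pp_sum.
have mSS : measurable_fun [set: W] (fun w => (S w).+1).
  by rewrite (_ : (fun _ => _) = (fun w => (S w + 1)%N)); [exact: measurable_fun_addn|apply/funext => w; rewrite addn1].
have vE s : fine (P [set w | S w == s]) = v s.
  rewrite /v -(iid_pp_sum_law _ iid kn); congr (fine (P _)).
  by apply/seteqP; split => w /= /eqP.
have dE s : fine (P [set w | (S w).+1 == s]) = delay v s.
  case: s => [|s] /=; last by rewrite -vE; congr (fine (P _)); apply/seteqP; split.
  by rewrite (_ : [set w | _] = set0) ?measure0//; apply/seteqP; split.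
have half (A : pred nat) :
    `|\sum_(0 <= s < K | A s) (delay v s - v s)| <= tau.
  have := tvP [set x | (x < K)%N && A x] => /=.
  rewrite (law_finite_sum P K A mSS) (law_finite_sum P K A mS).
  have -> : \sum_(0 <= s < K | A s) fine (P [set w | (S w).+1 == s]) =
      \sum_(0 <= s < K | A s) delay v s by apply: eq_bigr => s _; exact: dE.
  have -> : \sum_(0 <= s < K | A s) fine (P [set w | S w == s]) =
      \sum_(0 <= s < K | A s) v s by apply: eq_bigr => s _; exact: vE.
  by rewrite sumrB.
rewrite (bigID (fun s => v s <= delay v s))/= mulr2n mulrDl mul1r.
apply: lerD.
  apply: le_trans (half (fun s => v s <= delay v s)).
  rewrite [leRHS]ger0_norm; last by apply: sumr_ge0 => s; rewrite subr_ge0.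
  by apply: ler_sum => s vs; rewrite ger0_norm// subr_ge0.
apply: le_trans (half (fun s => ~~ (v s <= delay v s))).
rewrite [leRHS]ler0_norm; last first.
  by apply: sumr_le0 => s; rewrite -ltNge subr_le0 => /ltW.
rewrite -sumrN; apply: ler_sum => s; rewrite -ltNge => /ltW vs.
by rewrite ler0_norm// subr_le0.
Qed.

Lemma mass_law_ge0 (Q : probability (config T) R) i : 0 <= mass_law Q i.
Proof. by rewrite fine_ge0. Qed.

Lemma mass_law_series (Q : probability (config T) R) (h : nat -> R) :
  (forall j, 0 <= h j) -> integ Q (fun xi => h (mass xi)) ->
  series (fun j => mass_law Q j * h j) @ \oo --> EV Q (fun xi => h (mass xi)).
Proof.
move=> h0 Ih; exact: (EV_nat_cvg (N := @mass R T) measurable_mass h0 Ih).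
Qed.

Lemma mass_law_series1 (Q : probability (config T) R) :
  series (mass_law Q) @ \oo --> (1 : R).
Proof.
have := @mass_law_series Q (fun=> 1) (fun _ => ler01) (integ_cst Q 1).
by rewrite EV_cst; under [X in series X @ _]eq_fun do rewrite mulr1.
Qed.

Lemma mass_law_moment (Q : probability (config T) R) k :
  (factorial_moment Q 3 < +oo)%E -> (k <= 3)%N ->
  moment (trunc_poly (mass_law Q) N) k @[N --> \oo] -->
    EV Q (fun xi => (mass xi)%:R ^+ k).
Proof.
move=> fin3 k3.
rewrite (_ : (fun N => _) = series (fun j => mass_law Q j * j%:R ^+ k)).
  apply: (@mass_law_series Q (fun j => j%:R ^+ k)) => [j|]; first exact: exprn_ge0.
  exact: integ_mass_pow.
by apply/funext => N; rewrite /moment pairing_trunc.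
Qed.

End iid_sums.

(** * Atoms and lower tails of counts *)

Lemma mul_div_double_le_half (m q : nat) :
  let N := (m %/ (2 * q))%N in (q * N <= m)%N /\ (m./2 <= m - q * N)%N.
Proof.
have := leq_divM m (2 * q); rewrite mulnC -mulnA mul2n => h.
by have := odd_double_half m; split; lia.
Qed.

(** By Chebyshev's inequality at least half of the mass lies within l of e, on at most 2 l + 2
    atoms. *)
Lemma concentrated_atom (R : realType) d (W : measurableType d)
    (P : probability W R) (N : W -> nat) (e l tau : R) :
  measurable_fun [set: W] N -> 0 < l ->
  integ P (fun w => ((N w)%:R - e) ^+ 2) ->
  EV P (fun w => ((N w)%:R - e) ^+ 2) <= l ^+ 2 / 2 ->
  (forall k, fine (P [set w | N w = k]) <= tau) ->
  1 <= 4 * (l + 1) * tau.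
Proof.
move=> mN l0 I2 E2 Ntau.
(* The K integers from [k0] on contain every natural number within l of e; the 2 added in [K] makes
   up for both roundings, and [truncn] is 0 when e - l is negative. *)
pose k0 := Num.truncn (e - l); pose K := (Num.truncn (2 * l)).+2.
pose i k (w : W) : R := (N w == k)%:R.
have iP k : integ P (i k) /\ EV P (i k) <= tau.
  have [I E] := EV_bool P (measurable_nat_pred (pred1 k) mN).
  split => //; rewrite /i [leLHS]E; apply: le_trans (Ntau k).
  rewrite le_eqVlt; apply/orP; left; apply/eqP; congr (fine (P _)).
  by apply/seteqP; split => w /= /eqP.
have tau0 : 0 <= tau by apply: le_trans (Ntau 0%N); rewrite fine_ge0.
have l2 : 0 < l ^+ 2 by rewrite exprn_gt0.
have pointwise w : 1 <= \sum_(k < K) i (k0 + k)%N w + (l ^+ 2)^-1 * ((N w)%:R - e) ^+ 2.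
  have [close|far] := leP `|(N w)%:R - e| l; last first.
    have : 1 <= (l ^+ 2)^-1 * ((N w)%:R - e) ^+ 2.
      rewrite ler_pdivlMl// mulr1 -[leRHS]real_normK ?num_real//.
      by rewrite lerXn2r ?nnegrE// ltW.
    by move=> /le_trans; apply; rewrite lerDr sumr_ge0.
  move: close; rewrite ler_norml => /andP[c1 c2].
  have Nk0 : (k0 <= N w)%N.
    by rewrite /k0 truncn_le_nat -natr1; lra.
  have NK : (N w - k0 < K)%N.
    rewrite ltn_subLR// -(ltr_nat R) natrD /K -natr1 -natr1.
    have h1 : e - l < k0%:R + 1 by rewrite natr1; exact: truncnS_gt.
    have h2 : 2 * l < (Num.truncn (2 * l))%:R + 1 by rewrite natr1; exact: truncnS_gt.
    lra.
  rewrite (bigD1 (Ordinal NK))//= /i subnKC// eqxx.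
  by rewrite -addrA lerDl addr_ge0 ?sumr_ge0// mulr_ge0 ?sqr_ge0// invr_ge0 ltW.
have Is : integ P (fun w => \sum_(k < K) i (k0 + k)%N w).
  by apply: integ_sum => k; have [] := iP (k0 + k)%N.
have Ir : integ P (fun w => (l ^+ 2)^-1 * ((N w)%:R - e) ^+ 2) by exact: integZ.
have := EV_le (integ_cst P 1) (integD Is Ir) pointwise.
rewrite EV_cst EVD// EVZ// EV_sum; last by move=> k; have [] := iP (k0 + k)%N.
have s1 : \sum_(k < K) EV P (i (k0 + k)%N) <= (2 * l + 2) * tau.
  apply: (@le_trans _ _ (\sum_(k < K) tau)).
    by apply: ler_sum => k _; have [] := iP (k0 + k)%N.
  rewrite sumr_const card_ord -[leLHS]mulr_natl ler_wpM2r// /K -natr1 -natr1.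
  have : (Num.truncn (2 * l))%:R <= 2 * l by rewrite truncn_le mulr_ge0// ltW.
  lra.
have s2 : (l ^+ 2)^-1 * EV P (fun w => ((N w)%:R - e) ^+ 2) <= 1 / 2.
  by rewrite ler_pdivrMl// mulrA mulr1.
lra.
Qed.

Section iid_bounds.
Context {R : realType} {T : pointedMetricType R}.

Lemma mass_law0_lt1 (Q : probability (config T) R) :
  (factorial_moment Q 3 < +oo)%E -> 0 < theta Q 1 -> mass_law Q 0 < 1.
Proof.
move=> fin3 t10; rewrite ltNge; apply/negP => p01.
have p0 i : mass_law Q i.+1 = 0.
  have := trunc1_le1 (@mass_law_ge0 _ _ Q) (mass_law_series1 Q) i.+2.
  rewrite trunc1E big_nat_recr//= big_nat_recl//=.
  have : 0 <= \sum_(0 <= j < i) mass_law Q j.+1.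
    by apply: sumr_ge0 => j _; exact: mass_law_ge0.
  by have := mass_law_ge0 Q i.+1; move=> ? ? ?; apply/eqP; rewrite eq_le; apply/andP; split; lra.
have [tE _ _] := theta_moments fin3.
have c := mass_law_moment fin3 (isT : (1 <= 3)%N).
have c0 : (fun N => moment (trunc_poly (mass_law Q) N) 1) = fun=> 0.
  apply/funext => N; rewrite /moment pairing_trunc big1// => -[|j] _.
    by rewrite expr1 mulr0.
  by rewrite p0 mul0r.
have := cvg_lim (@Rhausdorff R) c; rewrite c0 (cvg_lim _ (cvg_cst 0))// tE.
by move=> e0; rewrite -e0 ltxx in t10.
Qed.

(** Chernoff's method at the point 1/2. A single mass X has E[2^(-X)] <= p(0) + (1 - p(0)) / 2 =
    phi, so P(S <= N0) <= 2^N0 phi^m. Since phi^q <= 1/2 and q N0 <= m / 2, the power of 2 consumes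
    at most half of the exponent. *)
Lemma mass_tail (Q : probability (config T) R) :
  (factorial_moment Q 3 < +oo)%E -> 0 < theta Q 1 ->
  exists rho phi : R, [/\ 0 < rho < 1, 0 < phi < 1 &
    forall d (W : measurableType d) (P : probability W R)
      (Xi : nat -> {mfun W >-> config T}) n m,
    iid_with_law P n Xi Q -> (m <= n)%N ->
    (P [set w | ((\sum_(k < m) mass (Xi k w))%N%:R <= rho * m%:R * theta Q 1)%R]
      <= (phi ^+ m./2)%:E)%E].
Proof.
move=> fin3 t10; have p01 := mass_law0_lt1 fin3 t10.
set p := mass_law Q in p01 *; have pge0 : forall i, 0 <= p i by exact: mass_law_ge0.
have p1 : series p @ \oo --> (1 : R) by exact: mass_law_series1.
pose phi := (1 + p 0%N) / 2.
have phi01 : 0 < phi < 1 by have := pge0 0%N; rewrite /phi => ?; apply/andP; split; lra.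
have [phi0 phi1] := andP phi01.
have [q q0 phiq] : exists2 q : nat, (0 < q)%N & phi ^+ q <= 2^-1.
  have c : (fun k => phi ^+ k) @ \oo --> (0 : R) by apply: cvg_expr; rewrite gtr0_norm.
  have h0 : (0 : R) < 2^-1 by rewrite invr_gt0.
  have [k _ kP] := (cvgrPdist_le _ _).1 c _ h0.
  exists k.+1 => //; have := kP k.+1 (leqnSn k).
  by rewrite /= sub0r normrN ger0_norm// exprn_ge0// ltW.
(* With this value S <= rho m theta_1 implies 2 q S <= m, that is S <= N0; the summand 2 ensures rho
   < 1. *)
pose rho : R := (2 + (2 * q)%:R * theta Q 1)^-1.
have d0 : 0 < 2 + (2 * q)%:R * theta Q 1 by rewrite ltr_wpDr// mulr_ge0// ltW.
exists rho, phi; split => //.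
  rewrite invr_gt0 d0/= invf_lt1//.
  have : 0 <= (2 * q)%:R * theta Q 1 by rewrite mulr_ge0// ltW.
  lra.
move=> d W P Xi n m iid mn.
pose S w := mass (pp_sum Xi m w).
have mS : measurable_fun [set: W] S.
  apply: measurableT_comp; first exact: measurable_mass.
  exact: measurable_pp_sum.
pose N0 := (m %/ (2 * q))%N.
have [qN0m halfm] := mul_div_double_le_half m q.
apply: (@le_trans _ _ (P [set w | (S w < N0.+1)%N && xpredT (S w)])).
  apply: le_measure; rewrite ?inE.
  - rewrite (_ : [set w | _] = [set w | (fun x => x%:R <= rho * m%:R * theta Q 1) (S w)]).
      exact: (measurable_nat_pred (fun x => x%:R <= rho * m%:R * theta Q 1)).
    by apply/seteqP; split => w /=; rewrite /S mass_pp_sum.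
  - exact: (measurable_nat_pred (fun x => (x < N0.+1)%N && xpredT x)).
  move=> w /=; rewrite -mass_pp_sum -/(S w) andbT ltnS => Sw.
  rewrite leq_divRL ?muln_gt0 ?q0// -(ler_nat R) natrM.
  have : (S w)%:R * (2 + (2 * q)%:R * theta Q 1) <= m%:R * theta Q 1.
    by rewrite -ler_pdivlMr// mulrC mulrA.
  have : 0 <= (S w)%:R * 2 :> R by rewrite mulr_ge0.
  move: ((S w)%:R : R) ((2 * q)%:R : R) (m%:R : R) (theta Q 1) t10 => x y z t t0 h1 h2.
  rewrite -(ler_pM2r t0); lra.
have mSp := measurable_nat_pred (fun x => (x < N0.+1)%N && xpredT x) mS.
rewrite -[leLHS]fineK ?fin_num_measure// lee_fin.
rewrite (law_finite_sum P N0.+1 xpredT mS).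
have -> : \sum_(0 <= s < N0.+1) fine (P [set w | S w == s]) =
    \sum_(0 <= s < N0.+1) conv_power p m s.
  apply: eq_bigr => s _; rewrite -(iid_pp_sum_law _ iid mn); congr (fine (P _)).
  by apply/seteqP; split => w /= /eqP.
pose A := trunc_poly p N0.+1.
have A0 : nneg_poly A by exact: nneg_trunc.
pose z : R := 2^-1.
have z0 : 0 <= z by rewrite invr_ge0.
have Az : A.[z] <= phi.
  have -> : A.[z] = pairing (fun i => z ^+ i) A by rewrite horner_coef.
  rewrite pairing_trunc big_nat_recl//= expr0 mulr1.
  have : \sum_(0 <= i < N0) p i.+1 * z ^+ i.+1 <= \sum_(0 <= i < N0) p i.+1 * z.
    apply: ler_sum => i _; rewrite ler_wpM2l// exprS ler_piMr// exprn_ile1//.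
    by rewrite invf_le1// ler1n.
  rewrite -mulr_suml.
  have := trunc1_le1 pge0 p1 N0.+1; rewrite trunc1E big_nat_recl//= /phi /z.
  move: (\sum_(0 <= i < N0) p i.+1) (\sum_(0 <= i < N0) _) => u v; lra.
have Az0 : 0 <= A.[z].
  have -> : A.[z] = pairing (fun i => z ^+ i) A by rewrite horner_coef.
  by apply: pairing_ge0 => // i; rewrite exprn_ge0.
have step : \sum_(0 <= s < N0.+1) conv_power p m s <= 2 ^+ N0 * A.[z] ^+ m.
  rewrite -horner_exp.
  have -> : (A ^+ m).[z] = pairing (fun i => z ^+ i) (A ^+ m) by rewrite horner_coef.
  pose K := maxn N0.+1 (size (A ^+ m)).
  rewrite (@pairing_wide _ _ _ K) ?leq_maxr// mulr_sumr.
  rewrite -(big_mkord xpredT (fun i => 2 ^+ N0 * ((A ^+ m)`_i * z ^+ i))).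
  rewrite [leRHS](big_cat_nat (leq0n N0.+1) (leq_maxl _ _))/=.
  have Am0 := nneg_polyX m A0.
  apply: le_trans (_ : _ <= \sum_(0 <= i < N0.+1) 2 ^+ N0 * ((A ^+ m)`_i * z ^+ i)) _; last first.
    rewrite lerDl; apply: sumr_ge0 => i _.
    by apply: mulr_ge0; [exact: exprn_ge0|apply: mulr_ge0; [exact: Am0|exact: exprn_ge0]].
  rewrite big_nat_cond [leRHS]big_nat_cond; apply: ler_sum => i /andP[/andP[_ iN] _].
  rewrite coef_exp_trunc// mulrCA ler_peMr//; first exact: conv_power_ge0.
  rewrite ltnS in iN; rewrite -(subnKC iN) exprD mulrAC -exprMn /z divff ?gt_eqF//.
  by rewrite expr1n mul1r exprn_ege1// ler1n.
apply: le_trans step _.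
apply: (@le_trans _ _ (2 ^+ N0 * phi ^+ m)).
  by apply: ler_wpM2l; [exact: exprn_ge0|rewrite lerXn2r ?nnegrE// ltW].
rewrite -(subnKC qN0m) exprD exprM mulrA -exprMn.
have g1 : 2 * phi ^+ q <= 1 by rewrite -ler_pdivlMl// mulr1.
have g0 : 0 <= 2 * phi ^+ q by rewrite mulr_ge0// exprn_ge0// ltW.
apply: (@le_trans _ _ (phi ^+ (m - q * N0))).
  by rewrite ler_piMl ?exprn_ile1// exprn_ge0// ltW.
by rewrite subnKC// ler_wiXn2l// ?ltW.
Qed.

End iid_bounds.

Lemma sum_sqr_le (R : realDomainType) I (r : seq I) (F : I -> R) :
  \sum_(i <- r) F i ^+ 2 <= (\sum_(i <- r) `|F i|) ^+ 2.
Proof.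
elim: r => [|i r IHr]; first by rewrite !big_nil expr0n.
rewrite !big_cons -[F i ^+ 2]real_normK ?num_real//.
have : 0 <= \sum_(j <- r) `|F j| by apply: sumr_ge0.
move: IHr (normr_ge0 (F i)); move: `|F i| (\sum_(j <- r) F j ^+ 2).
move: (\sum_(j <- r) `|F j|) => x y z; nra.
Qed.

Section block_estimates.
Context {R : realType} {T : pointedMetricType R}.

Lemma measurable_cfg_countR (B : set T) : measurable (B : set (borel T)) ->
  measurable_fun [set: config T] (fun xi => (cfg_count B xi)%:R : R).
Proof.
move=> mB; apply: (measurableT_comp (f := fun k : nat => k%:R : R)) => //.
exact: measurable_cfg_count.
Qed.

Lemma measurable_massR :
  measurable_fun [set: config T] (fun xi => (mass xi)%:R : R).
Proof.
apply: (measurableT_comp (f := fun k : nat => k%:R : R)) => //.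
exact: measurable_mass.
Qed.

Lemma integ_cfg_count_sqr (Q : probability (config T) R) (B : set T) (c : R) :
  (factorial_moment Q 3 < +oo)%E -> measurable (B : set (borel T)) ->
  let y xi := (cfg_count B xi)%:R - (mass xi)%:R * c in
  [/\ integ Q y, integ Q (fun xi => y xi ^+ 2) &
      integ Q (fun xi => (cfg_count B xi)%:R ^+ 2)].
Proof.
move=> fin3 mB y.
have mc := measurable_cfg_countR mB; have mm := measurable_massR.
have my : measurable_fun [set: config T] y.
  by apply: measurable_funB => //; apply: measurable_funM.
have cm xi : (cfg_count B xi)%:R <= (mass xi)%:R :> R.
  by rewrite ler_nat cfg_count_le_mass.
have ym xi : `|y xi| <= (1 + `|c|) * (mass xi)%:R.
  apply: le_trans (ler_normB _ _) _; rewrite normrM !normr_nat mulrDl mul1r.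
  by rewrite lerD// mulrC.
split.
- apply: (integ_le my ym); apply: integZ.
  by have := integ_mass_pow (isT : (1 <= 3)%N) fin3; under eq_fun do rewrite expr1.
- apply: (integ_le (g := fun xi => (1 + `|c|) ^+ 2 * (mass xi)%:R ^+ 2)).
  + exact: measurable_funX.
  + by move=> xi; rewrite normrX -exprMn lerXn2r ?nnegrE ?mulr_ge0 ?addr_ge0.
  + by apply: integZ; exact: integ_mass_pow.
- apply: (integ_le (g := fun xi => (mass xi)%:R ^+ 2)).
  + exact: measurable_funX.
  + by move=> xi; rewrite ger0_norm ?exprn_ge0// lerXn2r ?nnegrE.
  + exact: integ_mass_pow.
Qed.

Lemma cfg_count_pp_sum d (W : measurableType d)
    (Xi : nat -> {mfun W >-> config T}) k (B : set T) w :
  cfg_count B (pp_sum Xi k w) = (\sum_(j < k) cfg_count B (Xi j w))%N.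
Proof. exact: cfg_count_big. Qed.

(* Some block carries at most the average share of the second moment, and the
   count of that block is then too concentrated to have only small atoms. *)
Lemma block_share_le d (W : measurableType d) (P : probability W R)
    (Xi : nat -> {mfun W >-> config T}) (Q : probability (config T) R) n k
    m (cell : T -> 'I_m) (t : 'I_m -> T) (r tau M2 : R) :
  iid_with_law P n Xi Q -> (k <= n)%N -> (factorial_moment Q 3 < +oo)%E ->
  EV Q (fun xi => (mass xi)%:R ^+ 2) <= M2 -> 0 < M2 ->
  measurable_cells cell -> (0 < m)%N ->
  0 < r -> r ^+ 2 * n%:R = (size (centers t))%:R ->
  (forall i j, fine (P [set w |
     cfg_count (block cell t (t i)) (pp_sum Xi k w) = j]) <= tau) ->
  Num.min r 1 <= 4 * (Num.sqrt (2 * M2) + 1) * tau.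
Proof.
move=> iid kn fin3 EM2 M20 mcell m0 r0 rL Ptau.
pose ys := centers t; set L := size (centers t) in rL.
have mb y := measurable_block t y mcell.
pose v y := EV Q (fun xi => (cfg_count (block cell t y) xi)%:R ^+ 2).
have Iv y : integ Q (fun xi => (cfg_count (block cell t y) xi)%:R ^+ 2).
  by have [] := integ_cfg_count_sqr 0 fin3 (mb y).
have sv : \sum_(y <- ys) v y <= M2.
  apply: le_trans EM2; rewrite /v -(EV_sum ys Iv); apply: EV_le.
  - exact: integ_sum.
  - exact: integ_mass_pow.
  move=> xi; apply: le_trans (sum_sqr_le _ _) _.
  under eq_bigr do rewrite ger0_norm//.
  by rewrite -natr_sum sum_cfg_count_blocks.
have tys i : t i \in ys by rewrite mem_undup; apply: map_f; rewrite mem_enum.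
have L0 : (0 < L)%N.
  by have := tys (Ordinal m0); rewrite /ys /L; case: (centers t).
have [y yys vy] : exists2 y, y \in ys & v y * L%:R <= M2.
  apply: contrapT => H.
  have H' y : y \in ys -> M2 / L%:R < v y.
    move=> yys; rewrite ltr_pdivrMr ?ltr0n// ltNge; apply/negP => vy.
    by apply: H; exists y.
  have : \sum_(y <- ys) (M2 / L%:R) < \sum_(y <- ys) v y.
    rewrite big_seq [ltRHS]big_seq; apply: ltr_sum => //.
    by apply/hasP; exists (t (Ordinal m0)) => //; exact: tys.
  rewrite big_const_seq count_predT iter_addr_0 -/L -[_ *+ L]mulr_natr.
  by rewrite divfK ?pnatr_eq0 -?lt0n// ltNge sv.
have [i ty] : exists i, y = t i.
  by move: yys; rewrite mem_undup => /mapP[i _ ->]; exists i.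
pose l := EV Q (fun xi => (cfg_count (block cell t y) xi)%:R).
pose y0 (xi : config T) : R := (cfg_count (block cell t y) xi)%:R - l.
have I1 : integ Q (fun xi => (cfg_count (block cell t y) xi)%:R).
  by have [] := mean_measureE fin3 (mb y).
have my0 : measurable_fun [set: config T] y0.
  by apply: measurable_funB => //; exact: measurable_cfg_countR.
have y0E : (fun xi => y0 xi ^+ 2) = (fun xi =>
    (cfg_count (block cell t y) xi)%:R ^+ 2
    + (- (2 * l)) * (cfg_count (block cell t y) xi)%:R + l ^+ 2).
  by apply/funext => xi; rewrite /y0; ring.
have Iy01 := integB I1 (integ_cst Q l).
have Iy02 : integ Q (fun xi => y0 xi ^+ 2).
  rewrite y0E; apply: integD; last exact: integ_cst.
  by apply: integD; [exact: Iv|exact: integZ].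
have Ey01 : EV Q y0 = 0 by rewrite EVB ?EV_cst ?subrr//; exact: integ_cst.
have Ey02 : EV Q (fun xi => y0 xi ^+ 2) <= v y.
  rewrite y0E EVD; [|by apply: integD; [exact: Iv|exact: integZ]|exact: integ_cst].
  rewrite EVD; [|exact: Iv|exact: integZ].
  by rewrite EVZ// EV_cst -/l -/(v y); have := sqr_ge0 l; lra.
have [IS ES] := iid_second_moment iid kn my0 Iy02 Iy01.
have SE w : \sum_(j < k) y0 (Xi j w) =
    (cfg_count (block cell t y) (pp_sum Xi k w))%:R - k%:R * l.
  by rewrite cfg_count_pp_sum natr_sum /y0 sumrB sumr_const card_ord mulr_natl.
have SE2 : (fun w => (\sum_(j < k) y0 (Xi j w)) ^+ 2) = (fun w =>
    ((cfg_count (block cell t y) (pp_sum Xi k w))%:R - k%:R * l) ^+ 2).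
  by apply/funext => w; rewrite SE.
rewrite SE2 in IS; rewrite SE2 Ey01 mulr0 expr0n addr0 in ES.
set A := Num.sqrt (2 * M2).
have A2 : A ^+ 2 = 2 * M2 by rewrite sqr_sqrtr// mulr_ge0// ltW.
have A0 : 0 < A by rewrite sqrtr_gt0 mulr_gt0.
set s := Num.min r 1; have s0 : 0 < s by rewrite lt_min r0 ltr01.
have sr : s <= r by rewrite ge_min lexx.
have s1 : s <= 1 by rewrite ge_min lexx orbT.
have n0 : 0 < n%:R :> R.
  rewrite ltr0n lt0n; apply/eqP => n0; move: rL; rewrite n0 mulr0 => /esym/eqP.
  by rewrite pnatr_eq0 -leqn0 leqNgt L0.
have mN : measurable_fun [set: W]
    (fun w => cfg_count (block cell t y) (pp_sum Xi k w)).
  apply: measurableT_comp; first exact: measurable_cfg_count.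
  exact: measurable_pp_sum.
(* The deviation is A / s: the variance is at most n M2 / L = M2 / r^2 <= M2 / s^2, half the square
   of A / s. Multiplying the resulting inequality by s and using s <= 1 gives the claim. *)
have bound : 1 <= 4 * (A / s + 1) * tau.
  apply: (concentrated_atom mN (divr_gt0 A0 s0) IS) => [|j]; last first.
    by rewrite ty; exact: Ptau.
  apply: le_trans ES _; apply: le_trans (ler_wpM2l (ler0n _ _) Ey02) _.
  have -> : (A / s) ^+ 2 / 2 = M2 / s ^+ 2.
    by rewrite expr_div_n A2; field; rewrite gt_eqF.
  rewrite ler_pdivlMr ?exprn_gt0//.
  have v0 : 0 <= v y by apply: EV_ge0 => xi; rewrite exprn_ge0.
  have kn' : k%:R <= n%:R :> R by rewrite ler_nat.
  have s2 : s ^+ 2 <= r ^+ 2 by rewrite lerXn2r ?nnegrE// ltW.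
  apply: (@le_trans _ _ (n%:R * v y * r ^+ 2)).
    apply: ler_pM => //; first by rewrite mulr_ge0.
      by rewrite exprn_ge0// ltW.
    by rewrite ler_wpM2r.
  by move: vy; rewrite -rL; lra.
have tau0 : 0 <= tau by apply: le_trans (Ptau i 0%N); rewrite fine_ge0.
have -> : s = s * 1 by rewrite mulr1.
apply: (le_trans (ler_wpM2l (ltW s0) bound)).
rewrite mulrA ler_wpM2r// mulrCA ler_wpM2l// mulrDr mulr1 lerD//.
by rewrite mulrCA divff ?mulr1// gt_eqF.
Qed.

End block_estimates.

(** * Comparison of the laws *)

(** The weight s = 1/r balances the first two terms: L s = r n, while M / s is r M with M of order
    n. *)
Lemma block_deviation_weights (R : realFieldType) (n t1 r L D M : R) :
  0 < n -> 0 < t1 -> 0 < r -> r ^+ 2 * n = L -> 0 <= D -> n * t1 / 2 <= M ->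
  M^-1 * (L * r^-1 + M / r^-1 / 2 + D / r^-1 / 2) <=
  2 * r / t1 + r / 2 + r / (n * t1) * D.
Proof.
move=> n0 t0 r0 <- D0 Mlarge; rewrite invrK.
have nt0 : 0 < n * t1 by exact: mulr_gt0.
have M0 : 0 < M by apply: lt_le_trans Mlarge; rewrite divr_gt0.
have Minv : M^-1 <= 2 / (n * t1).
  by rewrite -[leRHS]invrK lef_pV2 ?posrE ?invr_gt0 ?divr_gt0// invf_div.
have -> : M^-1 * (r ^+ 2 * n * r^-1 + M * r / 2 + D * r / 2)
    = M^-1 * (r * n + D * r / 2) + r / 2.
  by field; rewrite !gt_eqF.
have -> : 2 * r / t1 + r / 2 + r / (n * t1) * D
    = 2 / (n * t1) * (r * n + D * r / 2) + r / 2.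
  by field; rewrite !gt_eqF.
rewrite lerD2r ler_wpM2r// addr_ge0 ?mulr_ge0//; exact: ltW.
Qed.

(** Where the mass is below half its mean u, the trivial bound 4 on the difference of two values of
    size at most 2 is charged to the squared deviation. *)
Lemma small_mass_weight (R : realFieldType) (u M : R) :
  0 < u -> M < u / 2 -> 4 <= 16 / u ^+ 2 * (M - u) ^+ 2.
Proof.
move=> u0 Mu; rewrite mulrAC ler_pdivlMr ?exprn_gt0//.
have h : u <= 2 * (u - M) by lra.
have : u ^+ 2 <= (2 * (u - M)) ^+ 2 by rewrite lerXn2r// nnegrE; lra.
by rewrite !expr2; lra.
Qed.

(** The squared deviation of the mass leaves a term of order 1/n; n r >= 1, true because (n r)^2 = n
    L, turns it into r. *)
Lemma deviation_scaling (R : realFieldType) (n t1 r M2 g : R) :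
  0 < t1 -> 0 <= M2 -> 0 < r -> 1 <= n -> 1 <= n * r ->
  16 / (n * t1) ^+ 2 * (n * M2) + (2 * r / t1 + r / 2)
    + r / (n * t1) * (n * (4 * M2) + g ^+ 2) <=
  r * (16 * M2 / t1 ^+ 2 + 2 / t1 + 1 / 2 + (4 * M2 + g ^+ 2) / t1).
Proof.
move=> t0 M0 r0 n1 nr1.
have n0 : 0 < n by lra.
have h1 : 16 / (n * t1) ^+ 2 * (n * M2) <= r * (16 * M2 / t1 ^+ 2).
  rewrite (_ : _ * (n * M2) = n^-1 * (16 * M2 / t1 ^+ 2)); last first.
    by field; rewrite !gt_eqF.
  rewrite ler_wpM2r ?divr_ge0 ?mulr_ge0 ?exprn_ge0 ?(ltW t0)//.
  by rewrite -[leLHS]mul1r ler_pdivrMr// mulrC.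
have h2 : r / (n * t1) * (n * (4 * M2) + g ^+ 2) <= r * ((4 * M2 + g ^+ 2) / t1).
  rewrite (_ : _ * (_ + g ^+ 2) = r * ((4 * M2 + g ^+ 2 / n) / t1)); last first.
    by field; rewrite !gt_eqF.
  rewrite ler_wpM2l ?(ltW r0)// ler_wpM2r ?invr_ge0 ?(ltW t0)//.
  by rewrite lerD2l ler_pdivrMr// ler_peMr ?sqr_ge0.
lra.
Qed.
(** The pointwise comparison with a sample of equal mass is averaged over the sum. The squared block
    deviations have total mean at most 4 n M2 + g^2, with no dependence on L: variances add up to at
    most 4 n M2, and the bias of the blocks, at most g / n in total for one process, contributes
    g^2. L enters through r only. *)
Lemma relocated_mean_gap (R : realType) (T : pointedMetricType R)
    d (W : measurableType d) (P : probability W R)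
    d' (W' : measurableType d') (P' : probability W' R)
    (Xi : nat -> {mfun W >-> config T}) (U : nat -> {mfun W' >-> borel T})
    (Q : probability (config T) R) n m (cell : T -> 'I_m) (t : 'I_m -> T)
    (f : config T -> R) (mu : T -> R) (r g : R) :
  (forall x y : T, mdist x y <= 1) -> measurable_cells cell -> (0 < m)%N ->
  (forall j y, P' (U j @^-1` block cell t y) = (mu y)%:E) ->
  (forall k (A : 'I_k -> set (borel T)), (forall j, measurable (A j)) ->
     P' (\bigcap_(j in [set: 'I_k]) (U j @^-1` A j)) =
     \prod_(j < k) P' (U j @^-1` A j))%E ->
  (forall xi eta, `|f xi - f eta| <= d1 xi eta) -> (forall xi, `|f xi| <= 2) ->
  iid_with_law P n Xi Q -> (0 < n)%N -> (factorial_moment Q 3 < +oo)%E ->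
  0 < theta Q 1 ->
  \sum_(y <- centers t) `|EV Q (fun xi => (cfg_count (block cell t y) xi)%:R)
     - theta Q 1 * mu y| <= g / n%:R ->
  0 < r -> r ^+ 2 * n%:R = (size (centers t))%:R ->
  `|EV P (fun w => f (relocate (t \o cell) (pp_sum Xi n w)))
    - EV P (fun w => EV P' (fun w' =>
        f (relocate (t \o cell) (point_sum U (mass (pp_sum Xi n w)) w'))))| <=
  r * (16 * (theta Q 2 + theta Q 1) / theta Q 1 ^+ 2 + 2 / theta Q 1 + 1 / 2
       + (4 * (theta Q 2 + theta Q 1) + g ^+ 2) / theta Q 1).
Proof.
move=> d0_le1 mcell m0 PU indU fL f2 iid n0 fin3 t10 gap r0 rL.
pose F k := EV P' (fun w => f (relocate (t \o cell) (point_sum U k w))).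
set M2 := theta Q 2 + theta Q 1.
rewrite [X in _ - X](_ : _ = EV P (fun w => F (mass (pp_sum Xi n w))))//.
set t1 := theta Q 1 in t10 gap *; set ys := centers t in gap *.
set L := size ys in rL.
have mb y := measurable_block t y mcell.
have nR0 : 0 < n%:R :> R by rewrite ltr0n.
have L0 : (0 < L)%N.
  have : t (Ordinal m0) \in ys by rewrite mem_undup; apply: map_f; rewrite mem_enum.
  by rewrite /L /ys; case: (centers t).
have [tM1 tM2 _] := theta_moments fin3.
have M20 : 0 <= M2 by rewrite /M2 -tM2; apply: EV_ge0 => xi; rewrite exprn_ge0.
have smu : \sum_(y <- ys) mu y = 1 := sum_block_probability mcell (PU 0%N).
have mu0 y : 0 <= mu y by rewrite -lee_fin -(PU 0%N).
have mFn (k : nat -> R) : measurable_fun [set: W] (fun w => k (mass (pp_sum Xi n w))).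
  apply: (measurableT_comp (g := fun w => mass (pp_sum Xi n w))) => //.
  by apply: measurableT_comp; [exact: measurable_mass|exact: measurable_pp_sum].
have mfr : measurable_fun [set: W] (fun w => f (relocate (t \o cell) (pp_sum Xi n w))).
  apply: (measurableT_comp (f := fun xi => f (relocate (t \o cell) xi))).
    exact: measurable_relocated.
  exact: measurable_pp_sum.
have F2 k : `|F k| <= 2.
  have mk := measurable_relocate_point_sum f t U k mcell.
  have Ik : integ P' (fun w => f (relocate (t \o cell) (point_sum U k w))).
    by apply: (@integ_bounded _ _ _ _ _ 2) => //; exact: mk.
  apply: le_trans (EV_norm Ik) _; rewrite -[leRHS](EV_cst P' 2).
  by apply: EV_le => //; [exact: integ_norm|exact: integ_cst].
have IF : integ P (fun w => F (mass (pp_sum Xi n w))).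
  by apply: (@integ_bounded _ _ _ _ _ 2) => //; exact: mFn.
have If : integ P (fun w => f (relocate (t \o cell) (pp_sum Xi n w))).
  by apply: (@integ_bounded _ _ _ _ _ 2) => //; exact: mfr.
pose D y (w : W) : R :=
  ((cfg_count (block cell t y) (pp_sum Xi n w))%:R
   - (mass (pp_sum Xi n w))%:R * mu y) ^+ 2.
pose S (w : W) : R := ((mass (pp_sum Xi n w))%:R - n%:R * t1) ^+ 2.
pose y1 (xi : config T) : R := (mass xi)%:R - t1.
have I1 : integ Q (fun xi => (mass xi)%:R).
  by have := integ_mass_pow (isT : (1 <= 3)%N) fin3; under eq_fun do rewrite expr1.
have E1 : EV Q (fun xi => (mass xi)%:R) = t1.
  by rewrite /t1 -tM1; apply: EV_eq => xi; rewrite expr1.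
have I2 := integ_mass_pow (isT : (2 <= 3)%N) fin3.
have y1E : (fun xi => y1 xi ^+ 2) = (fun xi =>
    (mass xi)%:R ^+ 2 + (- (2 * t1)) * (mass xi)%:R + t1 ^+ 2).
  by apply/funext => xi; rewrite /y1; ring.
have Iy1 : integ Q y1 by apply: integB => //; exact: integ_cst.
have Iy12 : integ Q (fun xi => y1 xi ^+ 2).
  rewrite y1E; apply: integD; last exact: integ_cst.
  by apply: integD => //; exact: integZ.
have Ey1 : EV Q y1 = 0 by rewrite EVB ?EV_cst ?E1 ?subrr//; exact: integ_cst.
have Ey12 : EV Q (fun xi => y1 xi ^+ 2) <= M2.
  rewrite y1E EVD; [|by apply: integD => //; exact: integZ|exact: integ_cst].
  rewrite EVD//; last exact: integZ.
  by rewrite EVZ// EV_cst E1 tM2 -/t1 -/M2; have := sqr_ge0 t1; lra.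
have my1 : measurable_fun [set: config T] y1.
  by apply: measurable_funB => //; exact: measurable_massR.
have [IS ES] := iid_second_moment iid (leqnn n) my1 Iy12 Iy1.
have SE : (fun w => (\sum_(j < n) y1 (Xi j w)) ^+ 2) = S.
  apply/funext => w; rewrite /S mass_pp_sum natr_sum /y1 sumrB sumr_const.
  by rewrite card_ord mulr_natl.
rewrite SE in IS; rewrite SE Ey1 mulr0 expr0n addr0 in ES.
have {}ES : EV P S <= n%:R * M2 by apply: le_trans ES _; rewrite ler_wpM2l.
pose yb y (xi : config T) : R :=
  (cfg_count (block cell t y) xi)%:R - (mass xi)%:R * mu y.
pose e y := EV Q (yb y); pose v y := EV Q (fun xi => yb y xi ^+ 2).
have Ib y : integ Q (yb y) /\ integ Q (fun xi => yb y xi ^+ 2).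
  by have [] := integ_cfg_count_sqr (mu y) fin3 (mb y).
have myb y : measurable_fun [set: config T] (yb y).
  by have [/integ_measurable] := Ib y.
have DE y : (fun w => (\sum_(j < n) yb y (Xi j w)) ^+ 2) = D y.
  apply/funext => w; rewrite /D mass_pp_sum cfg_count_pp_sum !natr_sum /yb.
  by rewrite sumrB -mulr_suml.
have Dy y : integ P (D y) /\ EV P (D y) <= n%:R * v y + (n%:R * e y) ^+ 2.
  have [Ib1 Ib2] := Ib y; rewrite -DE.
  exact: (iid_second_moment iid (leqnn n) (myb y) Ib2 Ib1).
(* Each square is at most twice the sum of two squares, and a sum of squares of nonnegative numbers
   is at most the square of their sum: the mass squared for the counts, 1 for the block
   probabilities. *)
have sv : \sum_(y <- ys) v y <= 4 * M2.
  have I42 := integZ 4 I2.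
  rewrite /M2 -tM2 -(EVZ 4 I2) /v -EV_sum; last by move=> y; case: (Ib y).
  apply: EV_le => //; first by apply: integ_sum => y; case: (Ib y).
  move=> xi; pose a y : R := (cfg_count (block cell t y) xi)%:R.
  have sa : \sum_(y <- ys) `|a y| = (mass xi)%:R.
    rewrite -(sum_cfg_count_blocks cell t xi) natr_sum.
    by apply: eq_bigr => y _; rewrite ger0_norm.
  have := sum_sqr_le ys a; rewrite sa => a2.
  have := sum_sqr_le ys mu; under [X in _ <= X ^+ 2]eq_bigr do rewrite ger0_norm//.
  rewrite smu expr1n => mu2.
  apply: (@le_trans _ _ (\sum_(y <- ys)
     (2 * a y ^+ 2 + (2 * (mass xi)%:R ^+ 2) * mu y ^+ 2))).
    apply: ler_sum => y _; rewrite /yb -/(a y).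
    have := sqr_ge0 (a y + (mass xi)%:R * mu y).
    move: (a y) ((mass xi)%:R : R) (mu y) => p q s.
    by lra.
  rewrite big_split/= -!mulr_sumr.
  have : 0 <= 2 * (mass xi)%:R ^+ 2 :> R by rewrite mulr_ge0// exprn_ge0.
  move/(ler_wpM2l) => /(_ _ _ mu2); move: a2; lra.
have se : \sum_(y <- ys) (n%:R * e y) ^+ 2 <= g ^+ 2.
  apply: le_trans (sum_sqr_le _ _) _.
  have eE y : `|n%:R * e y| = n%:R *
      `|EV Q (fun xi => (cfg_count (block cell t y) xi)%:R) - t1 * mu y|.
    rewrite normrM normr_nat; congr (_ * `|_|); rewrite /e /yb.
    have [Ic _] := mean_measureE fin3 (mb y).
    rewrite EVB//; last by under eq_fun do rewrite mulrC; exact: integZ.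
    congr (_ - _); under eq_fun do rewrite mulrC.
    by rewrite EVZ// E1 mulrC.
  rewrite (eq_bigr _ (fun y _ => eE y)) -mulr_sumr.
  have ng : n%:R * \sum_(y <- ys)
      `|EV Q (fun xi => (cfg_count (block cell t y) xi)%:R) - t1 * mu y| <= g.
    by rewrite mulrC -ler_pdivlMr.
  rewrite lerXn2r// nnegrE ?mulr_ge0 ?sumr_ge0//.
  by apply: le_trans ng; rewrite mulr_ge0// sumr_ge0.
have ED : EV P (fun w => \sum_(y <- ys) D y w) <= n%:R * (4 * M2) + g ^+ 2.
  rewrite EV_sum; last by move=> y; case: (Dy y).
  apply: le_trans (ler_sum _ (fun y _ => proj2 (Dy y))) _.
  by rewrite big_split/= -mulr_sumr lerD// ler_wpM2l.
have ID : integ P (fun w => \sum_(y <- ys) D y w).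
  by apply: integ_sum => y; case: (Dy y).
pose cS : R := 16 / (n%:R * t1) ^+ 2.
pose cD : R := r / (n%:R * t1).
pose c0 : R := 2 * r / t1 + r / 2.
have nt0 : 0 < n%:R * t1 by rewrite mulr_gt0.
have cS0 : 0 <= cS by rewrite divr_ge0// exprn_ge0// ltW.
have cD0 : 0 <= cD by rewrite divr_ge0// ltW.
have c00 : 0 <= c0 by rewrite addr_ge0// divr_ge0// ?mulr_ge0// ltW.
have bnd w : `|f (relocate (t \o cell) (pp_sum Xi n w)) - F (mass (pp_sum Xi n w))|
    <= cS * S w + c0 + cD * \sum_(y <- ys) D y w.
  have D0 : 0 <= \sum_(y <- ys) D y w by apply: sumr_ge0 => y _; exact: sqr_ge0.
  have S0 : 0 <= S w by exact: sqr_ge0.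
  set x := pp_sum Xi n w; pose M : R := (mass x)%:R.
  have [Mlarge|Msmall] := leP (n%:R * t1 / 2) M; last first.
    apply: (@le_trans _ _ 4).
      apply: le_trans (ler_normB _ _) _; rewrite (_ : 4 = 2 + 2 :> R); last by ring.
      exact: lerD.
    apply: le_trans (small_mass_weight nt0 Msmall) _.
    by rewrite -addrA lerDl addr_ge0// mulr_ge0.
  have M0 : 0 < M by apply: lt_le_trans Mlarge; rewrite divr_gt0.
  have Mx : (0 < mass x)%N by rewrite -(ltr0n R).
  have s0 : 0 < r^-1 by rewrite invr_gt0.
  apply: (le_trans (relocated_gap_le d0_le1 mcell PU indU fL f2 s0 Mx)).
  rewrite -[cS * _ + _ + _]addrA -[leLHS]add0r; apply: lerD; first by rewrite mulr_ge0.
  exact: block_deviation_weights.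
have IR : integ P (fun w => cS * S w + c0 + cD * \sum_(y <- ys) D y w).
  apply: integD; last exact: integZ.
  by apply: integD; [exact: integZ|exact: integ_cst].
rewrite -EVB//; apply: le_trans (EV_norm (integB If IF)) _.
apply: (le_trans (EV_le (integ_norm (integB If IF)) IR bnd)).
rewrite EVD; [|by apply: integD; [exact: integZ|exact: integ_cst]|exact: integZ].
rewrite EVD; [|exact: integZ|exact: integ_cst].
rewrite !EVZ// EV_cst.
have nr1 : 1 <= n%:R * r.
  have L1 : 1 <= L%:R :> R by rewrite ler1n.
  have n1 : 1 <= n%:R :> R by rewrite ler1n.
  have : 1 <= (n%:R * r) ^+ 2.
    rewrite exprMn expr2 -mulrA [n%:R * r ^+ 2]mulrC rL.
    by rewrite -[leLHS]mulr1 ler_pM.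
  by rewrite expr_ge1// mulr_ge0// ltW.
apply: le_trans (deviation_scaling _ t10 M20 r0 _ nr1); last by rewrite ler1n.
by apply: lerD; [rewrite lerD2r ler_wpM2l|rewrite ler_wpM2l].
Qed.

(** The factor of V is at most a constant times a + n (1 + beta n), hence O(a). The last term
    carries only beta n, one power of n less, and after division by a it leaves 1/n. *)
Lemma stein_remainder_le (R : realFieldType) (a b beta n c M1 M2 M3 mu V : R) :
  0 < c -> 0 <= b <= 1 -> 0 <= beta -> 2 <= n -> c * (n * (1 + beta * n)) <= a ->
  0 <= M1 <= mu -> 0 <= M2 <= mu -> 0 <= M3 <= mu -> 0 <= V ->
  a^-1 * (V * (a * (M2 * 1 + 1 * M2) + (b + 1) * n * (M3 * 1 + M1 * M2)
               + beta * n * (n - 1) * (M3 * M1 + M1 * M3))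
          + 2 * (beta * n * (M3 * 1 + M2 * M1)))
  <= (2 * mu + 2 * (mu + mu ^+ 2) / c) * (V + n^-1).
Proof.
move=> c0 /andP[b0 b1] be0 n2 ca /andP[M10 M1l] /andP[M20 M2l] /andP[M30 M3l] V0.
have n0 : 0 < n by lra.
have bn0 : 0 <= beta * n by rewrite mulr_ge0// ltW.
have N0 : 0 < n * (1 + beta * n) by rewrite mulr_gt0//; lra.
have a0 : 0 < a by apply: lt_le_trans ca; exact: mulr_gt0.
have Na : n * (1 + beta * n) <= a / c by rewrite ler_pdivlMr// mulrC.
have mu0 : 0 <= mu by exact: le_trans M1l.
have P x y : 0 <= x <= mu -> 0 <= y <= mu -> 0 <= x * y <= mu ^+ 2.
  by move=> /andP[? ?] /andP[? ?]; rewrite mulr_ge0//= expr2 ler_pM.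
have /andP[P12 Q12] := P M1 M2 (introT andP (conj M10 M1l)) (introT andP (conj M20 M2l)).
have /andP[P13 Q13] := P M1 M3 (introT andP (conj M10 M1l)) (introT andP (conj M30 M3l)).
clear P; rewrite !mulr1 mul1r (mulrC M2 M1) (mulrC M3 M1).
move: (M1 * M2) (M1 * M3) (mu ^+ 2) (sqr_ge0 mu) P12 Q12 P13 Q13 => p12 p13 mu2 mu20 P12 Q12 P13 Q13.
have nu0 : 0 <= mu + mu2 by rewrite addr_ge0.
have r1 : beta * n * (M3 + p12) <= beta * n * (mu + mu2).
  by rewrite ler_wpM2l// lerD.
have b2 : (b + 1) * n <= 2 * n by rewrite ler_wpM2r ?(ltW n0)//; lra.
have b1n : 0 <= (b + 1) * n by rewrite mulr_ge0 ?(ltW n0)//; lra.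
have n10 : 0 <= n - 1 by lra.
have r2 : a * (M2 + M2) + (b + 1) * n * (M3 + p12) + beta * n * (n - 1) * (p13 + p13)
   <= a * (2 * mu) + n * (1 + beta * n) * (2 * (mu + mu2)).
  have e1 : a * (M2 + M2) <= a * (2 * mu).
    by rewrite ler_wpM2l ?(ltW a0)// mulr_natl mulr2n lerD.
  have e2 : (b + 1) * n * (M3 + p12) <= 2 * n * (mu + mu2).
    by apply: ler_pM => //; [rewrite addr_ge0|rewrite lerD].
  have e3 : beta * n * (n - 1) * (p13 + p13) <= beta * n * n * (2 * (mu + mu2)).
    apply: ler_pM.
    - exact: mulr_ge0.
    - exact: addr_ge0.
    - by rewrite ler_wpM2l// lerBlDr lerDl.
    by rewrite mulr_natl mulr2n lerD// (le_trans Q13)// lerDr.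
  rewrite [n * (1 + _)](_ : _ = n + beta * n * n); last by ring.
  move: e1 e2 e3; move: (a * _) (a * _) (_ * _ * (M3 + _)) (beta * n * _ * (p13 + _)).
  by rewrite [(n + _) * _]mulrDl; move: (mu + mu2) (beta * n * n * _); clear => *; lra.
set nu := mu + mu2 in nu0 r1 r2 *.
have r3 : n * (1 + beta * n) * (2 * nu) <= a * (2 * nu / c).
  apply: le_trans (ler_wpM2r _ Na) _; first by rewrite mulr_ge0.
  by rewrite le_eqVlt; apply/orP; left; apply/eqP; field; rewrite gt_eqF.
have r4 : 2 * (beta * n * nu) <= a * (2 * nu / c) / n.
  rewrite ler_pdivlMr//; apply: le_trans r3.
  have := mulr_ge0 (ltW n0) nu0; move: (mulr_ge0 nu0 (mulr_ge0 bn0 (ltW n0))).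
  by rewrite !mulrDr mulrDl; lra.
have K0 : 0 <= a * (2 * mu) / n by rewrite divr_ge0 ?mulr_ge0// ltW.
rewrite mulrC ler_pdivrMr//.
have r5 := ler_wpM2l V0 (le_trans r2 (lerD (lexx _) r3)).
rewrite [leRHS](_ : _ = V * (a * (2 * mu) + a * (2 * nu / c)) + a * (2 * nu / c) / n
   + a * (2 * mu) / n); last by ring.
by move: r1 r4 K0 r5; clear; lra.
Qed.

(** No summability of the weights is analysed: as the law of [Z], the normalised weights add up to
    1, which excludes the default case of a normalising constant equal to 0. *)
Lemma pbd_law_weights (R : realType) d (W : measurableType d) (P : probability W R)
    (Z : {mfun W >-> nat}) (a b beta : R) :
  0 < a -> 0 <= b -> 0 <= beta ->
  (forall i, P (Z @^-1` [set i]) = (pbd a b beta i)%:E) ->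
  [/\ forall i, 0 < pbd a b beta i,
      forall i, pbd a b beta i.+1 * death beta i.+1 = pbd a b beta i * birth a b i &
      series (pbd a b beta) @ \oo --> (1 : R)].
Proof.
move=> a0 b0 be0 PZ.
have q1 : series (pbd a b beta) @ \oo --> (1 : R).
  have := EV_nat_cvg (measurable_funP Z) (fun=> ler01) (integ_cst P 1).
  rewrite (_ : EV P _ = 1); last exact: EV_cst.
  rewrite (_ : (fun j => fine _ * 1) = pbd a b beta)//.
  by apply/funext => j; rewrite PZ mulr1.
have f0 (j : nat) : 0 < (a + b * j%:R) / (j.+1%:R * (1 + beta * j%:R)).
  by rewrite divr_gt0 ?mulr_gt0 ?ltr0n ?ltr_pwDl ?mulr_ge0.
have w0 i : 0 < pbd_weight a b beta i by rewrite prodr_gt0.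
have L0 : limn (series (pbd_weight a b beta)) != 0.
  apply/eqP => L0; have : series (pbd a b beta) @ \oo --> (0 : R).
    rewrite (_ : series _ = fun=> 0); first exact: cvg_cst.
    by apply/funext => k; rewrite seriesEnat/= big1// => j _; rewrite /pbd L0 invr0 mulr0.
  by move=> /(cvg_unique (@Rhausdorff R) q1)/eqP; rewrite oner_eq0.
split=> // i.
  have q0 : 0 <= pbd a b beta i by rewrite -lee_fin -PZ.
  by rewrite lt_neqAle q0 andbT eq_sym mulf_neq0 ?invr_neq0// gt_eqF.
rewrite /pbd {1}/pbd_weight big_ord_recr/= -/(pbd_weight a b beta i) /death /birth.
move: (limn _) L0 (pbd_weight a b beta i) => L L0 w.
have ? : 0 <= i%:R :> R by [].
have ? : 0 <= beta * i%:R by rewrite mulr_ge0.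
rewrite -natr1 addrK; field; rewrite L0/=.
by apply/andP; split; apply: lt0r_neq0; lra.
Qed.

Lemma EV_mixed_sum_cvg (R : realType) (T : pointedMetricType R)
    d (W : measurableType d) (P : probability W R) (Z : {mfun W >-> nat})
    (U : nat -> {mfun W >-> borel T}) m (cell : T -> 'I_m) (t : 'I_m -> T)
    (f : config T -> R) (Pi : probability (config T) R) c :
  (forall (A : set nat) (m : nat) (B : 'I_m -> set (borel T)),
    (forall j, measurable (B j)) ->
    P (Z @^-1` A `&` \bigcap_(j in [set: 'I_m]) (U j @^-1` B j)) =
    (P (Z @^-1` A) * \prod_(j < m) P (U j @^-1` B j))%E) ->
  (forall A, measurable A -> P (mixed_sum Z U @^-1` A) = Pi A) ->
  measurable_cells cell -> (forall xi, 0 <= f xi <= c) ->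
  series (fun j => fine (P (Z @^-1` [set j]))
    * EV P (fun w => f (relocate (t \o cell) (point_sum U j w)))) @ \oo -->
  EV Pi (fun xi => f (relocate (t \o cell) xi)).
Proof.
move=> indep law mcell f0.
have mf := measurable_relocated f t mcell.
have If : integ Pi (fun xi => f (relocate (t \o cell) xi)).
  apply: (@integ_bounded _ _ _ _ _ c); first exact: mf.
  by move=> xi; have /andP[? ?] := f0 (relocate (t \o cell) xi); rewrite ger0_norm.
have [IM <-] := EV_comp (X := mixed_sum Z U : {mfun W >-> config T}) law If.
have fM0 w : 0 <= f (relocate (t \o cell) (mixed_sum Z U w)).
  by case/andP: (f0 (relocate (t \o cell) (mixed_sum Z U w))).
have := EV_fibers_cvg (measurable_funP Z) fM0 IM.
rewrite (_ : (fun j => EV P _) = (fun j => fine (P (Z @^-1` [set j]))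
    * EV P (fun w => f (relocate (t \o cell) (point_sum U j w)))))//.
by apply/funext => j; exact: EV_mixed_sum_fiber.
Qed.

Lemma EV_dist_le (R : realType) d (W : measurableType d) (P : probability W R)
    (f g : W -> R) c : integ P f -> integ P g ->
  (forall w, `|f w - g w| <= c) -> `|EV P f - EV P g| <= c.
Proof.
move=> If Ig fg; rewrite -EVB//; apply: le_trans (EV_norm (integB If Ig)) _.
rewrite -[leRHS](EV_cst P c).
by apply: EV_le => //; [exact: integ_norm (integB If Ig)|exact: integ_cst].
Qed.

Lemma theta_ge0 (R : realType) (T : pointedMetricType R)
    (Q : probability (config T) R) r : 0 <= theta Q r.
Proof.
by apply: fine_ge0; rewrite /factorial_moment unlock; apply: integral_ge0.
Qed.

Lemma partition_test_bound (R : realType) (T : pointedMetricType R)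
    (Q : probability (config T) R) (palm : R.-pker (borel T) ~> config T) (b : R) :
  compact [set: T] -> (forall x y : T, mdist x y <= 1) -> reduced_palm Q palm ->
  (factorial_moment Q 3 < +oo)%E -> 0 < theta Q 1 -> 0 <= b -> b < 1 ->
  exists C : R, 0 < C /\ forall n (beta a : R) d (W : measurableType d)
      (P : probability W R) (Xi : nat -> {mfun W >-> config T})
      (Pi : probability (config T) R),
    (2 <= n)%N -> 0 <= beta ->
    a = n%:R * ((1 - b) * theta Q 1 + beta * theta Q 2
          + beta * (n%:R - 1) * theta Q 1 ^+ 2) ->
    order1_coef a b beta n%:R 1 (theta Q 1) (theta Q 2 + theta Q 1)
        (theta Q 3 + 3 * theta Q 2 + theta Q 1) = 0 ->
    iid_with_law P n Xi Q ->
    pbd_process_law a b beta (pbd_mu Q palm beta n) Pi ->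
    forall eps m (G : 'I_m -> set T) (t : 'I_m -> T) (tau : R) (f : config T -> R),
    eps_partition eps G t -> TV P (pp_sum Xi (n - 2)) G t = tau%:E ->
    (forall xi eta, `|f xi - f eta| <= d1 xi eta) ->
    (forall xi, 0 <= f xi <= 2) ->
    `|EV P (fun w => f (pp_sum Xi n w)) - EV Pi f| <= 2 * eps + C * tau.
Proof.
move=> Tc d0_le1 palmP fin3 t10 b0 b1.
set t1 := theta Q 1 in t10 *; set t2 := theta Q 2; set t3 := theta Q 3.
have t20 : 0 <= t2 := theta_ge0 Q 2.
have t30 : 0 <= t3 := theta_ge0 Q 3.
pose M2 := t2 + t1; pose M3 := t3 + 3 * t2 + t1; pose mu := M2 + M3.
(* Chosen so that a >= c n (1 + beta n): the first entry comes from the part of [a] free of [beta],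
   the second from (n - 1) t1^2 >= n t1^2 / 2 for n >= 2. *)
pose c := Num.min ((1 - b) * t1) (t1 ^+ 2 / 2).
have c0 : 0 < c.
  by rewrite lt_min mulr_gt0 ?subr_gt0//= divr_gt0// exprn_gt0.
pose K := 2 * mu + 2 * (mu + mu ^+ 2) / c.
pose g := 4 * t2 / t1.
pose K1 := 16 * M2 / t1 ^+ 2 + 2 / t1 + 1 / 2 + (4 * M2 + g ^+ 2) / t1.
pose K2 := 4 * (Num.sqrt (2 * M2) + 1).
have M20 : 0 < M2 by rewrite ltr_wpDl.
have M30 : 0 <= M3 by rewrite !addr_ge0// ?mulr_ge0// ltW.
have mu0 : 0 <= mu by rewrite addr_ge0// ltW.
have K0 : 0 <= K.
  have ci : 0 <= c^-1 by rewrite invr_ge0 ltW.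
  exact: addr_ge0 (mulr_ge0 _ mu0)
    (mulr_ge0 (mulr_ge0 _ (addr_ge0 mu0 (sqr_ge0 mu))) ci).
have K20 : 0 < K2 by rewrite mulr_gt0// ltr_wpDl// sqrtr_ge0.
have K10 : 0 <= K1.
  have t1i : 0 <= t1^-1 by rewrite invr_ge0 ltW.
  have t1i2 : 0 <= (t1 ^+ 2)^-1 by rewrite invr_ge0 sqr_ge0.
  have M2_0 := ltW M20.
  exact: addr_ge0 (addr_ge0 (addr_ge0 (mulr_ge0 (mulr_ge0 _ M2_0) t1i2)
    (mulr_ge0 _ t1i)) (divr_ge0 _ _)) (mulr_ge0 (addr_ge0 (mulr_ge0 _ M2_0) (sqr_ge0 g)) t1i).
(* For r <= 1 the error r K1 + 2 K (2 tau + 1/n), with r and 1/n at most K2 tau, yields the first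
   three terms. The last one serves r > 1, where 1 <= K2 tau and the difference is at most 2. *)
exists (K1 * K2 + 4 * K + 2 * (K * K2) + 2 * K2); split.
  by rewrite ltr_wpDl ?addr_ge0 ?mulr_ge0 ?(ltW K20)// mulr_gt0.
move=> [|[|k]]// beta a d W P Xi Pi _ be0 aE e1 iid law.
move=> eps m G t tau f Gt TVE fL f02.
set n := k.+2 in aE e1 iid law *.
rewrite [(n - 2)%N]subn2/= in TVE.
have [eps0 [cell [GE mcell celleps]]] := eps_partition_cell d0_le1 Gt.
have m0 : (0 < m)%N by case: (cell point) => i; exact: leq_ltn_trans.
have fin_le (S : set W) : measurable S -> (P S <= tau%:E)%E -> fine (P S) <= tau.
  by move=> mS h; rewrite -lee_fin fineK// fin_num_measure.
have mVk := measurable_pp_sum Xi k; have mVn := measurable_pp_sum Xi n.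
have kn : (k <= n)%N by rewrite /n; apply/leqW/leqW.
have mf := measurable_d1_lipschitz Tc fL.
have mfr := measurable_relocated f t mcell.
have f2 xi : `|f xi| <= 2 by have /andP[? ?] := f02 xi; rewrite ger0_norm.
have bndd d' (X : measurableType d') (P' : probability X R) (V : X -> config T)
    (h : config T -> R) : measurable_fun [set: config T] h ->
    (forall xi, `|h xi| <= 2) -> measurable_fun [set: X] V ->
    integ P' (fun w => h (V w)).
  move=> mh h2 mV; apply: (@integ_bounded _ _ _ _ _ 2) => //.
  exact: (measurableT_comp mh mV).
have [d' [W' [P' [Z [U [PZ PU indZU PiE]]]]]] := law.
have indU k' (A : 'I_k' -> set (borel T)) : (forall j, measurable (A j)) ->
    P' (\bigcap_(j in [set: 'I_k']) (U j @^-1` A j)) =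
    (\prod_(j < k') P' (U j @^-1` A j))%E.
  move=> mA; have := indZU [set: nat] k' A mA.
  by rewrite preimage_setT setTI probability_setT mul1e.
have mUb j y : measurable (U j @^-1` block cell t y).
  rewrite -[X in measurable X]setTI.
  exact: (measurable_funP (U j) measurableT _ (measurable_block t y mcell)).
pose mu' y := fine (pbd_mu Q palm beta n (block cell t y)).
have PUb j y : P' (U j @^-1` block cell t y) = (mu' y)%:E.
  have E := PU j _ (measurable_block t y mcell).
  by rewrite E fineK// -E fin_num_measure.
have mubE y : pbd_mu Q palm beta n (block cell t y) = (mu' y)%:E.
  by rewrite -(PUb 0%N) PU//; exact: measurable_block.
pose F j := EV P' (fun w => f (relocate (t \o cell) (point_sum U j w))).
pose L := size (centers t).
have L1 : 1 <= L%:R :> R.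
  rewrite ler1n; have : t (Ordinal m0) \in centers t.
    by rewrite mem_undup; apply: map_f; rewrite mem_enum.
  by rewrite /L; case: (centers t).
have n0 : 0 < n%:R :> R by rewrite ltr0n.
pose r := Num.sqrt (L%:R / n%:R) : R.
have Ln0 : 0 < L%:R / n%:R :> R by rewrite divr_gt0// (lt_le_trans ltr01).
have r0 : 0 < r by rewrite sqrtr_gt0.
have rL : r ^+ 2 * n%:R = L%:R by rewrite sqr_sqrtr ?(ltW Ln0)// divfK// gt_eqF.
have tau0 : 0 <= tau.
  have := TV_ge_point P mVk t (Ordinal m0) 0 GE mcell; rewrite TVE.
  by move/(le_trans (measure_ge0 _ _)); rewrite lee_fin.
have share : Num.min r 1 <= K2 * tau.
  apply: (block_share_le (M2 := M2) iid kn fin3 _ M20 mcell m0 r0 rL) => [|i j].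
    by have [_ -> _] := theta_moments fin3.
  apply: fin_le; last by rewrite -TVE; exact: TV_ge_point.
  exact: (measurable_cfg_count_comp mVk [set j] (measurable_block t _ mcell)).
have tvV : forall N, \sum_(0 <= s < N)
    `|delay (conv_power (mass_law Q) k) s - conv_power (mass_law Q) k s| <= 2 * tau.
  apply: (conv_power_mass_tv iid kn) => A.
  have mA (h : nat -> nat) : P [set w | A (h (mass (pp_sum Xi k w)))] \is a fin_num.
    by rewrite fin_num_measure//; exact: (measurable_mass_comp mVk (h @^-1` A)).
  rewrite -lee_fin -TVE -abse_EFin EFinB (fineK (mA S)) (fineK (mA id)).
  exact: TV_ge_mass.
have t_relocate xi : `|f xi - f (relocate (t \o cell) xi)| <= eps.
  by apply: le_trans (fL _ _) _; exact: d1_relocate.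
have stepV : `|EV P (fun w => f (pp_sum Xi n w))
    - EV P (fun w => f (relocate (t \o cell) (pp_sum Xi n w)))| <= eps.
  apply: EV_dist_le => [||w]; [exact: bndd|exact: (bndd _ _ P _ _ mfr)|exact: t_relocate].
have stepPi : `|EV Pi f - EV Pi (fun xi => f (relocate (t \o cell) xi))| <= eps.
  apply: EV_dist_le => [||w]; [exact: (bndd _ _ Pi id)|exact: (bndd _ _ Pi id _ mfr)|exact: t_relocate].
have gap := pbd_mu_block_gap palmP fin3 mcell be0 (isT : (2 <= n)%N) t10 mubE.
have stepF := relocated_mean_gap d0_le1 mcell m0 PUb indU fL f2 iid isT fin3 t10 gap r0 rL.
have stepS : `|EV P (fun w => F (mass (pp_sum Xi n w)))
    - EV Pi (fun xi => f (relocate (t \o cell) xi))| <= 2 * (K * (2 * tau + n%:R^-1)).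
  (* Stein's bound is for test functions in [0, 1], while [F] takes values in [0, 2]; hence the
     halving and the factor 2 outside. *)
  pose h j := EV P' (fun w => 2^-1 * f (relocate (t \o cell) (point_sum U j w))).
  have IU j : integ P' (fun w => f (relocate (t \o cell) (point_sum U j w))).
    apply: (@integ_bounded _ _ _ _ _ 2) => //.
    exact: measurable_relocate_point_sum.
  have hE j : h j = 2^-1 * F j by rewrite /h EVZ.
  have h01 j : 0 <= h j <= 1.
    have half_f xi : 0 <= 2^-1 * f xi <= 1.
      by have := f02 xi; clear; lra.
    rewrite EV_ge0/= => [|w]; last first.
      by case/andP: (half_f (relocate (t \o cell) (point_sum U j w))).
    rewrite -[leRHS](EV_cst P' 1); apply: EV_le => [||w].
    - exact: integZ.
    - exact: integ_cst.
    by case/andP: (half_f (relocate (t \o cell) (point_sum U j w))).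
  have ca : c * (n%:R * (1 + beta * n%:R)) <= a.
    rewrite aE mulrCA ler_wpM2l//.
    have n2 : 2 <= n%:R :> R by rewrite ler_nat.
    have bt2 : 0 <= beta * t2 by exact: mulr_ge0.
    have cl : c <= (1 - b) * t1 by rewrite ge_min lexx.
    have cr : c <= t1 ^+ 2 / 2 by rewrite ge_min lexx orbT.
    have := ler_wpM2l (mulr_ge0 be0 (ltW n0)) cr.
    have := mulr_ge0 be0 (sqr_ge0 t1); move: (t1 ^+ 2) => t12.
    move=> bt12; have := mulr_ge0 (_ : 0 <= n%:R - 2) bt12; rewrite subr_ge0 => /(_ n2).
    move: bt2 cl; move: (beta * t2) (n%:R : R); clear => *; lra.
  have a0 : 0 < a.
    by apply: lt_le_trans ca; rewrite !mulr_gt0// ltr_pwDl// mulr_ge0// ltW.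
  have [q0 qS q1] := pbd_law_weights a0 b0 be0 PZ.
  have [tm1 tm2 tm3] := theta_moments fin3.
  have PiE' A : measurable A -> P' (mixed_sum Z U @^-1` A) = Pi A.
    by move=> mA; rewrite PiE.
  have f01 xi : 0 <= 2^-1 * f xi <= 1 by have := f02 xi; clear; lra.
  have cPi := @EV_mixed_sum_cvg R T d' W' P' Z U _ cell t (fun xi => 2^-1 * f xi)
    Pi 1 indZU PiE' mcell f01.
  rewrite (_ : (fun j => _ * _) = (fun j => pbd a b beta j * h j)) in cPi; last first.
    by apply/funext => j; rewrite PZ.
  have mN : measurable_fun [set: W] (fun w => mass (pp_sum Xi n w)).
    exact: (measurableT_comp (@measurable_mass R T) mVn).
  have Ih : integ P (h \o (fun w => mass (pp_sum Xi n w))).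
    apply: (@integ_bounded _ _ _ _ _ 1) => [|w].
      exact: (measurableT_comp (g := fun w => mass (pp_sum Xi n w))).
    by have /andP[? ?] := h01 (mass (pp_sum Xi n w)); rewrite ger0_norm.
  have cE := EV_nat_cvg mN (fun j => proj1 (andP (h01 j))) Ih.
  rewrite (_ : (fun j => _ * _) = (fun j => conv_power (mass_law Q) n j * h j)) in cE; last first.
    by apply/funext => j; rewrite -(iid_pp_sum_law j iid (leqnn n)).
  have B := stein_bound (mass_law_ge0 Q) (mass_law_series1 Q)
    (mass_law_moment fin3 (isT : (1 <= 3)%N)) (mass_law_moment fin3 (isT : (2 <= 3)%N))
    (mass_law_moment fin3 (isT : (3 <= 3)%N)) a0 b0 (ltW b1) be0 q0 qS q1 h01 tvV.
  rewrite tm1 tm2 tm3 (cvg_lim (@Rhausdorff R) cPi) in B.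
  have e0 : order0_coef a b beta n%:R 1 t1 M2 = 0 by rewrite aE; exact: order0_coef_eq0.
  have {}B := B _ e0 e1 cE.
  have n2 : 2 <= n%:R :> R by rewrite ler_nat.
  have t1mu : 0 <= t1 <= mu.
    by rewrite ltW//= /mu /M2; move: t10 t20 M30; clear; lra.
  have M2mu : 0 <= M2 <= mu by rewrite ltW//= lerDl.
  have M3mu : 0 <= M3 <= mu by rewrite M30/= lerDr ltW.
  have b01 : 0 <= b <= 1 by rewrite b0 ltW.
  have R2 := stein_remainder_le c0 b01 be0 n2 ca t1mu M2mu M3mu
    (mulr_ge0 (ler0n R 2) tau0).
  have {R2}B := le_trans B R2.
  have IfrPi : integ Pi (fun xi => f (relocate (t \o cell) xi)).
    exact: (bndd _ _ Pi id _ mfr).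
  rewrite (EVZ 2^-1 IfrPi) in B.
  have -> : EV P (fun w => F (mass (pp_sum Xi n w))) =
      2 * EV P (h \o (fun w => mass (pp_sum Xi n w))).
    rewrite -(EVZ 2 Ih); congr (EV P _); apply/funext => w /=.
    by rewrite hE mulrA divff ?mul1r.
  have -> : EV Pi (fun xi => f (relocate (t \o cell) xi)) =
      2 * (2^-1 * EV Pi (fun xi => f (relocate (t \o cell) xi))).
    by rewrite mulrA divff ?mul1r.
  by rewrite -mulrBr normrM ger0_norm// ler_wpM2l.
have n1r : n%:R^-1 <= r ^+ 2.
  by rewrite sqr_sqrtr ?(ltW Ln0)// -[leLHS]mul1r ler_wpM2r// invr_ge0 ltW.
have D2 : `|EV P (fun w => f (pp_sum Xi n w)) - EV Pi f| <= 2.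
  have rng d0 (X : measurableType d0) (P0 : probability X R) (V : X -> config T) :
      measurable_fun [set: X] V -> 0 <= EV P0 (fun w => f (V w)) <= 2.
    move=> mV; rewrite EV_ge0/= => [|w]; last by case/andP: (f02 (V w)).
    rewrite -[leRHS](EV_cst P0 2); apply: EV_le => [||w]; [exact: bndd|exact: integ_cst|].
    by case/andP: (f02 (V w)).
  have /andP[u0 u2] := rng _ _ P _ mVn.
  have /andP[v0 v2] := rng _ _ Pi id (measurable_id (D := setT)).
  by rewrite ler_distl; move: u0 u2 v0 v2; clear; lra.
have tri : `|EV P (fun w => f (pp_sum Xi n w)) - EV Pi f| <=
    2 * eps + (r * K1 + 2 * (K * (2 * tau + n%:R^-1))).
  apply: le_trans (ler_distD (EV P (fun w => f (relocate (t \o cell) (pp_sum Xi n w)))) _ _) _.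
  rewrite mulr_natl mulr2n -addrA; apply: lerD => //.
  apply: le_trans (ler_distD (EV P (fun w => F (mass (pp_sum Xi n w)))) _ _) _.
  rewrite addrCA; apply: lerD => //.
  apply: le_trans (ler_distD (EV Pi (fun xi => f (relocate (t \o cell) xi))) _ _) _.
  by rewrite addrC; apply: lerD => //; rewrite distrC.
have [r1|r1] := leP r 1.
  have rK : r <= K2 * tau by move: share; rewrite (min_idPl r1).
  have nK : n%:R^-1 <= K2 * tau.
    apply: le_trans n1r _; apply: le_trans rK; rewrite expr2 -[leRHS]mul1r ler_wpM2r//.
    exact: ltW.
  apply: le_trans tri _; rewrite lerD2l.
  have k1 := ler_wpM2r K10 rK; have k2 := ler_wpM2l K0 nK.
  have k3 : 0 <= K2 * tau by rewrite mulr_ge0// ltW.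
  move: k1 k2 k3; clear; lra.
apply: le_trans D2 _.
have oneK : 1 <= K2 * tau by move: share; rewrite (min_idPr (ltW r1)).
have k1 := mulr_ge0 K10 (mulr_ge0 (ltW K20) tau0).
have k2 := mulr_ge0 K0 tau0.
have k3 := mulr_ge0 K0 (mulr_ge0 (ltW K20) tau0).
move: k1 k2 k3 oneK eps0; clear; lra.
Qed.

(** As d1 <= 1, a Lipschitz test function stays within 1 of its value at the empty configuration.
    Shifting that value to 1 puts the function into [0, 2], and the constant cancels in the
    difference. *)
Lemma d2_le_test (R : realType) (T : pointedMetricType R)
    (P1 P2 : probability (config T) R) c :
  compact [set: T] -> (forall x y : T, mdist x y <= 1) ->
  (forall f, (forall xi eta, `|f xi - f eta| <= d1 xi eta) ->
     (forall xi, 0 <= f xi <= 2) -> `|EV P1 f - EV P2 f| <= c) ->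
  (d2 P1 P2 <= c%:E)%E.
Proof.
move=> Tc d0_le1 test; apply: ge_ereal_sup => _ [f fL <-].
pose g xi := f xi - (f (@mset0 T) - 1).
have gL xi eta : `|g xi - g eta| <= d1 xi eta.
  by rewrite (_ : g xi - g eta = f xi - f eta) ?/g; [exact: fL|ring].
have mf := measurable_d1_lipschitz Tc fL; have mg := measurable_d1_lipschitz Tc gL.
have g02 xi : 0 <= g xi <= 2.
  have := le_trans (fL xi (@mset0 T)) (d1_eq_mass_le1 _ _ d0_le1).
  by rewrite ler_norml /g; move: (f xi) (f _); clear => u v; lra.
have Ig (P : probability (config T) R) : integ P g.
  apply: (@integ_bounded _ _ _ _ _ 2) => // xi.
  by have /andP[? ?] := g02 xi; rewrite ger0_norm.
have If (P : probability (config T) R) :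
    integ P f /\ EV P f = EV P g + (f (@mset0 T) - 1).
  rewrite (_ : f = fun xi => g xi + (f (@mset0 T) - 1)); last first.
    by apply/funext => xi; rewrite subrK.
  have Ic := integ_cst P (f (@mset0 T) - 1).
  by split; [exact: integD|rewrite EVD// EV_cst /g subrK].
have [I1 E1] := If P1; have [I2 E2] := If P2.
rewrite -!EV_EFin// -EFinB abse_EFin lee_fin E1 E2 opprD addrACA subrr addr0.
exact: test.
Qed.

(** * Infima over partitions, and the rate of the tail term *)

Lemma TV_ge0 (R : realType) (T : pointedMetricType R) d (W : measurableType d)
    (P : probability W R) (V : W -> config T) m (G : 'I_m -> set T) t :
  (0 <= TV P V G t)%E.
Proof. by rewrite /TV; elim/big_rec: _ => // i x _ x0; rewrite le_max x0 orbT. Qed.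

(** The first bound passes to the infimum over partitions. For v with vartheta_v <= 2 v it reads D
    <= 2 v + 2 C v = (C + 1) 2 v, and the infimum over such v gives the second. *)
Lemma eps_inf_bounds (R : realType) (T : pointedMetricType R) d (W : measurableType d)
    (P : probability W R) (V : W -> config T) (D : \bar R) (C : R) : 0 < C ->
  (forall eps m (G : 'I_m -> set T) t tau, eps_partition eps G t ->
     TV P V G t = tau%:E -> (D <= (2 * eps + C * tau)%:E)%E) ->
  (forall eps, D <= (2 * eps)%:E + C%:E * vartheta P V eps)%E /\
  (D <= (C + 1)%:E * (2%:E * eps_inf P V))%E.
Proof.
move=> C0 DTV.
have Dv eps : (D <= (2 * eps)%:E + C%:E * vartheta P V eps)%E.
  rewrite addeC -leeBlDr// -lee_pdivrMl//; apply: le_ereal_inf_tmp => _ [m [G [t [Gt ->]]]].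
  rewrite lee_pdivrMl// leeBlDr// addeC.
  case E : (TV P V G t) (TV_ge0 P V G t) => [tau||]// _.
    by rewrite -EFinM -EFinD; exact: DTV E.
  by rewrite gt0_muley ?lte_fin// addey// leey.
have C1 : 0 < C + 1 by rewrite addr_gt0.
split=> //; rewrite -lee_pdivrMl// -lee_pdivrMl//.
apply: le_ereal_inf_tmp => _ [v /= vv <-].
rewrite !lee_pdivrMl//; apply: le_trans (Dv v) _.
apply: (@le_trans _ _ ((2 * v)%:E + C%:E * (2 * v)%:E)%E).
  by apply: leeD2l; rewrite lee_pmul2l// lte_fin.
by rewrite -!EFinM -EFinD lee_fin; lra.
Qed.

(** psi^k is the smallest of the k + 1 terms of 1 + psi + ... + psi^k = (1 - psi^(k+1)) / (1 -
    psi). *)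
Lemma geometric_mulnS_le (R : realFieldType) (psi : R) k : 0 <= psi -> psi < 1 ->
  k.+1%:R * psi ^+ k * (1 - psi) <= 1.
Proof.
move=> p0 p1; have psi_le j : 0 <= psi ^+ j <= 1.
  by rewrite exprn_ge0//= exprn_ile1// ltW.
suff : k.+1%:R * psi ^+ k * (1 - psi) + psi ^+ k.+1 <= 1.
  by apply: le_trans; rewrite lerDl; case/andP: (psi_le k.+1).
elim: k => [|k IHk]; first by rewrite expr0 expr1; lra.
have /andP[u0 u1] := psi_le k.+1.
have := ler_wpM2l p0 IHk; have : psi ^+ k.+1 * (1 - psi) <= 1 - psi by rewrite ler_piMl//; lra.
rewrite -[k.+2%:R]natr1 !exprS; move: (psi ^+ k) (k.+1%:R : R); clear => *; lra.
Qed.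

Lemma tail_bigO (R : realType) (C phi : R) : 0 < phi < 1 ->
  (fun n => C * n%:R * phi ^+ ((n - 2)./2)) =O_\oo
  (fun n : nat => (Num.sqrt n%:R)^-1 : R).
Proof.
(* The square root splits the decay: n^2 phi^k is the square of n psi^k, which is bounded because n
   <= 3 (k + 1). Thus n phi^k = O(1/n), more than required. *)
move=> /andP[phi0 phi1]; set psi := Num.sqrt phi.
have psi0 : 0 <= psi := sqrtr_ge0 _.
have psi2 : psi ^+ 2 = phi by rewrite sqr_sqrtr// ltW.
have psi1 : psi < 1.
  by rewrite -(ltr_pXn2r (n := 2)) ?nnegrE// psi2 expr1n.
pose B := 3 / (1 - psi); have B0 : 0 < B by rewrite divr_gt0// subr_gt0.
apply/eqO_exP; exists ((`|C| + 1) * B ^+ 2); first by rewrite mulr_gt0 ?exprn_gt0// ltr_wpDl.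
apply: nearW => n; case: n => [|n]; first by rewrite mulr0 mul0r normr0 sqrtr0 invr0 normr0 mulr0.
set k := (n.+1 - 2)./2; set N : R := n.+1%:R.
have N0 : 0 < N by rewrite ltr0n.
have N1 : 1 <= N by rewrite ler1n.
have Nk : N <= 3 * k.+1%:R.
  rewrite -natrM ler_nat /k.
  have := odd_double_half (n.+1 - 2); rewrite -addnn.
  by move: (odd _) (_./2) => o h; case: o; lia.
have NB : N * psi ^+ k <= B.
  rewrite ler_pdivlMr ?subr_gt0//.
  have := geometric_mulnS_le k psi0 psi1.
  have := ler_wpM2r (mulr_ge0 (exprn_ge0 k psi0) (_ : 0 <= 1 - psi)) Nk.
  by rewrite subr_ge0 ltW// => /(_ isT); rewrite !mulrA; lra.
have NB2 : N ^+ 2 * phi ^+ k <= B ^+ 2.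
  rewrite -psi2 -exprM mulnC exprM -exprMn.
  by apply: lerXn2r; rewrite // nnegrE ?(ltW B0)// mulr_ge0 ?(ltW N0)// exprn_ge0.
have sN : Num.sqrt N <= N.
  rewrite -[leRHS](sqr_sqrtr (ltW N0)) expr2 ler_peMl ?sqrtr_ge0//.
  by rewrite -[leLHS]sqrtr1 ler_sqrt.
have s0 : 0 < Num.sqrt N by rewrite sqrtr_gt0.
have ph0 : 0 <= phi ^+ k by rewrite exprn_ge0// ltW.
rewrite [leRHS](_ : _ = (`|C| + 1) * B ^+ 2 / Num.sqrt N); last first.
  by congr (_ * _); rewrite ger0_norm// invr_ge0 ltW.
rewrite ler_pdivlMr//.
rewrite !normrM (ger0_norm ph0) (ger0_norm (ltW N0)).
have h1 : N * phi ^+ k * Num.sqrt N <= B ^+ 2.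
  apply: le_trans NB2; rewrite expr2 -mulrA [phi ^+ k * _]mulrC mulrA.
  by rewrite ler_wpM2r// ler_wpM2l// ltW.
rewrite -!mulrA; apply: ler_pM => //; [|by rewrite lerDl|by rewrite !mulrA].
by rewrite !mulr_ge0// ltW.
Qed.

(** A mass with mean 0 is almost surely 0; this excludes Case 2 when theta_1 vanishes. *)
Lemma theta_eq0 (R : realType) (T : pointedMetricType R)
    (Q : probability (config T) R) r : (factorial_moment Q 3 < +oo)%E ->
  theta Q 1 = 0 -> theta Q r.+1 = 0.
Proof.
move=> fin3 t10.
have I1 : integ Q (fun xi => (mass xi)%:R).
  by have := integ_mass_pow (isT : (1 <= 3)%N) fin3; under eq_fun do rewrite expr1.
have [M1 _ _] := theta_moments fin3.
have mm : measurable_fun [set: config T] (EFin \o (fun xi => (mass xi)%:R : R)).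
  by apply/measurable_EFinP; exact: measurable_massR.
have /(ae_eq_integral_abs Q measurableT mm) ae0 :
    (\int[Q]_xi `|(EFin \o (fun xi : config T => (mass xi)%:R : R)) xi| = 0)%E.
  rewrite -[RHS]/(0%:E) -t10 -M1.
  rewrite (@EV_eq _ _ _ Q _ (fun xi => (mass xi)%:R)); last by move=> xi; rewrite expr1.
  by rewrite EV_EFin//; apply: eq_integral => xi _ /=; rewrite ger0_norm.
rewrite /theta /factorial_moment unlock (ae_eq_integral (cst 0%E))//.
- by rewrite integral_cst// mul0e.
- apply/measurable_EFinP.
  apply: (measurableT_comp (f := fun i : nat => (i ^_ r.+1)%:R : R)) => //.
  exact: measurable_mass.
- apply: filterS ae0 => xi /= h _; have := h Logic.I.
  by case=> /eqP; rewrite pnatr_eq0 => /eqP ->; rewrite ffact0n.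
Qed.

Theorem theorem2p2 (R : realType) (T : pointedMetricType R)
  (T_compact : compact [set: T])
  (d0_le1 : forall x y : T, mdist x y <= 1)
  (Q : probability (config T) R)
  (palm : R.-pker (borel T) ~> config T)
  (palmP : reduced_palm Q palm)
  (theta3_fin : (factorial_moment Q 3 < +oo)%E)
  (b : R) (beta : nat -> R) (n_range : set nat)
  (cases :
    [/\ (mean_mass Q <= var_mass Q)%E,
        b = (theta Q 2 - theta Q 1 ^+ 2)
            / (theta Q 2 - theta Q 1 ^+ 2 + theta Q 1),
        forall n, beta n = 0 &
        n_range = [set n | (2 < n)%N]]
    \/
    [/\ (2^-1%:E * mean_mass Q < var_mass Q)%E /\
          (var_mass Q < mean_mass Q)%E
        \/ (2^-1%:E * mean_mass Q = var_mass Q)%E /\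
          theta Q 2 * (theta Q 1 - 1) < theta Q 3,
        b = 0,
        forall n, beta n =
          (theta Q 1 ^+ 2 - theta Q 2)
          / ((n%:R - 1) * theta Q 1
               * (theta Q 1 - 2 * (theta Q 1 ^+ 2 - theta Q 2))
             + (theta Q 3 + theta Q 2 - theta Q 1 * theta Q 2)) &
        (* in the second alternative of this case the denominator is 0, and
           x / 0 = 0 gives the same maximum as reading the fraction as -oo *)
        n_range = [set n : nat | 1 + Num.max
          ((theta Q 1 * theta Q 2 - theta Q 2 - theta Q 3)
           / (theta Q 1 * (theta Q 1 - 2 * (theta Q 1 ^+ 2 - theta Q 2)))) 0
          < n%:R]]) :
  let a (n : nat) : R :=
    n%:R * ((1 - b) * theta Q 1 + beta n * theta Q 2
            + beta n * (n%:R - 1) * theta Q 1 ^+ 2) in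
  exists (C rho : R) (r : nat -> R),
  [/\ 0 < C, 0 < rho < 1,
      r =O_\oo (fun n : nat => (Num.sqrt n%:R)^-1 : R) &
      forall n : nat, n_range n ->
      forall (d : measure_display) (W : measurableType d) (P : probability W R)
        (Xi : nat -> {RV P >-> config T}), iid_with_law P n Xi Q ->
      forall Pi : probability (config T) R,
        pbd_process_law (a n) b (beta n) (pbd_mu Q palm (beta n) n) Pi ->
      let D := d2 (distribution P (pp_sum Xi n)) Pi in
      let V := pp_sum Xi (n - 2) in
      let tail := P [set w | (\sum_(k < (n - 2)%N) mass (Xi k w))%N%:R
                             <= rho * (n - 2)%:R * theta Q 1] in
      (forall eps : R, 0 < eps ->
         (D <= (2 * eps)%:E + C%:E * vartheta P V eps
               + (C * n%:R)%:E * tail)%E /\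
         ((2 * eps)%:E + C%:E * vartheta P V eps + (C * n%:R)%:E * tail
            <= (2 * eps)%:E + C%:E * vartheta P V eps + (r n)%:E)%E) /\
      (D <= (C + 1)%:E * (2%:E * eps_inf P V) + (C * n%:R)%:E * tail)%E /\
      ((C + 1)%:E * (2%:E * eps_inf P V) + (C * n%:R)%:E * tail
         <= (C + 1)%:E * (2%:E * eps_inf P V) + (r n)%:E)%E].
Proof.
move=> a.
have t1_ge0 : 0 <= theta Q 1 := theta_ge0 Q 1.
(* If theta_1 = 0, then in Case 1 the normalising factor of [pbd_mu] is the inverse of 0, which is
   0; the measure is null, cannot be the law of a point, and so no admissible [Pi] exists. Case 2
   contradicts its strict inequalities. *)
have [t10|t1_neq0] := eqVneq (theta Q 1) 0.
  case: cases => [[_ _ be _]|[disp _ _ _]].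
    exists 1, 2^-1, (fun=> 0); split=> //.
    - by apply/andP; split; lra.
    - apply/eqO_exP; exists 1 => //; apply: nearW => n.
      by rewrite normr0 mul1r normr_ge0.
    move=> n _ d W P Xi _ Pi [d' [W' [P' [Z [U [_ PU _ _]]]]]].
    have := PU 0%N [set: borel T] measurableT.
    rewrite preimage_setT probability_setT /pbd_mu be t10 !mul0r addr0 invr0.
    under eq_integral do rewrite mule0.
    by rewrite integral0 => -[] /eqP; rewrite oner_eq0.
  have t20 := theta_eq0 1 theta3_fin t10; have t30 := theta_eq0 2 theta3_fin t10.
  exfalso; move: disp; rewrite mean_massE// var_massE// t10 t20 t30 expr0n/=.
  by rewrite !addr0 subr0 mul0r mule0 !ltxx => -[[]|[]].
have t10 : 0 < theta Q 1 by rewrite lt_neqAle eq_sym t1_neq0.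
have [b0 b1 ncase] := dispersion_cases theta3_fin cases t10.
have [rho [phi [rho01 phi01 tailP]]] := mass_tail theta3_fin t10.
have [C [C0 test]] := partition_test_bound T_compact d0_le1 palmP theta3_fin t10 b0 b1.
(* The remainder is C n times the exponential bound of [mass_tail] for n - 2 summands. *)
exists C, rho, (fun n => C * n%:R * phi ^+ ((n - 2)./2)); split=> //.
  exact: tail_bigO.
move=> n nr d W P Xi iid Pi law D V tail.
have [n2 be0 e1] := ncase n nr.
have DTV eps m (G : 'I_m -> set T) t tau : eps_partition eps G t ->
    TV P V G t = tau%:E -> (D <= (2 * eps + C * tau)%:E)%E.
  move=> Gt TVE; apply: d2_le_test => // f fL f02.
  have If : integ (distribution P (pp_sum Xi n)) f.
    apply: (@integ_bounded _ _ _ _ _ 2) => [|xi].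
      exact: measurable_d1_lipschitz.
    by have /andP[? ?] := f02 xi; rewrite ger0_norm.
  have lawV A : measurable A -> P ((pp_sum Xi n : {mfun W >-> config T}) @^-1` A)
      = distribution P (pp_sum Xi n) A by [].
  have [_ <-] := EV_comp lawV If.
  exact: (test _ _ _ _ _ _ _ _ n2 be0 erefl e1 iid law _ _ _ _ _ _ Gt TVE fL f02).
have [Dv De] := eps_inf_bounds C0 DTV.
have Cn0 : (0 <= (C * n%:R)%:E)%E by rewrite lee_fin mulr_ge0// ltW.
have tail0 : (0 <= (C * n%:R)%:E * tail)%E by apply: mule_ge0 => //; exact: measure_ge0.
have tail1 : ((C * n%:R)%:E * tail <= (C * n%:R * phi ^+ ((n - 2)./2))%:E)%E.
  rewrite (EFinM (C * n%:R)); apply: (lee_wpmul2l Cn0).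
  exact: tailP iid (leq_subr _ _).
split; [move=> eps _; split|split].
- by apply: le_trans (Dv eps) _; rewrite leeDl.
- exact: leeD2l.
- by apply: le_trans De _; rewrite leeDl.
- exact: leeD2l.
Qed.
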